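(* For each $\Lambda\in X$, the sequences $\{G_{n,\Lambda}^{\pm}\}_{n\ge1}$ converge uniformly on compact subsets of $\mathbb{C}^2$, as $n\to\infty$, to locally H\''older continuous plurisubharmonic functions $G_\Lambda^{\pm}$ which satisfy $$G_\Lambda^{\pm}\circ H_\lambda^{\pm1}=d\,G_{\lambda\Lambda}^{\pm}$$ for every $\lambda\in M$. Moreover, $G_\Lambda^{\pm}$ are strictly positive pluriharmonic functions on $\mathbb{C}^2\setminus K_\Lambda^{\pm}$ and vanish precisely on $K_\Lambda^{\pm}$. Moreover, the correspondence $\Lambda\mapsto G_\Lambda^{\pm}$ is continuous on $X$ (for the topology of uniform convergence on compact subsets of $\mathbb{C}^2$).
   Context: $M$ is a compact set in $\mathbb{C}^k$ and $X=\prod_{i=1}^\infty M$ with the product topology. Fix $m\ge1$ and integers $d_1,\dots,d_m\ge2$, and put $d=d_1\cdots d_m$. For $\lambda\in M$ and $1\le j\le m$ let $H_\lambda^{(j)}(x,y)=(y,\,p_{j,\lambda}(y)-a_j(\lambda)x)$ on $\mathbb{C}^2$, where $p_{j,\lambda}$ is a monic polynomial of degree $d_j$ whose coefficients are continuous functions of $\lambda\in M$ and $a_j$ is a continuous nowhere vanishing function on $M$; let $H_\lambda=H_\lambda^{(m)}\circ\cdots\circ H_\lambda^{(1)}$. For $\Lambda=(\lambda_1,\lambda_2,\dots)\in X$ and $\lambda\in M$ write $\lambda\Lambda=(\lambda,\lambda_1,\lambda_2,\dots)$. For $n\ge1$ let $H_{n,\Lambda}^{\pm}=H_{\lambda_n}^{\pm1}\circ\cdots\circ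 H_{\lambda_1}^{\pm1}$ and $$G_{n,\Lambda}^{\pm}(z)=\frac1{d^n}\log^+\|H_{n,\Lambda}^{\pm}(z)\|,\qquad \log^+t=\max\{\log t,0\}.$$ Let $K_\Lambda^{\pm}=\{z\in\mathbb{C}^2:\ (H_{n,\Lambda}^{\pm}(z))_{n}\text{ is bounded in }\mathbb{C}^2\}$. *)

(* Defs.v *)
From HB Require Import structures.
From mathcomp Require Import all_boot all_order all_algebra.
From mathcomp Require Import complex.
From mathcomp Require Import all_classical all_reals all_analysis.

Set Implicit Arguments.
Unset Strict Implicit.
Unset Printing Implicit Defensive.

Import Order.TTheory GRing.Theory Num.Theory.
Import numFieldNormedType.Exports.

Local Open Scope classical_set_scope.
Local Open Scope ring_scope.

(* MathComp-Analysis equips every [numFieldType] with its norm topology, but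
   declares no topology on [R[i]] itself; naming [R[i]] as a [numFieldType]
   makes that topology available. *)
Definition Cplx (R : realType) : numFieldType := R[i]%C.

Definition C2 (R : realType) : normedModType (Cplx R) :=
  (Cplx R * Cplx R)%type.

Definition toC {R : realType} (t : R) : Cplx R := Complex t 0.

Definition iunit {R : realType} : Cplx R := Complex 0 1.

Definition cis {R : realType} (t : R) : Cplx R := Complex (cos t) (sin t).

(* The norm of the product type [C2 R] is the sup norm (with values in the
   complex field), whereas this is the Euclidean one. *)
Definition enorm {R : realType} (z : C2 R) : R :=
  Num.sqrt (complex.Re `|z.1| ^+ 2 + complex.Re `|z.2| ^+ 2).

(* [ln 0 = 0] in the library, so [logp 0 = 0] as it should be. *)
Definition logp {R : realType} (t : R) : R := Num.max (ln t) 0.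

Definition henon {R : realType} (p : {poly Cplx R}) (a : Cplx R) (z : C2 R) :
  C2 R := (z.2, p.[z.2] - a * z.1).

Definition henon_inv {R : realType} (p : {poly Cplx R}) (a : Cplx R)
  (z : C2 R) : C2 R := ((p.[z.1] - z.2) / a, z.1).

(* The index [j : 'I_m] stands for [j + 1] in [1, ..., m], and the map of
   index [0] is applied first. *)
Definition henon_comp {R : realType} {T : Type} {m : nat}
    (p : 'I_m -> T -> {poly Cplx R}) (a : 'I_m -> T -> Cplx R)
    (l : T) (z : C2 R) : C2 R :=
  foldl (fun w j => henon (p j l) (a j l) w) z (enum 'I_m).

Definition henon_comp_inv {R : realType} {T : Type} {m : nat}
    (p : 'I_m -> T -> {poly Cplx R}) (a : 'I_m -> T -> Cplx R)
    (l : T) (z : C2 R) : C2 R :=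
  foldr (fun j w => henon_inv (p j l) (a j l) w) z (enum 'I_m).

Lemma henonK (R : realType) (p : {poly Cplx R}) (a : Cplx R) :
  a != 0 -> cancel (henon p a) (henon_inv p a).
Proof.
by move=> a0 [x y]; rewrite /henon /henon_inv /= subKr mulrC mulKf.
Qed.

Lemma henon_invK (R : realType) (p : {poly Cplx R}) (a : Cplx R) :
  a != 0 -> cancel (henon_inv p a) (henon p a).
Proof.
by move=> a0 [x y]; rewrite /henon /henon_inv /= mulrC mulfVK // subKr.
Qed.

Lemma henon_compK (R : realType) (T : Type) (m : nat)
    (p : 'I_m -> T -> {poly Cplx R}) (a : 'I_m -> T -> Cplx R) (l : T) :
  (forall j, a j l != 0) ->
  cancel (henon_comp p a l) (henon_comp_inv p a l).
Proof.
move=> a0 z; rewrite /henon_comp /henon_comp_inv.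
by elim: (enum 'I_m) z => //= j s IHs z; rewrite IHs henonK.
Qed.

Lemma henon_comp_invK (R : realType) (T : Type) (m : nat)
    (p : 'I_m -> T -> {poly Cplx R}) (a : 'I_m -> T -> Cplx R) (l : T) :
  (forall j, a j l != 0) ->
  cancel (henon_comp_inv p a l) (henon_comp p a l).
Proof.
move=> a0 z; rewrite /henon_comp /henon_comp_inv.
by elim: (enum 'I_m) z => //= j s IHs z; rewrite henon_invK.
Qed.

(* The sign [s] is [false] for [+] and [true] for [-]. *)
Definition henon_sgn {R : realType} {T : Type} {m : nat}
    (p : 'I_m -> T -> {poly Cplx R}) (a : 'I_m -> T -> Cplx R)
    (s : bool) (l : T) : C2 R -> C2 R :=
  if s then henon_comp_inv p a l else henon_comp p a l.

(* [L n] stands for [lambda_(n+1)]; hence [iterH p a s n L] is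
   the composition of the maps of [lambda_1], ..., [lambda_n], that of
   [lambda_1] being applied first. *)
Fixpoint iterH {R : realType} {T : Type} {m : nat}
    (p : 'I_m -> T -> {poly Cplx R}) (a : 'I_m -> T -> Cplx R)
    (s : bool) (n : nat) (L : nat -> T) (z : C2 R) : C2 R :=
  if n is n'.+1 then henon_sgn p a s (L n') (iterH p a s n' L z) else z.

Definition greenn {R : realType} {T : Type} {m : nat}
    (d : 'I_m -> nat) (p : 'I_m -> T -> {poly Cplx R})
    (a : 'I_m -> T -> Cplx R) (s : bool) (n : nat) (L : nat -> T)
    (z : C2 R) : R :=
  logp (enorm (iterH p a s n L z)) / ((\prod_j d j) ^ n)%N%:R.

Definition Kset {R : realType} {T : Type} {m : nat}
    (p : 'I_m -> T -> {poly Cplx R}) (a : 'I_m -> T -> Cplx R)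
    (s : bool) (L : nat -> T) : set (C2 R) :=
  [set z | exists B : R, forall n, enorm (iterH p a s n L z) <= B].

Definition seq_cons {T : Type} (l : T) (L : nat -> T) (n : nat) : T :=
  if n is n'.+1 then L n' else l.

Definition locally_holder {R : realType} (u : C2 R -> R) : Prop :=
  forall z : C2 R, exists2 alpha : R, 0 < alpha <= 1 &
    exists c : R, \forall z1 & z2 \near z,
      `|u z1 - u z2| <= c * enorm (z1 - z2) `^ alpha.

(* Plurisubharmonicity on the whole of C^2: upper semicontinuity, values in
   [-oo, +oo), and the sub-mean value inequality over the circles of every
   complex line [zeta |-> z + zeta *: b] (the radius is absorbed in [b]). *)
Definition plurisubharmonic {R : realType} (u : C2 R -> \bar R) : Prop :=
  [/\ lower_semicontinuous (fun z => - u z)%E,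
      forall z, (u z < +oo)%E &
      forall z b : C2 R,
        (u z <= ((2 * pi)^-1)%:E *
          \int[lebesgue_measure]_(t in `[0%R, (2 * pi)%R]) u (z + cis t *: b)%R)%E].

(* Derivatives along real directions, C^2 being seen as R^4. *)
Definition real_derivable {R : realType} (u : C2 R -> R) (v z : C2 R) : Prop :=
  derivable (fun t : R => u (z + toC t *: v)) 0 1.

Definition real_derive {R : realType} (u : C2 R -> R) (v z : C2 R) : R :=
  derive1 (fun t : R => u (z + toC t *: v)) 0.

Definition classC1 {R : realType} (O : set (C2 R)) (u : C2 R -> R) : Prop :=
  forall v z, O z ->
    real_derivable u v z /\ {for z, continuous (real_derive u v)}.

Definition classC2 {R : realType} (O : set (C2 R)) (u : C2 R -> R) : Prop :=
  classC1 O u /\ forall v, classC1 O (real_derive u v).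

(* The last clause says that the Laplacian of [zeta |-> u (z + zeta *: b)] at
   [zeta = 0] vanishes, i.e. that [u] is harmonic along complex lines. *)
Definition pluriharmonic {R : realType} (O : set (C2 R)) (u : C2 R -> R) :
    Prop :=
  [/\ open O,
      classC2 O u &
      forall z b, O z ->
        real_derive (real_derive u b) b z +
        real_derive (real_derive u (iunit *: b)) (iunit *: b) z = 0].

(* Main.v *)
Require Import Defs.
From HB Require Import structures.
From mathcomp Require Import all_boot all_order all_algebra.
From mathcomp Require Import complex ring lra zify.
From mathcomp Require Import all_classical all_reals all_analysis.

(** Why the theorem holds.

    Conjugating by the exchange of coordinates for the minus sign, and splitting
    each map into its [m] factors, both families of iterates become orbits of a
    nonautonomous scalar recurrence
      [y_(k+1) = q_k(y_k) - b_k y_(k-1)],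
    seen through the pairs [(y_(k-1), y_k)]. Compactness of the parameter space
    puts all these recurrences in one class [recurrence_class A E], and every
    estimate is uniform on such a class.

    Convergence. When [|y_k|] is large and at least [|y_(k-1)|] the leading term
    of [q_k] dominates, the condition persists and the orbit escapes; until then
    the orbit stays in a fixed bidisc ([escaping_or_bounded]). Hence one step
    raises the height [max(1, |y_(k-1)|, |y_k|)] to the power [e_k], up to a
    bounded factor. Its logarithm divided by [e_0 ... e_(k-1)] is thus Cauchy
    with error [O(2 ^ -k)], uniformly on bounded sets and on the class
    ([green_err]). The limit is positive exactly when the orbit escapes, that is
    off the filled set ([green_gt0P]).

    Hoelder continuity. A step multiplies the distance of two orbits, measured
    relatively to the height, by at most a constant [L] as long as this ratio is
    at most 1. So points at distance at most [L ^ -k] have nearly equal heights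
    at time [k], and their Green functions differ by [O(2 ^ -k)]
    ([green_holder]).

    Plurisubharmonicity. Along a complex line the orbit is polynomial. Over the
    vertices of a regular polygon with [N] vertices a polynomial [f] multiplies
    to at least a constant times [|f(0)| ^ N], by the factorization of
    [X ^ N - 1] at each root. As [N] grows this gives the sub-mean value
    inequality for [ln |f|] from Riemann sums of any continuous majorant
    ([poly_sub_mean]), then for the heights, and for the limit by uniformity.

    Pluriharmonicity. Where the orbit escapes the limit is that of [ln |y_k|]
    over the degrees. Its derivatives are governed by the logarithmic derivatives
    [u_k = D y_k / y_k] and by their own derivatives. Euler's relation for the
    leading term shows that a step multiplies them by [e_k] up to an error of
    relative size [1 / |y_k|], and [|y_k|] grows geometrically
    ([logder_step], [logder2_step]). After division by the degrees both
    sequences converge locally uniformly, so the limit is of class C^2 with the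
    expected derivatives, and the Laplacian along a complex line vanishes
    because it does for each [ln |y_k|] ([pluriharmonic_green]).

    Dependence on the sequence. The coefficients at each time are continuous in
    the sequence of parameters for the product topology; uniform convergence
    makes the limit jointly continuous in the point and in the sequence
    ([cvg_green]), and compactness of the set of points gives uniformity. *)

Set Implicit Arguments.
Unset Strict Implicit.
Unset Printing Implicit Defensive.

Import Order.TTheory GRing.Theory Num.Theory.
Import numFieldNormedType.Exports.

Local Open Scope classical_set_scope.
Local Open Scope ring_scope.

(** * Real-valued moduli and the topology of C and C^2 *)

(** The norm of [Cplx R] takes its values in [Cplx R]; estimates need it as a
    real number. *)
Definition cabs {R : realType} (x : Cplx R) : R := complex.Re `|x|.

(** The sup norm makes the estimates on both coordinates symmetric; it is
    equivalent to [enorm] ([csup_enorm], [enorm_csup]). *)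
Definition csup {R : realType} (z : C2 R) : R := Num.max (cabs z.1) (cabs z.2).

Section Modulus.
Context {R : realType}.
Implicit Types (x y : Cplx R) (z w : C2 R) (r : R).

Lemma cabsE x : `|x| = toC (cabs x) :> Cplx R.
Proof. by rewrite /cabs /toC; case: x => a b; rewrite normc_def. Qed.

Lemma toC_inj : injective (@toC R).
Proof. by move=> r s []. Qed.

Lemma toC_le r s : (toC r <= toC s) = (r <= s).
Proof. exact: lecR. Qed.

Lemma toC_lt r s : (toC r < toC s) = (r < s).
Proof. exact: ltcR. Qed.

Lemma toCD r s : toC (r + s) = toC r + toC s.
Proof. exact: (rmorphD (@real_complex R)). Qed.

Lemma toCM r s : toC (r * s) = toC r * toC s.
Proof. exact: (rmorphM (@real_complex R)). Qed.

Lemma toC0 : toC 0 = 0 :> Cplx R. Proof. by []. Qed.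
Lemma toC1 : toC 1 = 1 :> Cplx R. Proof. by []. Qed.

Lemma cabs_ge0 x : 0 <= cabs x.
Proof. by rewrite -toC_le -cabsE normr_ge0. Qed.

Lemma cabs0 : cabs (0 : Cplx R) = 0.
Proof. by apply: toC_inj; rewrite -cabsE normr0. Qed.

Lemma cabs1 : cabs (1 : Cplx R) = 1.
Proof. by apply: toC_inj; rewrite -cabsE normr1. Qed.

Lemma cabs_eq0 x : (cabs x == 0) = (x == 0).
Proof.
by rewrite -[RHS]normr_eq0 cabsE; apply/eqP/eqP => [->//|]; exact: toC_inj.
Qed.

Lemma cabs_gt0 x : (0 < cabs x) = (x != 0).
Proof. by rewrite lt0r cabs_eq0 cabs_ge0 andbT. Qed.

Lemma cabsM x y : cabs (x * y) = cabs x * cabs y.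
Proof. by apply: toC_inj; rewrite toCM -!cabsE normrM. Qed.

Lemma cabsN x : cabs (- x) = cabs x.
Proof. by rewrite /cabs normrN. Qed.

Lemma cabsBC x y : cabs (x - y) = cabs (y - x).
Proof. by rewrite /cabs distrC. Qed.

Lemma cabsX x n : cabs (x ^+ n) = cabs x ^+ n.
Proof. by elim: n => [|n IH]; rewrite ?expr0 ?cabs1 // !exprS cabsM IH. Qed.

Lemma cabsV x : cabs x^-1 = (cabs x)^-1.
Proof.
have [->|x0] := eqVneq x 0; first by rewrite invr0 cabs0 invr0.
have cx0 : cabs x != 0 by rewrite cabs_eq0.
by apply: (mulIf cx0); rewrite -cabsM mulVf // cabs1 mulVf.
Qed.

Lemma cabsf x y : cabs (x / y) = cabs x / cabs y.
Proof. by rewrite cabsM cabsV. Qed.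

Lemma cabsD x y : cabs (x + y) <= cabs x + cabs y.
Proof. by rewrite -toC_le toCD -!cabsE ler_normD. Qed.

Lemma cabsB x y : cabs (x - y) <= cabs x + cabs y.
Proof. by rewrite -(cabsN y) cabsD. Qed.

Lemma cabs_lerB x y : cabs x - cabs y <= cabs (x - y).
Proof. by rewrite lerBlDr -{1}(subrK y x) cabsD. Qed.

Lemma cabs_dist x y : `|cabs x - cabs y| <= cabs (x - y).
Proof.
rewrite ler_norml cabs_lerB andbT lerNl opprB cabsBC; exact: cabs_lerB.
Qed.

Lemma cabs_sum n (F : 'I_n -> Cplx R) :
  cabs (\sum_(i < n) F i) <= \sum_(i < n) cabs (F i).
Proof.
elim/big_ind2: _ => [|r1 x1 r2 x2 h1 h2|//]; first by rewrite cabs0.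
exact: le_trans (cabsD _ _) (lerD h1 h2).
Qed.

Lemma cabs_toC r : cabs (toC r) = `|r|.
Proof. by rewrite /cabs /toC normc_def /= expr0n /= addr0 sqrtr_sqr. Qed.

Lemma cabs_nat n : cabs (n%:R : Cplx R) = n%:R.
Proof.
have -> : (n%:R : Cplx R) = toC n%:R.
  by elim: n => // n IH; rewrite !mulrS IH toCD.
by rewrite cabs_toC normr_nat.
Qed.

Lemma cabs_sqr x : cabs x ^+ 2 = complex.Re x ^+ 2 + complex.Im x ^+ 2.
Proof.
case: x => a b; rewrite /cabs normc_def /= sqr_sqrtr //.
by rewrite addr_ge0 // sqr_ge0.
Qed.

Lemma ReD x y : complex.Re (x + y) = complex.Re x + complex.Re y.
Proof. by case: x => a b; case: y. Qed.

Lemma ReB x y : complex.Re (x - y) = complex.Re x - complex.Re y.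
Proof. by case: x => a b; case: y. Qed.

Lemma ReN x : complex.Re (- x) = - complex.Re x.
Proof. by case: x. Qed.

Lemma Re_cabs x : `|complex.Re x| <= cabs x.
Proof.
rewrite -(ler_pXn2r (n := 2)) ?nnegrE ?cabs_ge0 // cabs_sqr.
by rewrite real_normK ?num_real // lerDl sqr_ge0.
Qed.

Lemma toC_ball x (P : set (Cplx R)) :
  nbhs x P <-> exists2 e : R, 0 < e & forall y, cabs (y - x) < e -> P y.
Proof.
split=> [/nbhs_normP[e /= e0 eP]|[e e0 eP]].
  have eR : e = toC (complex.Re e).
    by move: e0; case: (e) => a b; rewrite ltcE /= => /andP[/eqP-> _].
  exists (complex.Re e); first by rewrite -toC_lt -eR.
  by move=> y yx; apply: eP; rewrite /ball_ /= distrC cabsE eR toC_lt.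
apply/nbhs_normP; exists (toC e) => /=; first by rewrite toC_lt.
by move=> y; rewrite /ball_ /= distrC cabsE toC_lt; exact: eP.
Qed.

Lemma cvg_cabsP T (F : set_system T) (FF : Filter F) (f : T -> Cplx R) x :
  f @ F --> x <-> forall e : R, 0 < e -> \forall t \near F, cabs (f t - x) < e.
Proof.
split=> [fx e e0|H P /toC_ball[e e0 eP]].
  by apply: (fx [set y | cabs (y - x) < e]); apply/toC_ball; exists e.
by apply: filterS (H _ e0) => t; exact: eP.
Qed.

Lemma cvg_cabs T (F : set_system T) (FF : Filter F) (f : T -> Cplx R) x :
  f @ F --> x -> (fun t => cabs (f t)) @ F --> cabs x.
Proof.
move=> /cvg_cabsP fx; apply/cvgrPdist_lt => e /fx.
apply: filterS => t; rewrite distrC; exact: le_lt_trans (cabs_dist _ _).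
Qed.

Lemma cvg_Re T (F : set_system T) (FF : Filter F) (f : T -> Cplx R) x :
  f @ F --> x -> (fun t => complex.Re (f t)) @ F --> complex.Re x.
Proof.
move=> /cvg_cabsP fx; apply/cvgrPdist_lt => e /fx.
by apply: filterS => t; rewrite distrC -ReB; exact: le_lt_trans (Re_cabs _).
Qed.

Lemma cvg_complex T (F : set_system T) (FF : Filter F) (f g : T -> R) a b :
  f @ F --> a -> g @ F --> b ->
  (fun t => Complex (f t) (g t) : Cplx R) @ F --> (Complex a b : Cplx R).
Proof.
move=> /cvgrPdist_lt fa /cvgrPdist_lt gb; apply/cvg_cabsP => e e0.
have e2 : 0 < e / 2 by rewrite divr_gt0.
near=> t.
have -> : (Complex (f t) (g t) : Cplx R) - Complex a b =
    toC (f t - a) + iunit * toC (g t - b).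
  rewrite /toC /iunit; congr Complex => /=; ring.
apply: le_lt_trans (cabsD _ _) _; rewrite cabsM !cabs_toC.
have -> : cabs (iunit : Cplx R) = 1.
  by rewrite /cabs /iunit normc_def /= expr0n /= expr1n add0r sqrtr1.
rewrite mul1r [ltRHS](splitr e) ltrD //; rewrite distrC.
  by near: t; exact: fa.
by near: t; exact: gb.
Unshelve. all: by end_near. Qed.

Lemma cvg_toC T (F : set_system T) (FF : Filter F) (f : T -> R) a :
  f @ F --> a -> (fun t => toC (f t)) @ F --> toC a.
Proof. by move=> fa; apply: cvg_complex => //; exact: cvg_cst. Qed.

Lemma continuous_cis : continuous (@cis R).
Proof.
move=> t; apply: cvg_complex; [exact: continuous_cos|exact: continuous_sin].
Qed.

Lemma cabs_cis (t : R) : cabs (cis t) = 1.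
Proof. by rewrite /cabs /cis normc_def /= cos2Dsin2 sqrtr1. Qed.

Lemma csup_ge0 z : 0 <= csup z.
Proof. by rewrite /csup le_max cabs_ge0. Qed.

Lemma csup_ge1 z : cabs z.1 <= csup z.
Proof. by rewrite /csup le_max lexx. Qed.

Lemma csup_ge2 z : cabs z.2 <= csup z.
Proof. by rewrite /csup le_max lexx orbT. Qed.

Lemma csupD z w : csup (z + w) <= csup z + csup w.
Proof.
rewrite {1}/csup ge_max; apply/andP; split.
  exact: le_trans (cabsD _ _) (lerD (csup_ge1 z) (csup_ge1 w)).
exact: le_trans (cabsD _ _) (lerD (csup_ge2 z) (csup_ge2 w)).
Qed.

Lemma csupBC z w : csup (z - w) = csup (w - z).
Proof. by rewrite /csup /= cabsBC [cabs (z.2 - w.2)]cabsBC. Qed.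

Lemma csup_dist z w : `|csup z - csup w| <= csup (z - w).
Proof.
rewrite ler_norml lerNl opprB !lerBlDr; apply/andP; split.
  by rewrite csupBC -{1}(subrK z w) csupD.
by rewrite -{1}(subrK w z) csupD.
Qed.

Lemma cvg_C2P T (F : set_system T) (FF : Filter F) (f : T -> C2 R) z :
  f @ F --> z <->
  ((fun t => (f t).1) @ F --> z.1 /\ (fun t => (f t).2) @ F --> z.2).
Proof.
case: z => z1 z2; split=> [fz|[f1 f2]] /=.
  by split; [apply: cvg_comp fz (@cvg_fst _ _ (nbhs z1) (nbhs z2) _)
            |apply: cvg_comp fz (@cvg_snd _ _ (nbhs z1) (nbhs z2) _)].
move=> P [[A B] /= [nA nB] AB].
have h1 : F [set t | A (f t).1] := f1 _ nA.
have h2 : F [set t | B (f t).2] := f2 _ nB.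
have : F [set t | P (f t)] by apply: filterS2 h1 h2 => t At Bt; exact: AB.
by [].
Qed.

Lemma cvg_csupP T (F : set_system T) (FF : Filter F) (f : T -> C2 R) z :
  f @ F --> z <-> forall e : R, 0 < e -> \forall t \near F, csup (f t - z) < e.
Proof.
rewrite cvg_C2P; split=> [[/cvg_cabsP f1 /cvg_cabsP f2] e e0|H].
  near=> t; rewrite /csup gt_max /=; apply/andP; split; near: t.
    exact: f1.
  exact: f2.
split; apply/cvg_cabsP => e /H; apply: filterS => t; apply: le_lt_trans.
  exact: (csup_ge1 (f t - z)).
exact: (csup_ge2 (f t - z)).
Unshelve. all: by end_near. Qed.

Lemma nbhs_csupP z (P : set (C2 R)) :
  nbhs z P <-> exists2 e : R, 0 < e & forall w, csup (w - z) < e -> P w.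
Proof.
split=> [|[e e0 eP]].
  rewrite /nbhs /= => -[[A B] /= [/toC_ball[e e0 eA] /toC_ball[d d0 dB]] AB].
  exists (Num.min e d); first by rewrite lt_min e0.
  move=> w; rewrite lt_min => /andP[we wd]; apply: (AB w); split => /=.
    exact: eA (le_lt_trans (csup_ge1 (w - z)) we).
  exact: dB (le_lt_trans (csup_ge2 (w - z)) wd).
have /cvg_csupP/(_ _ e0) : (fun w : C2 R => w) @ z --> z by exact: cvg_id.
by apply: filterS => w; exact: eP.
Qed.

Lemma near_csup z e : 0 < e -> \forall w \near z, csup (w - z) < e.
Proof. by move=> e0; apply/nbhs_csupP; exists e. Qed.

Lemma cvg_csup T (F : set_system T) (FF : Filter F) (f : T -> C2 R) z :
  f @ F --> z -> (fun t => csup (f t)) @ F --> csup z.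
Proof.
move=> /cvg_csupP fz; apply/cvgrPdist_lt => e /fz.
by apply: filterS => t; rewrite distrC; exact: le_lt_trans (csup_dist _ _).
Qed.

Lemma compact_csup (K : set (C2 R)) :
  compact K -> exists B, forall z, K z -> csup z <= B.
Proof.
move=> cK.
have : compact (csup @` K).
  apply: continuous_compact cK.
  by apply: continuous_subspaceT => z; apply: cvg_csup; exact: cvg_id.
move=> /compact_bounded[B [_ HB]]; exists (B + 1) => z Kz.
have : `|csup z| <= B + 1 by apply: HB; [rewrite ltrDl|exists z].
by apply: le_trans; exact: ler_norm.
Qed.

Lemma csup_enorm z : csup z <= enorm z.
Proof.
have h (x : Cplx R) (e : R) : 0 <= e ->
    cabs x <= Num.sqrt (cabs x ^+ 2 + e).
  move=> e0; rewrite -{1}[cabs x]ger0_norm ?cabs_ge0 // -sqrtr_sqr.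
  by rewrite ler_sqrt ?addr_ge0 ?sqr_ge0 // lerDl.
rewrite /csup ge_max /enorm -!/(cabs _) h ?sqr_ge0 //=.
by rewrite addrC h ?sqr_ge0.
Qed.

Lemma enorm_csup z : enorm z <= 2 * csup z.
Proof.
rewrite /enorm -!/(cabs _).
have h0 := csup_ge0 z; have h1 := csup_ge1 z; have h2 := csup_ge2 z.
have : 0 <= 2 * csup z by lra.
move=> /ger0_norm <-; rewrite -sqrtr_sqr ler_sqrt ?sqr_ge0 //.
have k1 := cabs_ge0 z.1; have k2 := cabs_ge0 z.2; nra.
Qed.

Lemma csupZ (c : Cplx R) z : csup (c *: z) = cabs c * csup z.
Proof. by rewrite /csup /= maxr_pMr ?cabs_ge0 // -!cabsM. Qed.

End Modulus.

(** * Polynomial estimates *)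

Section PolyEstimates.
Context {R : realType}.
Implicit Types (r q : {poly Cplx R}) (x y : Cplx R).

Lemma horner_bound r n (B t : R) y :
  (forall i, (n <= i)%N -> r`_i = 0) -> (forall i, cabs r`_i <= B) ->
  1 <= t -> cabs y <= t -> cabs r.[y] <= n%:R * B * t ^+ n.-1.
Proof.
move=> r0 rB t1 yt; rewrite (@horner_coef_wide _ n); last exact/leq_sizeP.
apply: le_trans (cabs_sum _) _.
apply: (@le_trans _ _ (\sum_(i < n) B * t ^+ n.-1)); last first.
  by rewrite sumr_const card_ord -[leLHS]mulr_natl mulrA.
apply: ler_sum => i _; rewrite cabsM cabsX ler_pM ?exprn_ge0 ?cabs_ge0 //.
apply: (@le_trans _ _ (t ^+ i)).
  by rewrite lerXn2r ?nnegrE ?cabs_ge0 //; lra.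
by rewrite ler_weXn2l // -ltnS prednK ?(leq_ltn_trans _ (ltn_ord i)).
Qed.

Lemma cabs_exp_sub x y n (t : R) : cabs x <= t -> cabs y <= t ->
  cabs (x ^+ n.+1 - y ^+ n.+1) <= n.+1%:R * t ^+ n * cabs (x - y).
Proof.
move=> xt yt; rewrite subrXX cabsM mulrC ler_wpM2r ?cabs_ge0 //.
apply: le_trans (cabs_sum _) _.
apply: (@le_trans _ _ (\sum_(i < n.+1) t ^+ n)); last first.
  by rewrite sumr_const card_ord -[leLHS]mulr_natl.
have t0 : 0 <= t by exact: le_trans (cabs_ge0 _) xt.
apply: ler_sum => i _; rewrite cabsM !cabsX /=.
have -> : t ^+ n = t ^+ (n - i) * t ^+ i.
  by rewrite -exprD subnK // -ltnS.
by rewrite ler_pM ?exprn_ge0 ?cabs_ge0 // lerXn2r ?nnegrE ?cabs_ge0.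
Qed.

Lemma horner_lip r n (B t : R) x y :
  size r = n.+1 -> (forall i, cabs r`_i <= B) ->
  1 <= t -> cabs x <= t -> cabs y <= t ->
  cabs (r.[x] - r.[y]) <= n.+1%:R ^+ 2 * B * t ^+ n.-1 * cabs (x - y).
Proof.
move=> rn rB t1 xt yt; rewrite !horner_coef rn -sumrB.
apply: le_trans (cabs_sum _) _.
apply: (@le_trans _ _
  (\sum_(i < n.+1) (B * (n.+1%:R * t ^+ n.-1 * cabs (x - y))))); last first.
  by rewrite sumr_const card_ord -[leLHS]mulr_natl le_eqVlt expr2 -!mulrA (mulrCA B) eqxx.
apply: ler_sum => -[[|i] /= ilt] _; rewrite -mulrBr cabsM.
  rewrite !expr0 subrr cabs0 mulr0 !mulr_ge0 ?cabs_ge0 ?exprn_ge0 //; try lra.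
  exact: le_trans (cabs_ge0 r`_0) _.
rewrite ler_pM ?cabs_ge0 //; apply: le_trans (cabs_exp_sub _ xt yt) _.
rewrite ler_wpM2r ?cabs_ge0 // ler_pM ?exprn_ge0 //; try lra.
  by rewrite ler_nat; lia.
by rewrite ler_weXn2l //; lia.
Qed.

Lemma coef_XderivM q i : ('X * q^`())`_i = q`_i *+ i.
Proof. by rewrite coefXM coef_deriv; case: i => [|i] /=; rewrite ?mulr0n. Qed.

Lemma coef_top q e i : size q = e.+1 -> (e < i)%N -> q`_i = 0.
Proof. by move=> sq ei; rewrite nth_default // sq. Qed.

Lemma ler_nat_sub (i e : nat) (B : R) (c : Cplx R) : (i <= e)%N -> cabs c <= B ->
  cabs (c *+ i - e%:R * c) <= e%:R * B.
Proof.
move=> ie cB; have -> : c *+ i - e%:R * c = - ((e - i)%:R * c).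
  by rewrite natrB // -mulr_natl; ring.
rewrite cabsN cabsM cabs_nat ler_pM ?cabs_ge0 // ler_nat; lia.
Qed.

(** Euler's operator multiplies the top coefficient of a polynomial by its
    degree: the left-hand side has degree less than [e]. *)
Lemma euler_bound q e (A t : R) y : size q = e.+1 ->
  (forall i, cabs q`_i <= A) -> 1 <= t -> cabs y <= t ->
  cabs (y * q^`().[y] - e%:R * q.[y]) <= e%:R * (e%:R * A) * t ^+ e.-1.
Proof.
move=> sq qA t1 yt; set r := 'X * q^`() - e%:R *: q.
have rE i : r`_i = q`_i *+ i - e%:R * q`_i.
  by rewrite coefB coef_XderivM coefZ.
have -> : y * q^`().[y] - e%:R * q.[y] = r.[y].
  by rewrite /r hornerD hornerN hornerZ hornerM hornerX.
apply: horner_bound => // i.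
  rewrite leq_eqVlt => /orP[/eqP <-|ei]; first by rewrite rE mulr_natl subrr.
  by rewrite rE (coef_top sq) // mul0rn mulr0 subr0.
have [ie|ei] := leqP i e; first by rewrite rE ler_nat_sub.
rewrite rE (coef_top sq) // mul0rn mulr0 subr0 cabs0.
by rewrite mulr_ge0 // (le_trans (cabs_ge0 q`_0)).
Qed.

Lemma euler2_bound q e (A t : R) y : size q = e.+1 ->
  (forall i, cabs q`_i <= A) -> 1 <= t -> cabs y <= t ->
  cabs (y ^+ 2 * q^`()^`().[y] + y * q^`().[y] - e%:R ^+ 2 * q.[y])
    <= e%:R * (e%:R ^+ 2 * A) * t ^+ e.-1.
Proof.
move=> sq qA t1 yt; set r := 'X * ('X * q^`())^`() - (e ^ 2)%:R *: q.
have rE i : r`_i = q`_i *+ (i ^ 2) - (e ^ 2)%:R * q`_i.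
  by rewrite coefB coef_XderivM coef_XderivM coefZ -mulrnA -mulnn.
have -> : y ^+ 2 * q^`()^`().[y] + y * q^`().[y] - e%:R ^+ 2 * q.[y] = r.[y].
  rewrite /r derivM derivX mul1r hornerD hornerN hornerZ !hornerM hornerD.
  by rewrite hornerM hornerX natrX; ring.
rewrite -natrX; apply: horner_bound => // i.
  rewrite leq_eqVlt => /orP[/eqP <-|ei]; first by rewrite rE mulr_natl subrr.
  by rewrite rE (coef_top sq) // mul0rn mulr0 subr0.
have [ie|ei] := leqP i e.
  by rewrite rE ler_nat_sub // leq_exp2r.
rewrite rE (coef_top sq) // mul0rn mulr0 subr0 cabs0.
by rewrite mulr_ge0 // (le_trans (cabs_ge0 q`_0)).
Qed.

Lemma lead_bound q e (A t : R) y : size q = e.+1 ->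
  (forall i, cabs q`_i <= A) -> 1 <= t -> cabs y <= t ->
  cabs (q.[y] - q`_e * y ^+ e) <= e%:R * A * t ^+ e.-1.
Proof.
move=> sq qA t1 yt; set r := q - q`_e *: 'X^e.
have -> : q.[y] - q`_e * y ^+ e = r.[y].
  by rewrite /r hornerD hornerN hornerZ hornerXn.
have rE i : r`_i = if i == e then 0 else q`_i.
  rewrite coefB coefZ coefXn; case: eqVneq => [->|_]; first by rewrite mulr1 subrr.
  by rewrite mulr0 subr0.
apply: horner_bound => // i; rewrite rE.
  by rewrite leq_eqVlt eq_sym; case: eqP => //= _ ei; exact: coef_top sq ei.
by case: eqP => // _; rewrite cabs0 (le_trans (cabs_ge0 q`_0)).
Qed.

End PolyEstimates.

(** * Escape of orbits and convergence of the Green functions *)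

(** The sequence [u k - C / 2 ^ k] is nondecreasing and bounded, so monotone
    convergence applies; the same for [- u] gives the other half of the error
    bound. *)
Lemma geometric_cauchy {R : realType} (u : nat -> R) (C : R) :
  (forall k, `|u k.+1 - u k| <= C / 2 ^+ k.+1) ->
  (u @ \oo --> lim (u @ \oo)) /\ forall k, `|lim (u @ \oo) - u k| <= C / 2 ^+ k.
Proof.
have half k : C / 2 ^+ k = C / 2 ^+ k.+1 + C / 2 ^+ k.+1.
  have p0 : (2 : R) ^+ k != 0 by rewrite expf_neq0.
  by rewrite exprS; field; rewrite p0.
have key (v : nat -> R) : (forall k, `|v k.+1 - v k| <= C / 2 ^+ k.+1) ->
    cvg (v @ \oo) /\ forall k, v k - C / 2 ^+ k <= lim (v @ \oo).
  move=> vC; pose w k := v k - C / 2 ^+ k.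
  have C0 k : 0 <= C / 2 ^+ k.
    by rewrite half addr_ge0 // (le_trans _ (vC k)).
  have wnd : nondecreasing_seq w.
    apply/nondecreasing_seqP => k; rewrite /w half.
    have := vC k; rewrite ler_norml => /andP[]; lra.
  have pw : (fun k => C / 2 ^+ k) @ \oo --> (0 : R).
    have -> : (fun k => C / 2 ^+ k) = geometric C (1 / 2 : R).
      by apply/funext => k; rewrite /geometric /= expr_div_n expr1n mul1r.
    by apply: cvg_geometric; rewrite ger0_norm; lra.
  have ub k : v k + C / 2 ^+ k <= v 0%N + C.
    elim: k => [|k IH]; first by rewrite expr0 divr1.
    have := vC k; rewrite ler_norml => /andP[_]; have := half k; lra.
  have cw : cvg (w @ \oo).
    apply: nondecreasing_is_cvgn => //; exists (v 0%N + C) => _ [k _ <-].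
    rewrite /w; have := ub k; have := C0 k; lra.
  have vw : v = (fun k => w k + C / 2 ^+ k).
    by apply/funext => k; rewrite /w subrK.
  have cv : v @ \oo --> lim (w @ \oo).
    by rewrite vw -[X in _ --> X]addr0; apply: cvgD.
  split; first by apply/cvg_ex; exists (lim (w @ \oo)).
  move=> k; rewrite (cvg_lim _ cv) //.
  exact: nondecreasing_cvgn_le.
move=> uC; have [cu lo] := key u uC; split=> // k.
have [cN hi] : cvg ((fun k => - u k) @ \oo) /\
    forall k, - u k - C / 2 ^+ k <= lim ((fun k => - u k) @ \oo).
  by apply: key => i; rewrite -opprD normrN.
have := hi k; have := lo k.
have -> : lim ((fun k => - u k) @ \oo) = - lim (u @ \oo).
  by apply: cvg_lim => //; exact: cvgN.
by rewrite ler_norml => *; apply/andP; split; lra.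
Qed.

Section Recurrence.
Context {R : realType}.
Implicit Types (z w : C2 R).

(** A bound [A] and a degree bound [E] valid at all times are what makes the later
    constants independent of the recurrence. The lead coefficients are bounded
    below instead of being [1], because the inverse of a Henon map leads to the
    polynomial [p / a]. *)
Definition recurrence_class (A : R) (E : nat) (q : nat -> {poly Cplx R})
    (b : nat -> Cplx R) (e : nat -> nat) : Prop :=
  forall k, [/\ (2 <= e k <= E)%N, size (q k) = (e k).+1,
    (forall i, cabs (q k)`_i <= A), 1 <= A * cabs (q k)`_(e k) &
    cabs (b k) <= A].

(** The [k]-th state is the pair [(y_(k-1), y_k)] of consecutive terms of the
    scalar recurrence [y_(k+1) = q_k(y_k) - b_k y_(k-1)]. *)
Fixpoint orb (q : nat -> {poly Cplx R}) (b : nat -> Cplx R) (k : nat) z : C2 R :=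
  if k is k'.+1 then henon (q k') (b k') (orb q b k' z) else z.

Definition degs (e : nat -> nat) (k : nat) : nat := (\prod_(i < k) e i)%N.

(** The truncation at [1] makes powers of the height monotone in the exponent and
    turns [log^+] into a logarithm. *)
Definition height z : R := Num.max 1 (csup z).

Definition loggrowth q b (e : nat -> nat) k z : R :=
  ln (height (orb q b k z)) / (degs e k)%:R.

Definition green q b e z : R := lim ((fun k => loggrowth q b e k z) @ \oo).

(** Large enough for two purposes: the leading term is at least twice the others
    ([escaping_step]), and moduli grow faster than the product of the degrees
    ([escaping_grow], [tail_inv_le]). *)
Definition escape_radius (A : R) (E : nat) : R := 8 * A ^+ 2 * E.+1%:R ^+ 2.

Definition escaping (A : R) (E : nat) z : Prop :=
  escape_radius A E <= cabs z.2 /\ cabs z.1 <= cabs z.2.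

(** The factor by which a step can change [height] compared with its [e]-th power,
    for starting points of sup norm at most [R0]. *)
Definition distortion (A : R) (E : nat) (R0 : R) : R := A * E.+2%:R * R0 ^+ E.

Lemma height_ge1 z : 1 <= height z.
Proof. by rewrite le_max lexx. Qed.

Lemma height_csup z : csup z <= height z.
Proof. by rewrite le_max lexx orbT. Qed.

Lemma height_gt0 z : 0 < height z.
Proof. by have := height_ge1 z; lra. Qed.

Lemma height_le z (B : R) : 1 <= B -> csup z <= B -> height z <= B.
Proof. by move=> h1 h2; rewrite /height ge_max; apply/andP. Qed.

Context {A : R} {E : nat} {q : nat -> {poly Cplx R}} {b : nat -> Cplx R}
  {e : nat -> nat}.
Hypothesis H : recurrence_class A E q b e.

Lemma class_A_ge1 : 1 <= A.
Proof.
have [_ _ qA lead _] := H 0.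
have h0 := cabs_ge0 (q 0)`_(e 0%N); have := qA (e 0%N) => h.
by move: lead; nra.
Qed.

Lemma class_E_ge2 : (2 <= E)%N.
Proof. by have [/andP[h1 h2] _ _ _ _] := H 0; exact: leq_trans h2. Qed.

Lemma degs_gt0 k : (0 < degs e k)%N.
Proof.
rewrite /degs; apply: prodn_gt0 => i; have [/andP[h _] _ _ _ _] := H i.
exact: leq_trans h.
Qed.

Lemma degsS k : degs e k.+1 = (degs e k * e k)%N.
Proof. by rewrite /degs big_ord_recr. Qed.

Lemma degsR_gt0 k : 0 < (degs e k)%:R :> R.
Proof. by rewrite ltr0n degs_gt0. Qed.

Lemma degs_ge k : 2 ^+ k <= (degs e k)%:R :> R.
Proof.
rewrite -natrX ler_nat; elim: k => [|k IH]; first by rewrite degs_gt0.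
rewrite degsS expnSr leq_mul //; by have [/andP[]] := H k.
Qed.

Lemma escape_radius_ge1 : 8 * A * E.+1%:R <= escape_radius A E.
Proof.
rewrite /escape_radius; have A1 := class_A_ge1.
have E1 : 1 <= E.+1%:R :> R by rewrite ler1n.
by rewrite !expr2 ler_pM //; nra.
Qed.

(** The terms of lower degree and the term [b * z.1] amount to at most
    [(e + 1) * A * t ^ (e - 1)] with [t = cabs z.2], which the escape radius makes
    at most half of the leading term, itself at least [t ^ e / A]. *)
Lemma escaping_step k z : escaping A E z ->
  cabs z.2 ^+ e k <= 2 * A * cabs (henon (q k) (b k) z).2.
Proof.
case; case: z => x y /= zr z12; have [/andP[e2 eE] sq qA lead bA] := H k.
have A1 := class_A_ge1.
have E1 : 3 <= E.+1%:R :> R by rewrite ler_nat ltnS class_E_ge2.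
have eE1 : (e k)%:R + 1 <= E.+1%:R :> R by rewrite natr1 ler_nat ltnS.
have [t tE] : {t | t = cabs y} by exists (cabs y).
rewrite -!tE in zr z12 *.
have t1 : 1 <= t by move: zr; have := escape_radius_ge1; nra.
have [T TE] : {T | T = t ^+ (e k).-1} by exists (t ^+ (e k).-1).
have tT : t <= T.
  rewrite -[t in t <= _]expr1 TE ler_weXn2l //; move: e2; clear; lia.
have T0 : 0 <= T by lra.
have eT : t ^+ e k = t * T.
  by rewrite TE -exprS prednK // (leq_trans _ e2).
have h1 := lead_bound sq qA t1 (_ : cabs y <= t).
rewrite -tE -TE in h1; have {}h1 := h1 (lexx t).
have h2 : t * T <= A * cabs ((q k)`_(e k) * y ^+ e k).
  rewrite cabsM cabsX -tE eT mulrA ler_peMl // mulr_ge0 //.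
  exact: le_trans t1.
have h3 : cabs (b k * x) <= A * T.
  by rewrite cabsM ler_pM ?cabs_ge0 //; exact: le_trans tT.
rewrite eT.
have h4 : cabs ((q k)`_(e k) * y ^+ e k) <=
  cabs ((q k).[y] - b k * x) + cabs (b k * x)
   + cabs ((q k).[y] - (q k)`_(e k) * y ^+ e k).
  rewrite [cabs ((q k).[y] - (q k)`_(e k) * y ^+ e k)]cabsBC.
  have {1}-> : (q k)`_(e k) * y ^+ e k = ((q k).[y] - b k * x) + b k * x +
    ((q k)`_(e k) * y ^+ e k - (q k).[y]) by ring.
  by apply: le_trans (cabsD _ _) _; rewrite lerD // cabsD.
have h5 : 2 * A * (((e k)%:R + 1) * A * T) <= t * T.
  rewrite !mulrA ler_wpM2r //.
  move: zr; rewrite /escape_radius; move: E.+1%:R eE1 E1 => r h6 r3.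
  have h7 : A * A * ((e k)%:R + 1) <= A * A * (r * r).
    by rewrite ler_wpM2l //; nra.
  rewrite !expr2; nra.
move: h1 h2 h3 h4 h5 A1 T0.
move: (cabs ((q k).[y] - b k * x)) (cabs (b k * x)) (cabs ((q k).[y] - _))
  (cabs (_ * y ^+ _)) (e k)%:R; clear.
move=> c1 c2 c3 c4 n h1 h2 h3 h4 h5 A1 T0.
have h6 : A * c4 <= A * (c1 + (n + 1) * A * T) by rewrite ler_wpM2l; lra.
lra.
Qed.

Lemma escaping_grow k z : escaping A E z ->
  4 * E.+1%:R * cabs z.2 <= cabs (henon (q k) (b k) z).2.
Proof.
move=> ez; have h := escaping_step k ez; case: ez => zr _.
have [/andP[e2 eE] _ _ _ _] := H k; have A1 := class_A_ge1.
set t := cabs z.2 in h zr *; set s := cabs _ in h *.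
have E1 : 1 <= E.+1%:R :> R by rewrite ler1n.
have t1 : 1 <= t by move: zr; have := escape_radius_ge1; nra.
have h2 : t ^+ 2 <= 2 * A * s by apply: le_trans h; rewrite ler_weXn2l.
have h3 : 8 * A * E.+1%:R <= t by exact: le_trans escape_radius_ge1 zr.
have h4 : 8 * A * E.+1%:R * t <= 2 * A * s.
  by apply: le_trans h2; rewrite expr2 ler_wpM2r //; lra.
have h5 : (2 * A) * (4 * E.+1%:R * t) <= 2 * A * s by apply: le_trans h4; lra.
by move: h5; rewrite ler_pM2l //; lra.
Qed.

Lemma escaping_ge1 z : escaping A E z -> 1 <= cabs z.2.
Proof.
case=> zr _; apply: le_trans zr; apply: le_trans escape_radius_ge1.
have A1 := class_A_ge1; have E1 : 1 <= E.+1%:R :> R by rewrite ler1n.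
nra.
Qed.

Lemma escaping_height z : escaping A E z -> height z = cabs z.2.
Proof.
move=> ez; have z1 := escaping_ge1 ez; case: ez => _ z12.
by rewrite /height /csup (max_idPr z12) (max_idPr z1).
Qed.

Lemma escaping_henon k z : escaping A E z -> escaping A E (henon (q k) (b k) z).
Proof.
move=> ez; have z1 := escaping_ge1 ez; have h := escaping_grow k ez.
have E1 : 1 <= E.+1%:R :> R by rewrite ler1n.
have h2 : cabs z.2 <= cabs (henon (q k) (b k) z).2 by apply: le_trans h; nra.
by split; [case: ez => zr _; exact: le_trans h2|].
Qed.

Lemma escaping_orb j k z :
  escaping A E (orb q b j z) -> escaping A E (orb q b (j + k) z).
Proof.
elim: k => [|k IH] h; first by rewrite addn0.
by rewrite addnS; apply: escaping_henon; exact: IH.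
Qed.

Lemma escaping_orb_grow j k z : escaping A E (orb q b j z) ->
  (4 * E.+1%:R) ^+ k * cabs (orb q b j z).2 <= cabs (orb q b (j + k) z).2.
Proof.
move=> h; elim: k => [|k IH]; first by rewrite expr0 mul1r addn0.
rewrite addnS exprS -mulrA.
apply: le_trans (escaping_grow (j + k) (escaping_orb k h)).
by rewrite ler_wpM2l.
Qed.

Lemma height_henon_le k z :
  height (henon (q k) (b k) z) <= A * E.+2%:R * height z ^+ e k.
Proof.
have [/andP[e2 eE] sq qA _ bA] := H k; have A1 := class_A_ge1.
set t := height z; have t1 : 1 <= t by exact: height_ge1.
have tT : t <= t ^+ e k by rewrite -[t in t <= _]expr1 ler_weXn2l // (leq_trans _ e2).
set T := t ^+ e k in tT *.
have E2 : 4 <= E.+2%:R :> R by rewrite ler_nat !ltnS class_E_ge2.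
have z2t : cabs z.2 <= t by exact: le_trans (csup_ge2 z) (height_csup z).
have z1t : cabs z.1 <= t by exact: le_trans (csup_ge1 z) (height_csup z).
have TT : T <= A * E.+2%:R * T by rewrite ler_peMl //; nra.
apply: height_le; first lra.
rewrite /csup /= ge_max; apply/andP; split; first lra.
apply: le_trans (cabsB _ _) _; rewrite cabsM.
have h1 : cabs (q k).[z.2] <= (e k).+1%:R * A * T.
  by apply: (@horner_bound _ _ (e k).+1) => // i; exact: coef_top.
have h2 : cabs (b k) * cabs z.1 <= A * T.
  by rewrite ler_pM ?cabs_ge0 //; lra.
have h3 : (e k).+1%:R * A * T <= E.+1%:R * (A * T).
  by rewrite -mulrA ler_wpM2r ?ler_nat //; apply: mulr_ge0; lra.
rewrite -[E.+2%:R]natr1; lra.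
Qed.

(** Before it escapes, an orbit does not leave the bidisc in which it starts:
    the first coordinate is the previous second one, and the second one is
    smaller than the first one or than the escape radius. *)
Lemma escaping_or_bounded R0 k z : escape_radius A E <= R0 -> csup z <= R0 ->
  escaping A E (orb q b k z) \/ csup (orb q b k z) <= R0.
Proof.
move=> rR zR; elim: k => [|k [IH|IH]]; first by right.
  by left; exact: escaping_henon.
have h1 := csup_ge2 (orb q b k z).
have [h|h] := pselect (escaping A E (orb q b k.+1 z)); [by left|right].
rewrite /csup /= ge_max (le_trans h1 IH) /=; apply: contrapT.
move=> /negP; rewrite -ltNge => h2; apply: h; split=> /=.
  by rewrite (le_trans rR) // ltW.
by rewrite ltW // (le_lt_trans _ h2) // (le_trans h1 IH).
Qed.

(** For escaping points this is [escaping_step]; for the others the left-hand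
    side is bounded by [R0 ^ E] and the height is at least [1]. *)
Lemma height_henon_ge R0 k z : escape_radius A E <= R0 -> csup z <= R0 ->
  height (orb q b k z) ^+ e k <=
    distortion A E R0 * height (orb q b k.+1 z).
Proof.
move=> rR zR; have [/andP[e2 eE] _ _ _ _] := H k; have A1 := class_A_ge1.
have E1 : 1 <= E.+1%:R :> R by rewrite ler1n.
have E2 : 4 <= E.+2%:R :> R by rewrite ler_nat !ltnS class_E_ge2.
have R1 : 1 <= R0 by have := escape_radius_ge1; nra.
have RE : 1 <= R0 ^+ E by exact: exprn_ege1.
have h1 := height_ge1 (orb q b k.+1 z).
have [ez|zb] := escaping_or_bounded k rR zR.
  rewrite (escaping_height ez) (escaping_height (escaping_henon k ez)).
  apply: le_trans (escaping_step k ez) _; rewrite ler_wpM2r ?cabs_ge0 //.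
  rewrite /distortion; apply: (@le_trans _ _ (A * E.+2%:R)); first nra.
  by rewrite ler_peMr //; nra.
have h2 : height (orb q b k z) <= R0 by exact: height_le.
apply: (@le_trans _ _ (R0 ^+ E)).
  apply: (@le_trans _ _ (R0 ^+ e k)); last by rewrite ler_weXn2l.
  by rewrite lerXn2r ?nnegrE // ?ltW ?height_gt0 //; lra.
rewrite /distortion.
have : 1 <= A * E.+2%:R by nra.
move: (A * _) => c c1.
have : R0 ^+ E <= c * R0 ^+ E by rewrite ler_peMl //; lra.
move: (R0 ^+ E) RE => r r1 cr; nra.
Qed.

Lemma distortion_ge1 R0 : escape_radius A E <= R0 -> 1 <= distortion A E R0.
Proof.
move=> rR; have A1 := class_A_ge1.
have E1 : 1 <= E.+1%:R :> R by rewrite ler1n.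
have E2 : 4 <= E.+2%:R :> R by rewrite ler_nat !ltnS class_E_ge2.
have R1 : 1 <= R0 by have := escape_radius_ge1; nra.
have RE : 1 <= R0 ^+ E by exact: exprn_ege1.
have h : 1 <= A * E.+2%:R by nra.
by rewrite /distortion; apply: le_trans h _; rewrite ler_peMr //; nra.
Qed.

(** One step multiplies [ln height] by the degree up to the additive constant
    [ln distortion], which is then divided by a product of [k + 1] degrees. *)
Lemma loggrowth_step R0 k z : escape_radius A E <= R0 -> csup z <= R0 ->
  `|loggrowth q b e k.+1 z - loggrowth q b e k z|
    <= ln (distortion A E R0) / 2 ^+ k.+1.
Proof.
move=> rR zR; set kap := distortion A E R0.
have k1 : 1 <= kap by exact: distortion_ge1.
set s := height (orb q b k z); set s' := height (orb q b k.+1 z).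
have s0 : 0 < s by exact: height_gt0.
have s0' : 0 < s' by exact: height_gt0.
have e0 : 0 < (e k)%:R :> R.
  by have [/andP[h _] _ _ _ _] := H k; rewrite ltr0n (leq_trans _ h).
have A1 := class_A_ge1.
have E1 : 1 <= E.+1%:R :> R by rewrite ler1n.
have R1 : 1 <= R0 by have := escape_radius_ge1; nra.
have up : s' <= kap * s ^+ e k.
  apply: le_trans (height_henon_le k _) _; rewrite ler_wpM2r ?exprn_ge0 //.
    exact: ltW.
  rewrite /kap /distortion ler_peMr //; last exact: exprn_ege1.
  by rewrite mulr_ge0 //; lra.
have lo : s ^+ e k <= kap * s' by exact: height_henon_ge.
have kap0 : 0 < kap by lra.
rewrite /loggrowth -/s -/s'; move: kap s s' k1 s0 s0' up lo kap0.
move=> kap s s' k1 s0 s0' up lo kap0.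
have lup : ln s' <= ln kap + ln s * (e k)%:R.
  rewrite mulr_natr -lnXn // -lnM ?posrE ?exprn_gt0 //.
  by rewrite ler_ln ?posrE ?mulr_gt0 ?exprn_gt0.
have llo : ln s * (e k)%:R <= ln kap + ln s'.
  rewrite mulr_natr -lnXn // -lnM ?posrE //.
  by rewrite ler_ln ?posrE ?mulr_gt0 ?exprn_gt0.
rewrite degsS natrM.
have D0 := degsR_gt0 k; set D := (degs e k)%:R in D0 *.
have -> : ln s' / (D * (e k)%:R) - ln s / D =
  (ln s' - ln s * (e k)%:R) / (D * (e k)%:R) by field; rewrite !gt_eqF.
rewrite normrM [X in _ * X]gtr0_norm; last by rewrite invr_gt0 mulr_gt0.
have De0 : 0 < D * (e k)%:R by exact: mulr_gt0.
apply: ler_pM; first exact: normr_ge0.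
by rewrite invr_ge0 ltW.
by rewrite ler_norml; apply/andP; split; lra.
rewrite lef_pV2 ?posrE ?exprn_gt0 //.
by have := degs_ge k.+1; rewrite degsS natrM.
Qed.

Lemma green_cvg z : (fun k => loggrowth q b e k z) @ \oo --> green q b e z.
Proof.
pose R0 := Num.max (escape_radius A E) (csup z).
have h1 : escape_radius A E <= R0 by rewrite le_max lexx.
have h2 : csup z <= R0 by rewrite le_max lexx orbT.
by have [] := geometric_cauchy (fun k => loggrowth_step k h1 h2).
Qed.

Lemma green_err R0 k z : escape_radius A E <= R0 -> csup z <= R0 ->
  `|green q b e z - loggrowth q b e k z| <= ln (distortion A E R0) / 2 ^+ k.
Proof.
by move=> h1 h2; have [_] := geometric_cauchy (fun k => loggrowth_step k h1 h2).
Qed.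

(** Along an escaping orbit [(ln height - ln (2 * A)) / degs] is nondecreasing,
    because the degrees are at least [2]; it starts positive because the escape
    radius exceeds [2 * A]. *)
Lemma green_escaping k z : escaping A E (orb q b k z) -> 0 < green q b e z.
Proof.
move=> ez; have A1 := class_A_ge1.
have E1 : 1 <= E.+1%:R :> R by rewrite ler1n.
have A2 : 0 < 2 * A by lra.
pose h j := (ln (height (orb q b (k + j) z)) - ln (2 * A)) / (degs e (k + j))%:R.
have hnd : nondecreasing_seq h.
  apply/nondecreasing_seqP => j; rewrite /h addnS degsS natrM.
  have ezj := escaping_orb j ez.
  have [/andP[e2 _] _ _ _ _] := H (k + j).
  have e2R : 2 <= (e (k + j))%:R :> R by rewrite ler_nat.
  have D0 := degsR_gt0 (k + j).
  rewrite ler_pdivlMr ?mulr_gt0 //; last lra.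
  rewrite [leLHS]mulrA divfK ?gt_eqF //.
  rewrite (escaping_height ezj) (escaping_height (escaping_henon (k + j) ezj)).
  have hs := escaping_step (k + j) ezj.
  have t1 := escaping_ge1 ezj.
  have t1' := escaping_ge1 (escaping_henon (k + j) ezj).
  have ll : ln (cabs (orb q b (k + j) z).2) * (e (k + j))%:R <=
     ln (2 * A) + ln (cabs (orb q b (k + j).+1 z).2).
    rewrite mulr_natr -lnXn; last lra.
    by rewrite -lnM ?posrE ?ler_ln ?posrE ?mulr_gt0 ?exprn_gt0 //; lra.
  have l2 : 0 <= ln (2 * A) by rewrite ln_ge0; lra.
  have l3 : ln (2 * A) * 2 <= ln (2 * A) * (e (k + j))%:R.
    by rewrite ler_wpM2l.
  move: ll => /=; lra.
have h0 : 0 < h 0%N.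
  rewrite /h addn0 divr_gt0 ?degsR_gt0 // subr_gt0 ltr_ln ?posrE ?height_gt0 //.
  rewrite (escaping_height ez); case: ez => zr _; apply: lt_le_trans zr.
  by apply: lt_le_trans escape_radius_ge1; nra.
apply: lt_le_trans h0 _.
apply: limr_ge; first by apply/cvg_ex; exists (green q b e z); exact: green_cvg.
near=> n; have kn : (k <= n)%N by near: n; exists k.
have -> : n = (k + (n - k))%N by rewrite subnKC.
apply: le_trans (hnd _ _ (leq0n (n - k))) _; rewrite /h /loggrowth.
rewrite ler_pM2r ?invr_gt0 ?degsR_gt0 // gerBl ln_ge0 //; lra.
Unshelve. all: by end_near. Qed.

End Recurrence.

(** * Dependence on the point and on the parameters *)

Section ParameterLimits.
Context {R : realType} {T : Type} (F : set_system T) {FF : Filter F}.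

Lemma cvg_exprC (f : T -> Cplx R) (x : Cplx R) n :
  f @ F --> x -> (fun t => f t ^+ n) @ F --> x ^+ n.
Proof.
move=> fx; elim: n => [|n IH].
  rewrite expr0; have -> : (fun t => f t ^+ 0) = fun=> 1.
    by apply/funext => t; rewrite expr0.
  exact: cvg_cst.
have -> : (fun t => f t ^+ n.+1) = f \* (fun t => f t ^+ n).
  by apply/funext => t; rewrite exprS.
by rewrite exprS; exact: cvgM.
Qed.

Lemma cvg_sumC n (f : nat -> T -> Cplx R) (x : nat -> Cplx R) :
  (forall i, f i @ F --> x i) ->
  (fun t => \sum_(i < n) f i t) @ F --> \sum_(i < n) x i.
Proof.
move=> fx; elim: n => [|n IH].
  have -> : (fun t => \sum_(i < 0) f i t) = fun=> 0.
    by apply/funext => t; rewrite big_ord0.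
  by rewrite big_ord0; exact: cvg_cst.
have -> : (fun t => \sum_(i < n.+1) f i t) = (fun t => \sum_(i < n) f i t) \+ f n.
  by apply/funext => t; rewrite big_ord_recr.
rewrite [X in _ --> X]big_ord_recr; exact: (cvgD IH (fx n)).
Qed.

Lemma cvg_horner (r_ : T -> {poly Cplx R}) (r : {poly Cplx R})
    (y_ : T -> Cplx R) (y : Cplx R) :
  (\forall t \near F, size (r_ t) = size r) ->
  (forall i, (fun t => (r_ t)`_i) @ F --> r`_i) ->
  y_ @ F --> y -> (fun t => (r_ t).[y_ t]) @ F --> r.[y].
Proof.
move=> sr cr cy; rewrite horner_coef.
apply: (@cvg_trans _ ((fun t => \sum_(i < size r) (r_ t)`_i * y_ t ^+ i) @ F)).
  by apply: near_eq_cvg; apply: filterS sr => t st; rewrite horner_coef st.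
apply: (@cvg_sumC _ (fun i t => (r_ t)`_i * y_ t ^+ i) (fun i => r`_i * y ^+ i)).
by move=> i; exact: (cvgM (cr i) (cvg_exprC cy)).
Qed.

Lemma cvg_orb (q_ : T -> nat -> {poly Cplx R}) (b_ : T -> nat -> Cplx R)
    (z_ : T -> C2 R) (q : nat -> {poly Cplx R}) (b : nat -> Cplx R) (z : C2 R) k :
  (forall k, \forall t \near F, size (q_ t k) = size (q k)) ->
  (forall k i, (fun t => (q_ t k)`_i) @ F --> (q k)`_i) ->
  (forall k, (fun t => b_ t k) @ F --> b k) ->
  z_ @ F --> z ->
  (fun t => orb (q_ t) (b_ t) k (z_ t)) @ F --> orb q b k z.
Proof.
move=> sq cq cb cz; elim: k => [|k IH]; first exact: cz.
move/cvg_C2P: IH => [IH1 IH2]; apply/cvg_C2P; split; first exact: IH2.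
exact: (cvgB (cvg_horner (sq k) (cq k) IH2) (cvgM (cb k) IH1)).
Qed.

Lemma cvg_ln (f : T -> R) (x : R) : 0 < x -> f @ F --> x ->
  (fun t => ln (f t)) @ F --> ln x.
Proof. by move=> x0 fx; apply: cvg_comp fx _; exact: continuous_ln. Qed.

Lemma cvg_height (z_ : T -> C2 R) (z : C2 R) :
  z_ @ F --> z -> (fun t => height (z_ t)) @ F --> height z.
Proof.
move=> /cvg_csup/cvgrPdist_lt cz; apply/cvgrPdist_lt => e /cz.
apply: filterS => t; apply: le_lt_trans; rewrite /height.
move: (csup z) (csup (z_ t)) => u v; rewrite /Num.max.
by case: ifPn; case: ifPn; rewrite -?leNgt => h1 h2;
  case: (ler0P (_ - _)); case: (ler0P (u - v)); lra.
Qed.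

Lemma cvg_loggrowth (q_ : T -> nat -> {poly Cplx R}) (b_ : T -> nat -> Cplx R)
    (z_ : T -> C2 R) (q : nat -> {poly Cplx R}) (b : nat -> Cplx R) e (z : C2 R) k :
  (forall k, \forall t \near F, size (q_ t k) = size (q k)) ->
  (forall k i, (fun t => (q_ t k)`_i) @ F --> (q k)`_i) ->
  (forall k, (fun t => b_ t k) @ F --> b k) ->
  z_ @ F --> z ->
  (fun t => loggrowth (q_ t) (b_ t) e k (z_ t)) @ F --> loggrowth q b e k z.
Proof.
move=> sq cq cb cz; apply: cvgMl; apply: cvg_ln; first exact: height_gt0.
by apply: cvg_height; exact: cvg_orb.
Qed.

Lemma geometric_small (C e : R) : 0 < e -> \forall k \near \oo, C / 2 ^+ k < e.
Proof.
move=> e0; have : (fun k => C / 2 ^+ k) @ \oo --> (0 : R).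
  have -> : (fun k => C / 2 ^+ k) = geometric C (1 / 2 : R).
    by apply/funext => k; rewrite /geometric /= expr_div_n expr1n mul1r.
  by apply: cvg_geometric; rewrite ger0_norm; lra.
move=> /cvgrPdist_lt/(_ _ e0); apply: filterS => k.
by rewrite sub0r normrN; apply: le_lt_trans; exact: ler_norm.
Qed.

(** The approximations [loggrowth] converge at a rate which depends only on the
    class of the recurrence and on a bound for the point. *)
Lemma cvg_green A E (q_ : T -> nat -> {poly Cplx R}) (b_ : T -> nat -> Cplx R)
    (z_ : T -> C2 R) (q : nat -> {poly Cplx R}) (b : nat -> Cplx R) e (z : C2 R) :
  recurrence_class A E q b e ->
  (\forall t \near F, recurrence_class A E (q_ t) (b_ t) e) ->
  (forall k i, (fun t => (q_ t k)`_i) @ F --> (q k)`_i) ->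
  (forall k, (fun t => b_ t k) @ F --> b k) ->
  z_ @ F --> z ->
  (fun t => green (q_ t) (b_ t) e (z_ t)) @ F --> green q b e z.
Proof.
move=> H H_ cq cb cz.
have sq k : \forall t \near F, size (q_ t k) = size (q k).
  by apply: filterS H_ => t Ht; have [_ -> _ _ _] := Ht k; have [_ ->] := H k.
pose R0 := Num.max (escape_radius A E) (csup z + 1).
have rR : escape_radius A E <= R0 by rewrite le_max lexx.
have zR : csup z + 1 <= R0 by rewrite le_max lexx orbT.
apply/cvgrPdist_lt => eps eps0.
have eps3 : 0 < eps / 3 by rewrite divr_gt0.
have [k _ /(_ k (leqnn k)) kP] := geometric_small (ln (distortion A E R0)) eps3.
have := cvg_loggrowth (k := k) (e := e) sq cq cb cz.
move/cvgrPdist_lt => /(_ _ eps3) cg.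
near=> t.
have Ht : recurrence_class A E (q_ t) (b_ t) e by near: t.
have zt : csup (z_ t) <= R0.
  apply: le_trans zR; rewrite -lerBlDl; apply: le_trans (ler_norm _) _.
  apply: le_trans (csup_dist _ _) _; apply: ltW; near: t.
  by move/cvg_csupP: cz; apply.
have z0 : csup z <= R0 by apply: le_trans zR; rewrite lerDl.
have h1 := le_lt_trans (green_err H k rR z0) kP.
have h2 := le_lt_trans (green_err Ht k rR zt) kP.
have h3 : `|loggrowth q b e k z - loggrowth (q_ t) (b_ t) e k (z_ t)| < eps / 3.
  by near: t.
move: h1 h2 h3; rewrite !ltr_norml => /andP[? ?] /andP[? ?] /andP[? ?].
by apply/andP; split; lra.
Unshelve. all: by end_near. Qed.

End ParameterLimits.

Section SingleRecurrence.
Context {R : realType} {A : R} {E : nat} {q : nat -> {poly Cplx R}}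
  {b : nat -> Cplx R} {e : nat -> nat}.
Hypothesis H : recurrence_class A E q b e.
Implicit Types z w : C2 R.

Lemma continuous_orb k : continuous (orb q b k).
Proof.
move=> z; apply: (@cvg_orb _ _ _ _ (fun=> q) (fun=> b) (fun w => w)).
by move=> j; near=> t.
by move=> j i; exact: cvg_cst.
by move=> j; exact: cvg_cst.
Unshelve. all: by end_near. Qed.

Lemma continuous_green : continuous (green q b e).
Proof.
move=> z; apply: (@cvg_green _ _ _ _ A E (fun=> q) (fun=> b) (fun w => w)) => //.
by near=> t.
by move=> j i; exact: cvg_cst.
by move=> j; exact: cvg_cst.
Unshelve. all: by end_near. Qed.

(** An orbit which never escapes stays in a fixed bidisc, so that the numerators of
    [loggrowth] are bounded while the degrees tend to infinity. *)
Lemma never_escaping_bounded z : (forall k, ~ escaping A E (orb q b k z)) ->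
  (exists B, forall k, csup (orb q b k z) <= B) /\ green q b e z = 0.
Proof.
move=> nesc; pose R0 := Num.max (escape_radius A E) (csup z).
have rR : escape_radius A E <= R0 by rewrite le_max lexx.
have zR : csup z <= R0 by rewrite le_max lexx orbT.
have bd k : csup (orb q b k z) <= R0.
  by have [/nesc|] := escaping_or_bounded H k rR zR.
split; first by exists R0.
have R1 : 1 <= R0.
  apply: le_trans rR; apply: le_trans (escape_radius_ge1 H).
  have := class_A_ge1 H; have : 1 <= E.+1%:R :> R by rewrite ler1n.
  nra.
have lim0 : (fun k => loggrowth q b e k z) @ \oo --> (0 : R).
  apply/cvgrPdist_lt => eps eps0; near=> k.
  have h1 : 0 <= ln (height (orb q b k z)) by rewrite ln_ge0 // height_ge1.
  have h2 : ln (height (orb q b k z)) <= ln R0.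
    by rewrite ler_ln ?posrE ?height_gt0 ?height_le //; lra.
  rewrite sub0r normrN ger0_norm; last by rewrite divr_ge0.
  apply: (@le_lt_trans _ _ (ln R0 / 2 ^+ k)); last first.
    by near: k; exact: geometric_small.
  rewrite /loggrowth; apply: ler_pM => //.
  by rewrite lef_pV2 ?posrE ?exprn_gt0 ?degsR_gt0 ?(degsR_gt0 H) ?(degs_ge H).
by apply: cvg_lim lim0.
Unshelve. all: by end_near. Qed.

Lemma escaping_unbounded k z (B : R) : escaping A E (orb q b k z) ->
  exists N, forall n, (N <= n)%N -> B < csup (orb q b n z).
Proof.
move=> ez; have [n0 _ n0P] := geometric_small B ltr01.
exists (k + n0)%N => n kn; have -> : n = (k + (n - k))%N by lia.
apply: lt_le_trans (csup_ge2 _).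
apply: lt_le_trans (escaping_orb_grow H (n - k) ez).
have : B / 2 ^+ (n - k) < 1 by apply: n0P => /=; lia.
rewrite ltr_pdivrMr ?exprn_gt0 // mul1r => /lt_le_trans; apply.
have z1 := escaping_ge1 H ez.
apply: (@le_trans _ _ ((4 * E.+1%:R) ^+ (n - k) * 1)); last first.
  by rewrite ler_wpM2l // exprn_ge0.
rewrite mulr1 lerXn2r ?nnegrE //.
have : 1 <= E.+1%:R :> R by rewrite ler1n.
lra.
Qed.

Lemma green_ge0 z : 0 <= green q b e z.
Proof.
have [[k ez]|nez] := pselect (exists k, escaping A E (orb q b k z)).
  by rewrite ltW // (green_escaping H ez).
by have [_ ->] := never_escaping_bounded (fun k ez => nez (ex_intro _ k ez)).
Qed.

Lemma green_gt0P z :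
  0 < green q b e z <-> exists k, escaping A E (orb q b k z).
Proof.
split; last by case=> k ez; apply: (green_escaping H ez).
move=> g0; apply: contrapT => nez.
have [_ g0'] := never_escaping_bounded (fun k ez => nez (ex_intro _ k ez)).
by rewrite g0' ltxx in g0.
Qed.

(** A step expands relative distances, measured against the height, by a bounded
    factor: differences grow at most like [t ^ (e - 1)] and heights at least
    like [t ^ e]. *)
Lemma relative_distance_step R0 k z w :
  escape_radius A E <= R0 -> csup z <= R0 ->
  csup (orb q b k z - orb q b k w) <= height (orb q b k z) ->
  csup (orb q b k.+1 z - orb q b k.+1 w) / height (orb q b k.+1 z) <=
  ((E.+1%:R ^+ 2 * 2 ^+ E + 1) * A * distortion A E R0) *
    (csup (orb q b k z - orb q b k w) / height (orb q b k z)).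
Proof.
move=> rR zR; have hge := height_henon_ge H k rR zR.
have t0' := height_gt0 (orb q b k.+1 z).
have dist1 := distortion_ge1 H rR; have A1 := class_A_ge1 H.
move: hge t0' => /=; move: (orb q b k z) (orb q b k w) => {z zR w} z w.
move: (height (henon _ _ z)) (distortion _ _ _) dist1 => t' kap kap1 hge t0' dt.
have [/andP[e2 eE] sq qA _ bA] := H k.
have t1 := height_ge1 z; have ht := height_csup z.
move: (height z) t1 ht hge dt => t t1 ht hge dt.
have t0 : 0 < t by lra.
have d0 := csup_ge0 (z - w).
have d1 : cabs (z.1 - w.1) <= csup (z - w) by exact: (csup_ge1 (z - w)).
have d2 : cabs (z.2 - w.2) <= csup (z - w) by exact: (csup_ge2 (z - w)).
have wt : csup w <= 2 * t.
  rewrite -[w](subrK z); apply: le_trans (csupD _ _) _.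
  by rewrite csupBC; lra.
have [D DE] : {D | D = csup (z - w)} by exists (csup (z - w)).
rewrite -DE in d0 d1 d2 dt *.
have [T TE] : {T | T = t ^+ (e k).-1} by exists (t ^+ (e k).-1).
have T1 : 1 <= T by rewrite TE exprn_ege1.
have eT : t ^+ e k = T * t by rewrite TE -exprSr prednK // (leq_trans _ e2).
have lip : cabs ((q k).[z.2] - (q k).[w.2]) <=
    E.+1%:R ^+ 2 * 2 ^+ E * A * T * D.
  apply: (@le_trans _ _ ((e k).+1%:R ^+ 2 * A * (2 * t) ^+ (e k).-1 * cabs (z.2 - w.2))).
    apply: (horner_lip sq qA); first lra.
      by apply: le_trans (csup_ge2 z) _; lra.
    by apply: le_trans (csup_ge2 w) _.
  rewrite exprMn -TE; apply: ler_pM => //; rewrite ?cabs_ge0 //.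
    by rewrite !mulr_ge0 ?exprn_ge0 //; lra.
  rewrite mulrA ler_wpM2r //; first lra.
  rewrite [leRHS]mulrAC; apply: ler_pM => //.
  by rewrite mulr_ge0 ?exprn_ge0 //; lra.
  rewrite ler_wpM2r //; first lra.
    by rewrite lerXn2r ?nnegrE // ler_nat ltnS.
  by rewrite ler_weXn2l //; [lra|move: eE; clear; lia].
have C0 : 0 <= E.+1%:R ^+ 2 * 2 ^+ E :> R by rewrite mulr_ge0 ?exprn_ge0.
rewrite eT in hge; clear TE eT.
move: (E.+1%:R ^+ 2 * 2 ^+ E) C0 lip => C C0 lip.
have step : csup (henon (q k) (b k) z - henon (q k) (b k) w) <=
    (C + 1) * A * T * D.
  have AT : 1 <= A * T by nra.
  have ATD : D <= A * T * D by rewrite ler_peMl.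
  have AD : A * D <= A * T * D by rewrite ler_wpM2r // ler_peMr //; lra.
  have CATD : 0 <= C * A * T * D by rewrite !mulr_ge0 //; lra.
  rewrite /csup /= ge_max; apply/andP; split.
    apply: le_trans d2 _; apply: le_trans ATD _; lra.
  have -> : (q k).[z.2] - b k * z.1 - ((q k).[w.2] - b k * w.1) =
    (q k).[z.2] - (q k).[w.2] - b k * (z.1 - w.1) by ring.
  apply: le_trans (cabsB _ _) _; rewrite cabsM.
  have : cabs (b k) * cabs (z.1 - w.1) <= A * D.
    by apply: ler_pM; rewrite ?cabs_ge0.
  move: lip AD; move: (cabs _) (cabs (b k) * _) => c1 c2; lra.
rewrite ler_pdivrMr //; apply: le_trans step _.
have -> : (C + 1) * A * kap * (D / t) * t' = (C + 1) * A * D / t * (kap * t').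
  by field; rewrite gt_eqF.
have -> : (C + 1) * A * T * D = (C + 1) * A * D / t * (T * t).
  by field; rewrite gt_eqF.
by rewrite ler_wpM2l // divr_ge0 ?mulr_ge0 //; lra.
Qed.

End SingleRecurrence.

(** * Hoelder continuity *)

Section Holder.
Context {R : realType} {A : R} {E : nat} {q : nat -> {poly Cplx R}}
  {b : nat -> Cplx R} {e : nat -> nat}.
Hypothesis H : recurrence_class A E q b e.
Variable R0 : R.
Hypothesis rR : escape_radius A E <= R0.
Implicit Types z w : C2 R.

Let L : R := (E.+1%:R ^+ 2 * 2 ^+ E + 1) * A * distortion A E R0.

Lemma expansion_ge2 : 2 <= L.
Proof.
have A1 := class_A_ge1 H; have k1 := distortion_ge1 H rR.
have c1 : 1 <= E.+1%:R ^+ 2 * 2 ^+ E :> R.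
  by rewrite mulr_ege1 ?exprn_ege1 ?ler1n.
rewrite /L; move: (_ * 2 ^+ E) (distortion _ _ _) c1 k1 => c kap c1 k1.
have : 2 <= (c + 1) * A by nra.
nra.
Qed.

(** As long as the relative distance is at most [1] it is multiplied by at most
    [L] at each step. *)
Lemma orbits_close k z w : csup z <= R0 -> L ^+ k * csup (z - w) <= 1 ->
  csup (orb q b k z - orb q b k w) / height (orb q b k z)
    <= L ^+ k * csup (z - w).
Proof.
move=> zR; have L2 := expansion_ge2.
elim: k => [|k IH] h.
  rewrite expr0 mul1r ler_pdivrMr ?height_gt0 // ler_peMr ?csup_ge0 //.
  exact: height_ge1.
have hk : L ^+ k * csup (z - w) <= 1.
  apply: le_trans h; rewrite exprS -mulrA ler_peMl //; last lra.
  by rewrite mulr_ge0 ?csup_ge0 ?exprn_ge0 //; lra.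
have {}IH := IH hk.
apply: le_trans (relative_distance_step H rR zR _) _.
  by have := le_trans IH hk; rewrite ler_pdivrMr ?height_gt0 // mul1r.
rewrite -/L exprS -[leRHS]mulrA; apply: ler_wpM2l IH; lra.
Qed.

(** A relative distance at most [1] means that the two heights differ by a factor
    at most [2]. *)
Lemma loggrowth_close k z w : csup z <= R0 -> csup w <= R0 ->
  L ^+ k * csup (z - w) <= 1 ->
  `|loggrowth q b e k z - loggrowth q b e k w| <= ln 2 / 2 ^+ k.
Proof.
move=> zR wR h.
have key z1 z2 : csup z1 <= R0 -> L ^+ k * csup (z1 - z2) <= 1 ->
    ln (height (orb q b k z2)) <= ln 2 + ln (height (orb q b k z1)).
  move=> z1R h1; have := le_trans (orbits_close z1R h1) h1.
  rewrite ler_pdivrMr ?height_gt0 // mul1r => h2.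
  have p1 := height_gt0 (orb q b k z1); have p2 := height_gt0 (orb q b k z2).
  rewrite -lnM ?posrE // ler_ln ?posrE ?mulr_gt0 //.
  have q1 := height_ge1 (orb q b k z1).
  apply: height_le; first lra.
  rewrite -[orb q b k z2](subrK (orb q b k z1)); apply: le_trans (csupD _ _) _.
  have q2 := height_csup (orb q b k z1).
  by rewrite csupBC; lra.
have h1 := key _ _ zR h; rewrite csupBC in h; have h2 := key _ _ wR h.
have D0 := degsR_gt0 H k.
rewrite /loggrowth -mulrBl normrM [X in _ * X]gtr0_norm ?invr_gt0 //.
apply: ler_pM; rewrite ?invr_ge0 ?(ltW D0) //.
  by rewrite ler_norml; apply/andP; split; lra.
by rewrite lef_pV2 ?posrE ?exprn_gt0 ?(degs_ge H).
Qed.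

Lemma green_close k z w : csup z <= R0 -> csup w <= R0 ->
  L ^+ k * csup (z - w) <= 1 ->
  `|green q b e z - green q b e w|
    <= (2 * ln (distortion A E R0) + ln 2) / 2 ^+ k.
Proof.
move=> zR wR h; have h1 := green_err H k rR zR; have h2 := green_err H k rR wR.
have h3 := loggrowth_close zR wR h.
have -> : (2 * ln (distortion A E R0) + ln 2) / 2 ^+ k =
  ln (distortion A E R0) / 2 ^+ k + ln 2 / 2 ^+ k + ln (distortion A E R0) / 2 ^+ k.
  by field; rewrite expf_neq0.
move: (_ / 2 ^+ k) (ln 2 / _) h1 h2 h3 => c1 c2.
rewrite !ler_norml => /andP[? ?] /andP[? ?] /andP[? ?].
by apply/andP; split; lra.
Qed.

(** With [k] the last time at which the orbits are known to be close,
    [L ^ (k + 1) * csup (z - w) > 1] and [2 = L ^ alpha] turn [2 ^ - k] into a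
    power of the distance. *)
Lemma green_holder z w : csup z <= R0 -> csup w <= R0 -> csup (z - w) <= 1 ->
  `|green q b e z - green q b e w|
    <= 2 * (2 * ln (distortion A E R0) + ln 2) * csup (z - w) `^ (ln 2 / ln L).
Proof.
move=> zR wR zw1; have L2 := expansion_ge2.
have C0 : 0 <= 2 * ln (distortion A E R0) + ln 2.
  have : 0 <= ln (distortion A E R0) by rewrite ln_ge0 // (distortion_ge1 H).
  have : 0 <= ln (2 : R) by rewrite ln_ge0; lra.
  lra.
have l2 : 0 < ln (2 : R) by rewrite ln_gt0; lra.
have lL : 0 < ln L by rewrite ln_gt0; lra.
have [zw0|zwn0] := eqVneq (csup (z - w)) 0.
  have -> : green q b e z = green q b e w.
    apply/eqP; rewrite -subr_eq0 -normr_le0; apply/ler_addgt0Pr => eps eps0.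
    rewrite add0r.
    have [k _ /(_ k (leqnn k))/ltW] := geometric_small
      (2 * ln (distortion A E R0) + ln 2) eps0.
    by apply: le_trans; apply: green_close => //; rewrite zw0 mulr0.
  by rewrite subrr normr0 mulr_ge0 ?powR_ge0 // mulr_ge0.
set D := csup (z - w) in zw1 zwn0 *.
have D0 : 0 < D by rewrite lt0r zwn0 csup_ge0.
(* for the least such [k] the orbits are still close at time [k - 1] *)
have ex : exists k, 1 < L ^+ k * D.
  have [k _ /(_ k (leqnn k))] := geometric_small 1 D0.
  rewrite ltr_pdivrMr ?exprn_gt0 // mulrC => h; exists k.
  apply: lt_le_trans h _; rewrite ler_wpM2r ?(ltW D0) //.
  by rewrite lerXn2r ?nnegrE //; lra.
have [[|k] kP kmin] := ex_minnP ex.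
  by rewrite expr0 mul1r ltNge zw1 in kP.
have hk : L ^+ k * D <= 1.
  by rewrite leNgt; apply/negP => /kmin; rewrite ltnn.
apply: le_trans (green_close zR wR hk) _.
rewrite [leLHS]mulrC [in leRHS](mulrC 2) -mulrA [leLHS]mulrC ler_wpM2l //.
rewrite /powR (negbTE zwn0).
have p2 : 2 ^- k.+1 <= expR (ln 2 / ln L * ln D) :> R.
  have -> : 2 ^- k.+1 = expR (- (ln 2 * k.+1%:R)) :> R.
    by rewrite expRN expRM_natr lnK // posrE.
  rewrite ler_expR lerNl -mulrA -mulrN ler_wpM2l ?(ltW l2) //.
  rewrite (mulrC (ln L)^-1) -mulNr ler_pdivrMr // -subr_ge0 opprK.
  rewrite mulrC mulr_natr -lnXn; last lra.
  rewrite -lnM ?posrE ?exprn_gt0 //; last lra.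
  by rewrite ln_ge0 // ltW.
have -> : 2 ^- k = 2 * 2 ^- k.+1 :> R.
  by rewrite exprS; field; rewrite expf_neq0.
by rewrite ler_wpM2l.
Qed.

End Holder.

Lemma locally_holder_green {R : realType} (A : R) E q b e :
  recurrence_class A E q b e -> locally_holder (green q b e).
Proof.
move=> H z; pose R0 := Num.max (escape_radius A E) (csup z + 1).
have rR : escape_radius A E <= R0 by rewrite le_max lexx.
have zR : csup z + 1 <= R0 by rewrite le_max lexx orbT.
have L2 := expansion_ge2 H rR; set L := (X in 2 <= X) in L2.
have k1 := distortion_ge1 H rR.
have l2 : 0 < ln (2 : R) by rewrite ln_gt0; lra.
have lL : 0 < ln L by rewrite ln_gt0; lra.
exists (ln 2 / ln L).
  rewrite divr_gt0 //= ler_pdivrMr // mul1r ler_ln ?posrE //; lra.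
exists (2 * (2 * ln (distortion A E R0) + ln 2)).
have near_z : \forall w \near z, csup (w - z) < 1 / 2 by apply: near_csup; lra.
exists ([set w | csup (w - z) < 1 / 2], [set w | csup (w - z) < 1 / 2]) => //.
move=> [z1 z2] [/= h1 h2].
have bd w : csup (w - z) < 1 / 2 -> csup w <= R0.
  move=> h; apply: le_trans zR; rewrite -[w](subrK z).
  by apply: le_trans (csupD _ _) _; lra.
have h12 : csup (z1 - z2) <= 1.
  have -> : z1 - z2 = (z1 - z) + (z - z2) by rewrite addrA subrK.
  by apply: le_trans (csupD _ _) _; rewrite (csupBC z); lra.
apply: le_trans (green_holder H rR (bd _ h1) (bd _ h2) h12) _.
rewrite ler_wpM2l //.
  have : 0 <= ln (distortion A E R0) by rewrite ln_ge0.
  lra.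
apply: ge0_ler_powR; rewrite ?nnegrE ?csup_ge0 ?csup_enorm //.
  by rewrite divr_ge0 // ltW.
exact: le_trans (csup_ge0 _) (csup_enorm _).
Qed.

(** * Plurisubharmonicity *)

Section CircleMeans.
Context {R : realType}.
Implicit Types (s t : R) (r x : Cplx R) (f : {poly Cplx R}).

Lemma cisD s t : cis (s + t) = cis s * cis t.
Proof. by rewrite /cis cosD sinD; congr Complex; rewrite addrC. Qed.

Lemma cisX t n : cis t ^+ n = cis (t * n%:R).
Proof.
elim: n => [|n IH]; first by rewrite mulr0 /cis cos0 sin0.
by rewrite exprS IH -cisD -natr1 mulrDr mulr1 addrC.
Qed.

Lemma cis2pi : cis (2 * pi) = 1 :> Cplx R.
Proof. by rewrite mulr_natl /cis cos2pi sin2pi. Qed.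

Lemma cis_neq1 t : 0 < t < 2 * pi -> cis t != 1.
Proof.
move=> /andP[t0 tpi]; apply/eqP => /(congr1 (@complex.Re R)) /= ct.
have st : 0 < sin (t / 2) by apply: sin_gt0_pi; rewrite divr_gt0 //= ltr_pdivrMr // mulrC.
move: ct; have -> : t = t / 2 + t / 2 by rewrite -splitr.
rewrite cosD -!expr2 => ct; have := cos2Dsin2 (t / 2); nra.
Qed.

Definition root1 (N : nat) : Cplx R := cis (2 * pi / N%:R).

Lemma root1_prim N : (0 < N)%N -> N.-primitive_root (root1 N).
Proof.
move=> N0; have NR : 0 < N%:R :> R by rewrite ltr0n.
have p0 := pi_gt0 R.
apply/andP; split=> //; apply/forallP => i; apply/eqP.
rewrite unity_rootE; have [->|iN] := eqVneq i.+1 N.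
  by apply/eqP; rewrite /root1 cisX divfK ?gt_eqF // cis2pi.
apply/negbTE; rewrite /root1 cisX; apply: cis_neq1.
have i1 : 0 < i.+1%:R :> R by rewrite ltr0n.
rewrite mulr_gt0 ?divr_gt0 ?mulr_gt0 //= mulrAC ltr_pdivrMr // ltr_pM2l ?mulr_gt0 //.
by rewrite ltr_nat ltn_neqAle iN ltn_ord.
Qed.

Lemma prod_root1 N x r : (0 < N)%N ->
  cabs (\prod_(k < N) (x * root1 N ^+ k - r)) = cabs (r ^+ N - x ^+ N).
Proof.
move=> N0; have [->|x0] := eqVneq x 0.
  under eq_bigr do rewrite mul0r sub0r.
  rewrite prodr_const card_ord exprNn cabsM cabsX cabsN cabs1 expr1n mul1r.
  by rewrite expr0n gtn_eqF // subr0.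
have := factor_Xn_sub_1 (root1_prim N0) => /(congr1 (fun f => f.[r / x])).
rewrite hornerD hornerN hornerC hornerXn horner_prod big_mkord => h.
have -> : r ^+ N - x ^+ N = x ^+ N * ((r / x) ^+ N - 1).
  by rewrite mulrBr mulr1 -exprMn mulrCA mulfV // mulr1.
rewrite (eq_bigr (fun k : 'I_N => - x * ('X - (root1 N ^+ k)%:P).[r / x])).
  by rewrite big_split prodr_const card_ord /= h !cabsM !cabsX cabsN.
by move=> k _; rewrite hornerXsubC; field.
Qed.

(** The product over the vertices of a regular polygon is [|r ^ N - rho ^ N|],
    whose size is at least comparable to [|r| ^ N] unless [rho = |r|]. *)
Lemma prod_circle_root r : r != 0 -> \forall rho \near (1 : R)^'+,
  exists2 kap : R, 0 < kap & forall N, (0 < N)%N ->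
    kap * cabs r ^+ N <= \prod_(k < N) cabs (toC rho * root1 N ^+ k - r).
Proof.
move=> r0; have cr0 : 0 < cabs r by rewrite cabs_gt0.
have n1 : \forall rho \near (1 : R)^'+, (1 < rho) && (rho != cabs r).
  have [r1|r1] := leP (cabs r) 1.
    near=> rho; have h : 1 < rho by near: rho; exact: nbhs_right_gt.
    by rewrite h gt_eqF // (le_lt_trans r1).
  near=> rho; apply/andP; split; first by near: rho; exact: nbhs_right_gt.
  by rewrite lt_eqF //; near: rho; exact: nbhs_right_lt.
apply: filterS n1 => rho /andP[rho1 rhor].
have prodE N : (0 < N)%N -> \prod_(k < N) cabs (toC rho * root1 N ^+ k - r) =
    cabs (r ^+ N - toC rho ^+ N).
  move=> N0; rewrite -prod_root1 //; elim/big_ind2: _ => //.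
    by rewrite cabs1.
  by move=> x1 x2 y1 y2 -> ->; rewrite cabsM.
have rhoE : cabs (toC rho) = rho by rewrite cabs_toC gtr0_norm //; lra.
move: rhor; rewrite neq_lt => /orP[lt|gt].
  exists (1 - rho / cabs r); first by rewrite subr_gt0 ltr_pdivrMr // mul1r.
  move=> [//|N] _; rewrite prodE //.
  apply: le_trans (cabs_lerB _ _); rewrite !cabsX rhoE mulrBl mul1r lerD2l lerN2.
  rewrite exprS [in leRHS]exprS mulrA divfK ?gt_eqF // ler_wpM2l //; first lra.
  by rewrite lerXn2r ?nnegrE ?ltW //; lra.
exists (rho / cabs r - 1); first by rewrite subr_gt0 ltr_pdivlMr // mul1r.
move=> [//|N] _; rewrite prodE // cabsBC.
apply: le_trans (cabs_lerB _ _); rewrite !cabsX rhoE mulrBl mul1r lerD2r.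
rewrite exprS [in leRHS]exprS mulrA divfK ?gt_eqF // ler_wpM2l //; first lra.
by rewrite lerXn2r ?nnegrE ?ltW //; lra.
Unshelve. all: by end_near. Qed.

(** Radii slightly above [1] avoid the moduli of the finitely many roots, so the
    bounds for the linear factors can be multiplied. *)
Lemma prod_circle_poly f : f.[0] != 0 -> \forall rho \near (1 : R)^'+,
  exists2 kap : R, 0 < kap & forall N, (0 < N)%N ->
    kap * cabs f.[0] ^+ N <= \prod_(k < N) cabs f.[toC rho * root1 N ^+ k].
Proof.
have [rs ->] := closed_field_poly_normal f.
rewrite hornerZ mulf_eq0 negb_or => /andP[c0]; move: (lead_coef f) c0 => c c0.
elim: rs => [|r rs IH].
  rewrite big_nil => _; near=> rho; exists 1 => // N _; rewrite mul1r.
  under eq_bigr do rewrite hornerZ hornerC mulr1.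
  by rewrite prodr_const card_ord hornerC mulr1.
rewrite big_cons hornerM mulf_eq0 negb_or hornerXsubC sub0r oppr_eq0.
move=> /andP[r0 /IH h]; apply: filterS2 (prod_circle_root r0) h => rho.
move=> [k1 k10 k1P] [k2 k20 k2P]; exists (k1 * k2); first exact: mulr_gt0.
move=> N N0; rewrite (eq_bigr (fun k : 'I_N => cabs (toC rho * root1 N ^+ k - r) *
  cabs (c *: \prod_(z <- rs) ('X - z%:P)).[toC rho * root1 N ^+ k])); last first.
  by move=> k _; rewrite !hornerZ hornerM hornerXsubC !cabsM mulrCA.
rewrite big_split /= mulrCA cabsM cabsN exprMn mulrACA.
by apply: ler_pM (k1P _ N0) (k2P _ N0); rewrite mulr_ge0 ?exprn_ge0 ?cabs_ge0 // ltW.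
Unshelve. all: by end_near. Qed.

(** The constant [C] does not depend on the number [N] of sample points: it
    disappears from the averages as [N] grows. This is how Jensen's inequality
    comes out of finite products. *)
Lemma sum_circle_poly f : f.[0] != 0 -> \forall rho \near (1 : R)^'+,
  exists C : R, forall (phi : Cplx R -> R) N, (0 < N)%N ->
    (forall x, f.[x] != 0 -> ln (cabs f.[x]) <= phi x) ->
    N%:R * ln (cabs f.[0]) - C <= \sum_(k < N) phi (toC rho * root1 N ^+ k).
Proof.
move=> f0; apply: filterS (prod_circle_poly f0) => rho [kap kap0 kapP].
exists (- ln kap) => phi N N0 phiP; rewrite opprK.
have cf0 : 0 < cabs f.[0] by rewrite cabs_gt0.
have lhs0 : 0 < kap * cabs f.[0] ^+ N by rewrite mulr_gt0 // exprn_gt0.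
have prod0 := lt_le_trans lhs0 (kapP _ N0).
have fk (k : 'I_N) : f.[toC rho * root1 N ^+ k] != 0.
  rewrite -cabs_eq0; apply: contraTneq prod0 => fk0.
  by rewrite (bigD1 k) //= fk0 mul0r ltxx.
apply: (@le_trans _ _ (ln (\prod_(k < N) cabs f.[toC rho * root1 N ^+ k]))).
  rewrite mulr_natl -lnXn // addrC -lnM ?posrE ?exprn_gt0 // ler_ln ?posrE //.
  exact: kapP.
apply: (@le_trans _ _ (\sum_(k < N) ln (cabs f.[toC rho * root1 N ^+ k]))).
  suff [] : 0 < \prod_(k < N) cabs f.[toC rho * root1 N ^+ k] /\
     ln (\prod_(k < N) cabs f.[toC rho * root1 N ^+ k]) <=
    \sum_(k < N) ln (cabs f.[toC rho * root1 N ^+ k]) by [].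
  elim/big_ind2: _ => [|x1 x2 y1 y2 [p1 l1] [p2 l2]|k _].
  by rewrite ln1.
  by rewrite mulr_gt0 // lnM ?posrE // lerD.
  by rewrite cabs_gt0.
by apply: ler_sum => k _; exact: phiP.
Qed.

End CircleMeans.

Section RiemannSums.
Context {R : realType}.
Implicit Types (h : R -> R).

Lemma unif_cont_itv h (a c e : R) : continuous h -> 0 < e ->
  \forall dl \near 0^'+, forall s t, s \in `[a, c] -> `|t - s| <= dl ->
    `|h t - h s| <= e.
Proof.
move=> hc e0; have e2 : 0 < e / 2 by rewrite divr_gt0.
have cK : compact `[a, c]%classic by exact: segment_compact.
move/compact_near_coveringP: cK => cov.
have F0 : Filter (0^'+ : set_system R) by exact: _.
suff H : forall x, `[a, c]%classic x -> \forall s \near x & dl \near 0^'+,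
    forall t, `|t - s| <= dl -> `|h t - h s| <= e.
  have := cov _ _ (fun dl s => forall t, `|t - s| <= dl -> `|h t - h s| <= e) F0 H.
  by apply: filterS => dl P s t sac; exact: P.
move=> x _.
have /cvgrPdist_lt/(_ _ e2) := hc x.
move=> /nbhs_ballP[eta /= eta0 etaP].
exists (ball x (eta / 2), [set dl | 0 < dl < eta / 2]).
  split; first by apply: nbhsx_ballx; rewrite divr_gt0.
  near=> dl; apply/andP; split; first by near: dl; exact: nbhs_right_gt.
  by near: dl; apply: nbhs_right_lt; rewrite divr_gt0.
move=> [s dl] [/= bs /andP[dl0 dle]] t ts.
rewrite /ball /= in bs etaP.
have hs : `|h x - h s| < e / 2.
  by apply: etaP; apply: lt_trans bs _; lra.
have ht : `|h x - h t| < e / 2.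
  apply: etaP; rewrite /ball_ /=.
  have -> : x - t = (x - s) - (t - s) by rewrite opprB addrA subrK.
  apply: le_lt_trans (ler_normB _ _) _; rewrite (splitr eta).
  by rewrite ltrD // (le_lt_trans ts).
rewrite distrC in ht; have -> : h t - h s = (h t - h x) + (h x - h s).
  by rewrite addrA subrK.
by apply: le_trans (ler_normD _ _) _; rewrite (splitr e) lerD // ltW.
Unshelve. all: by end_near. Qed.

Lemma integrable_itv_continuous h (i : interval R) a c : continuous h ->
  [set` i] `<=` `[a, c]%classic ->
  lebesgue_measure.-integrable [set` i] (EFin \o h).
Proof.
move=> hc iac.
have hi : lebesgue_measure.-integrable `[a, c] (EFin \o h).
  apply: continuous_compact_integrable; first exact: segment_compact.
  exact: continuous_subspaceT.
by apply: integrableS hi.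
Qed.

Lemma Rintegral_ge_sum h (dl e : R) n : continuous h -> 0 < dl ->
  (forall k t, (k < n)%N -> k%:R * dl <= t <= k.+1%:R * dl ->
     h (k%:R * dl) - e <= h t) ->
  dl * (\sum_(k < n) h (k%:R * dl) - n%:R * e) <=
    \int[lebesgue_measure]_(t in `[0, n%:R * dl]) h t.
Proof.
move=> hc dl0; elim: n => [|n IH] hP.
  rewrite big_ord0 !mul0r subr0 mulr0 set_itv1 Rintegral_set1 //.
have {}IH := IH (fun k t kn => hP k t (ltnW kn)).
have nd : n%:R * dl <= n.+1%:R * dl by rewrite ler_wpM2r ?(ltW dl0) // ler_nat.
have n0 : 0 <= n%:R * dl by rewrite mulr_ge0 // ltW.
have hi : lebesgue_measure.-integrable `[0, n.+1%:R * dl] (EFin \o h).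
  by apply: (integrable_itv_continuous (a := 0) (c := n.+1%:R * dl)).
have := Rintegral_itvB hi (x := n%:R * dl).
rewrite !bnd_simp => /(_ n0 nd) => eqB.
have lo : dl * (h (n%:R * dl) - e) <=
    \int[lebesgue_measure]_(t in `]n%:R * dl, n.+1%:R * dl]) h t.
  have sub : `]n%:R * dl, n.+1%:R * dl]%classic `<=`
      `[n%:R * dl, n.+1%:R * dl]%classic by exact: subset_itv_oc_cc.
  have <- : \int[lebesgue_measure]_(t in `]n%:R * dl, n.+1%:R * dl])
      (h (n%:R * dl) - e) = dl * (h (n%:R * dl) - e).
    rewrite Rintegral_cst //= lebesgue_measure_itv /= lte_fin.
    rewrite ltr_pM2r // ltr_nat ltnSn -EFinB /= mulrC; congr (_ * _).
    by rewrite -mulrBl -natr1 addrAC subrr add0r mul1r.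
  apply: le_Rintegral => //.
    by apply: (integrable_itv_continuous _ sub) => t; exact: cvg_cst.
    exact: (integrable_itv_continuous _ sub).
  move=> t /=; rewrite in_itv /= => /andP[h1 h2]; apply: hP => //.
  by rewrite (ltW h1).
rewrite big_ord_recr /= -natr1; rewrite -natr1 in eqB lo.
move: eqB IH lo; move: (Rintegral _ _ _) (Rintegral _ _ _) (Rintegral _ _ _).
move=> I1 I2 I3 eqB; lra.
Qed.

(** The left-hand side of the hypothesis, times [2 * pi / N], tends to
    [2 * pi * (c - e)] and the right-hand side to the integral. *)
Lemma mean_ge_riemann h (c : R) : continuous h ->
  (forall e : R, 0 < e -> exists C, forall N, (0 < N)%N ->
    N%:R * (c - e) - C <= \sum_(k < N) h (k%:R * (2 * pi / N%:R))) ->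
  2 * pi * c <= \int[lebesgue_measure]_(t in `[0, 2 * pi]) h t.
Proof.
move=> hc hS; apply/ler_addgt0Pr => /= e; move: (e : R) => {}e e0.
have p0 : 0 < 2 * pi :> R by rewrite mulr_gt0 // pi_gt0.
pose e' : R := e / (2 * pi) / 3.
have e'0 : 0 < e' by rewrite !divr_gt0.
have [C CP] := hS _ e'0.
have [dl0 /= dl00 dlP] := unif_cont_itv 0 (2 * pi) hc e'0.
have C1 : 0 < `|C| + 1 by rewrite ltr_wpDl.
have eta0 : 0 < Num.min (dl0 / (2 * pi)) (e / 3 / (2 * pi * (`|C| + 1))).
  by rewrite lt_min !divr_gt0 ?mulr_gt0 ?pi_gt0.
have [n _ /(_ n (leqnn n))] := near_infty_natSinv_lt (PosNum eta0).
rewrite /= lt_min ltr_pdivlMr // ltr_pdivlMr ?mulr_gt0 ?pi_gt0 // => /andP[nd nC].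
have N0 : 0 < n.+1%:R :> R by rewrite ltr0n.
have Ndl : n.+1%:R * (2 * pi / n.+1%:R) = 2 * pi :> R.
  by rewrite mulrC divfK // gt_eqF.
have dlN0 : 0 < 2 * pi / n.+1%:R :> R by rewrite divr_gt0.
have SP := CP n.+1 isT.
have lo : 2 * pi / n.+1%:R * (\sum_(k < n.+1) h (k%:R * (2 * pi / n.+1%:R)) -
    n.+1%:R * e') <= \int[lebesgue_measure]_(t in `[0, 2 * pi]) h t.
  rewrite -[X in `[0, X]]Ndl; apply: Rintegral_ge_sum => // k t kn /andP[t1 t2].
  rewrite lerBlDr -lerBlDl.
  apply: le_trans (ler_norm _) _; rewrite distrC.
  apply: (dlP (2 * pi / n.+1%:R)) => //.
    by rewrite /= sub0r normrN gtr0_norm // mulrC.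
    rewrite in_itv /= mulr_ge0 ?(ltW dlN0) //= -[leRHS]Ndl.
    by rewrite ler_wpM2r ?(ltW dlN0) // ler_nat ltnW.
  rewrite ger0_norm ?subr_ge0 // lerBlDl.
  by move: t2; rewrite -natr1 mulrDl mul1r.
have e'E : 2 * pi * e' = e / 3 by rewrite /e' mulrA (mulrC (2 * pi)) divfK // gt_eqF.
apply: le_trans (lerD lo (lexx e)).
have CN : 2 * pi / n.+1%:R * C <= e / 3.
  apply: (@le_trans _ _ (n.+1%:R^-1 * (2 * pi * (`|C| + 1)))); last exact: ltW.
  rewrite [leLHS]mulrAC [leRHS]mulrC ler_wpM2r ?invr_ge0 //.
  by rewrite ler_wpM2l ?(ltW p0) // (le_trans (ler_norm C)) // lerDl.
have h2 : 2 * pi / n.+1%:R * (n.+1%:R * (c - e') - C - n.+1%:R * e') <=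
  2 * pi / n.+1%:R * (\sum_(k < n.+1) h (k%:R * (2 * pi / n.+1%:R)) -
    n.+1%:R * e') by rewrite ler_wpM2l ?(ltW dlN0) // lerD2r.
have h3 : 2 * pi / n.+1%:R * (n.+1%:R * (c - e') - C - n.+1%:R * e') =
  2 * pi * c - 2 * (2 * pi * e') - 2 * pi / n.+1%:R * C.
  by field; rewrite gt_eqF.
move: h2; rewrite h3 e'E; move: (_ * (_ - _)) (2 * pi / _ * C) CN => x y.
by move: (2 * pi * c) e0 => u; clear; lra.
Qed.

End RiemannSums.

Section SubMeanValue.
Context {R : realType}.

Lemma near_circle (phi : Cplx R -> R) (e : R) : continuous phi -> 0 < e ->
  \forall rho \near (1 : R)^'+, forall t, t \in `[0, 2 * pi] ->
    `|phi (toC rho * cis t) - phi (cis t)| <= e.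
Proof.
move=> cphi e0; have e2 : 0 < e / 2 by rewrite divr_gt0.
have cK : compact `[0, 2 * pi : R]%classic by exact: segment_compact.
move/compact_near_coveringP: cK => cov.
have F0 : Filter ((1 : R)^'+ : set_system R) by exact: _.
suff H : forall x, `[0, 2 * pi : R]%classic x -> \forall t \near x & rho \near (1 : R)^'+,
    `|phi (toC rho * cis t) - phi (cis t)| <= e.
  have := cov _ _ (fun rho t => `|phi (toC rho * cis t) - phi (cis t)| <= e) F0 H.
  by apply: filterS => rho P t tI; exact: P.
move=> x _.
pose FF : set_system (R * R) := filter_prod (nbhs (x : R)) (1^'+ : set_system R).
have FF0 : Filter FF by exact: filter_prod_filter.
have fst : (fun u : R * R => u.1) @ FF --> (x : R) by exact: cvg_fst.
have snd : (fun u : R * R => u.2) @ FF --> (1 : R).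
  apply: cvg_trans (_ : _ --> (1 : R)^'+) _; first exact: cvg_snd.
  exact: cvg_at_right_filter cvg_id.
have cisx : (fun u : R * R => cis u.1) @ FF --> (cis x : Cplx R).
  exact: (cvg_comp _ _ fst (@continuous_cis R x)).
have c1 : (fun u : R * R => phi (cis u.1)) @ FF --> phi (cis x).
  exact: (cvg_comp _ _ cisx (cphi (cis x))).
have cis2 : (fun u : R * R => toC u.2 * cis u.1) @ FF --> (cis x : Cplx R).
  have h := cvgM (cvg_toC FF0 snd) cisx.
  by rewrite toC1 mul1r in h; exact: h.
have c2 : (fun u : R * R => phi (toC u.2 * cis u.1)) @ FF --> phi (cis x).
  exact: (cvg_comp _ _ cis2 (cphi (cis x))).
move/cvgrPdist_lt/(_ _ e2): c1 => c1; move/cvgrPdist_lt/(_ _ e2): c2 => c2.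
suff : FF [set u | `|phi (toC u.2 * cis u.1) - phi (cis u.1)| <= e] by [].
apply: (@filterS2 _ FF FF0 _ _ _ _ c1 c2) => -[t rho] /= h1 h2.
have -> : phi (toC rho * cis t) - phi (cis t) =
  (phi (cis x) - phi (cis t)) - (phi (cis x) - phi (toC rho * cis t)).
  by ring.
by apply: le_trans (ler_normB _ _) _; rewrite (splitr e) lerD // ltW.
Qed.

(** The products are controlled on circles of radius [rho > 1] only;
    [near_circle] brings the sums back to the unit circle at an arbitrarily small
    cost. *)
Lemma poly_sub_mean (f : {poly Cplx R}) (phi : Cplx R -> R) : continuous phi ->
  f.[0] != 0 -> (forall x, f.[x] != 0 -> ln (cabs f.[x]) <= phi x) ->
  2 * pi * ln (cabs f.[0]) <=
    \int[lebesgue_measure]_(t in `[0, 2 * pi]) phi (cis t).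
Proof.
move=> cphi f0 fphi; apply: mean_ge_riemann => [t|e e0].
  by apply: continuous_comp; [exact: continuous_cis|exact: cphi].
(* any radius close enough to 1 serves both for the products and for the circle *)
near (1 : R)^'+ => rho.
have rhoP : forall t, t \in `[0, 2 * pi] ->
    `|phi (toC rho * cis t) - phi (cis t)| <= e.
  by near: rho; exact: near_circle.
have [C CP] : exists C : R, forall (phi : Cplx R -> R) N, (0 < N)%N ->
    (forall x, f.[x] != 0 -> ln (cabs f.[x]) <= phi x) ->
    N%:R * ln (cabs f.[0]) - C <= \sum_(k < N) phi (toC rho * root1 N ^+ k).
  by near: rho; exact: sum_circle_poly.
exists C => N N0; have NR : 0 < N%:R :> R by rewrite ltr0n.
have h : \sum_(k < N) phi (toC rho * root1 N ^+ k) <=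
    \sum_(k < N) (phi (cis (k%:R * (2 * pi / N%:R))) + e).
  apply: ler_sum => k _; rewrite /root1 cisX (mulrC _ k%:R) -lerBlDl.
  apply: le_trans (ler_norm _) _; apply: rhoP.
  have p0 : 0 <= 2 * pi / N%:R :> R.
    by rewrite divr_ge0 ?mulr_ge0 ?pi_ge0.
  rewrite in_itv /= mulr_ge0 //=.
  rewrite mulrCA ger_pMr ?mulr_gt0 ?pi_gt0 // ler_pdivrMr // mul1r.
  by rewrite ler_nat ltnW.
have := le_trans (CP phi N N0 fphi) h.
rewrite big_split /= sumr_const card_ord -[e *+ N]mulr_natl mulrBr.
lra.
Unshelve. all: by end_near. Qed.

Context {A : R} {E : nat} {q : nat -> {poly Cplx R}} {b : nat -> Cplx R}
  {e : nat -> nat}.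
Hypothesis H : recurrence_class A E q b e.

Lemma orb_line_poly k (z v : C2 R) : exists P Q : {poly Cplx R},
  forall x, orb q b k (z + x *: v) = (P.[x], Q.[x]).
Proof.
elim: k => [|k [P [Q PQ]]].
  exists (z.1%:P + v.1 *: 'X), (z.2%:P + v.2 *: 'X) => x.
  by rewrite !hornerD !hornerC !hornerZ !hornerX [v.1 * x]mulrC [v.2 * x]mulrC.
exists Q, (q k \Po Q - b k *: P) => x.
by rewrite /= PQ /henon /= hornerD hornerN hornerZ horner_comp.
Qed.

Lemma cvg_affine (x a c : Cplx R) : (fun t : Cplx R => a + t * c) @ x --> a + x * c.
Proof.
have FF : Filter (nbhs x) by exact: _.
have h1 : (fun t : Cplx R => a) @ x --> a by apply: cvg_cst.
have h2 : (fun t : Cplx R => t * c) @ x --> x * c.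
  exact: (cvgM (@cvg_id _ (nbhs x)) (cvg_cst c)).
exact: (cvgD h1 h2).
Qed.

Lemma cvg_line (z v : C2 R) (x : Cplx R) :
  (fun t : Cplx R => z + t *: v) @ x --> z + x *: v.
Proof.
have FF : Filter (nbhs x) by exact: _.
apply/cvg_C2P; split.
  have -> : (fun t : Cplx R => (z + t *: v).1) = (fun t => z.1 + t * v.1) by [].
  exact: cvg_affine.
have -> : (fun t : Cplx R => (z + t *: v).2) = (fun t => z.2 + t * v.2) by [].
exact: cvg_affine.
Qed.

Lemma continuous_line (z v : C2 R) : continuous (fun x : Cplx R => z + x *: v).
Proof. by move=> x; apply: cvg_line. Qed.

Lemma continuous_circle (u : C2 R -> R) (z v : C2 R) : continuous u ->
  continuous (fun t : R => u (z + cis t *: v)).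
Proof.
move=> cu t.
have c1 : (fun t : R => z + cis t *: v) @ t --> z + cis t *: v.
  apply: (cvg_comp _ _ (@continuous_cis R t) (@continuous_line z v (cis t))).
exact: (cvg_comp _ _ c1 (cu (z + cis t *: v))).
Qed.

Lemma continuous_ln_height k :
  continuous (fun w : C2 R => ln (height (orb q b k w))).
Proof.
move=> w; have FF : Filter (nbhs w) by exact: _.
have h1 := @cvg_height R _ _ FF _ _ (@continuous_orb R q b k w).
exact: (cvg_ln (height_gt0 (orb q b k w)) h1).
Qed.

(** Along a complex line the coordinates of the orbit are polynomials [P] and [Q],
    and [ln height] is the largest of [0], [ln |P|] and [ln |Q|]; at the center it
    equals one of the three, to which [poly_sub_mean] applies. *)
Lemma height_sub_mean k (z v : C2 R) : 2 * pi * ln (height (orb q b k z)) <=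
  \int[lebesgue_measure]_(t in `[0, 2 * pi])
    ln (height (orb q b k (z + cis t *: v))).
Proof.
have [P [Q PQ]] := orb_line_poly k z v.
have PQ0 : orb q b k z = (P.[0], Q.[0]) by rewrite -PQ scale0r addr0.
pose phi x := ln (height (orb q b k (z + x *: v))).
have phiE x : phi x = ln (Num.max 1 (Num.max (cabs P.[x]) (cabs Q.[x]))).
  by rewrite /phi PQ.
have cphi : continuous phi.
  move=> x; apply: (@continuous_comp _ _ _ (fun t : Cplx R => z + t *: v)
    (fun w : C2 R => ln (height (orb q b k w)))); first exact: cvg_line.
  exact: continuous_ln_height.
have dom (f : {poly Cplx R}) : (forall x, cabs f.[x] <= height (orb q b k (z + x *: v))) ->
    forall x, f.[x] != 0 -> ln (cabs f.[x]) <= phi x.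
  move=> fh x fx; rewrite /phi ler_ln ?posrE ?height_gt0 ?cabs_gt0 //.
have domP x : cabs P.[x] <= height (orb q b k (z + x *: v)).
  by rewrite PQ; apply: le_trans (height_csup _); exact: (csup_ge1 (P.[x], Q.[x])).
have domQ x : cabs Q.[x] <= height (orb q b k (z + x *: v)).
  by rewrite PQ; apply: le_trans (height_csup _); exact: (csup_ge2 (P.[x], Q.[x])).
have sub (f : {poly Cplx R}) : (forall x, cabs f.[x] <= height (orb q b k (z + x *: v))) ->
    1 < cabs f.[0] -> 2 * pi * ln (cabs f.[0]) <=
      \int[lebesgue_measure]_(t in `[0, 2 * pi]) phi (cis t).
  move=> fh f1; apply: poly_sub_mean => //; last exact: dom.
  by rewrite -cabs_gt0; lra.
rewrite {1}/height /csup PQ0 /=.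
have [h|h] := leP (Num.max (cabs P.[0]) (cabs Q.[0])) 1.
  rewrite ln1 mulr0; apply: Rintegral_ge0 => t _.
  by rewrite ln_ge0 // height_ge1.
move: h; rewrite /Num.max; case: ifP => _ h; exact: sub.
Qed.

(** The inequality passes to the limit because [loggrowth] converges uniformly on
    the circle. *)
Lemma green_sub_mean (z v : C2 R) : 2 * pi * green q b e z <=
  \int[lebesgue_measure]_(t in `[0, 2 * pi]) green q b e (z + cis t *: v).
Proof.
have p0 : 0 < 2 * pi :> R by rewrite mulr_gt0 ?pi_gt0.
pose R0 := Num.max (escape_radius A E) (csup z + csup v).
have rR : escape_radius A E <= R0 by rewrite le_max lexx.
have zvR : csup z + csup v <= R0 by rewrite le_max lexx orbT.
have zR : csup z <= R0 by apply: le_trans zvR; rewrite lerDl csup_ge0.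
have circR t : csup (z + cis t *: v) <= R0.
  apply: le_trans zvR; apply: le_trans (csupD _ _) _.
  by rewrite csupZ cabs_cis mul1r.
set I := Rintegral _ _ _.
apply/ler_addgt0Pr => /= eps; move: (eps : R) => {}eps eps0.
have [n _ /(_ n (leqnn n)) nP] :=
  geometric_small (2 * (2 * pi) * ln (distortion A E R0)) eps0.
have D0 := degsR_gt0 H n; set D := (degs e n)%:R in D0.
set c := ln (distortion A E R0) / 2 ^+ n.
have err w : csup w <= R0 -> `|green q b e w - loggrowth q b e n w| <= c.
  by move=> wR; exact: green_err.
have cG := @continuous_circle (green q b e) z v (@continuous_green R A E q b e H).
have intG f : continuous f ->
    lebesgue_measure.-integrable `[0, 2 * pi : R] (EFin \o f).
  by move=> cf; apply: (integrable_itv_continuous (a := 0) (c := 2 * pi)).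
have cGc : continuous (fun t : R => green q b e (z + cis t *: v) + c).
  by move=> t; apply: cvgD; [exact: cG|exact: cvg_cst].
have cDG : continuous (fun t : R => D * (green q b e (z + cis t *: v) + c)).
  by move=> t; apply: cvgM; [exact: cvg_cst|exact: cGc].
have up : \int[lebesgue_measure]_(t in `[0, 2 * pi])
    ln (height (orb q b n (z + cis t *: v))) <=
   \int[lebesgue_measure]_(t in `[0, 2 * pi]) (D * (green q b e (z + cis t *: v) + c)).
  apply: le_Rintegral => //.
    apply: intG; apply: (@continuous_circle (fun w => ln (height (orb q b n w)))).
    exact: continuous_ln_height.
    exact: intG cDG.
  move=> t _; have := err _ (circR t); rewrite ler_norml => /andP[h1 _].
  rewrite mulrC -ler_pdivrMr // -/(loggrowth q b e n _).
  move: h1; move: (green _ _ _ _) (loggrowth _ _ _ _ _) => x y; lra.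
have := le_trans (height_sub_mean n z v) up.
rewrite RintegralZl //; last exact: intG cGc.
rewrite RintegralD //; [|exact: intG|by apply: intG => t; exact: cvg_cst].
rewrite Rintegral_cst //= lebesgue_measure_itv /= lte_fin p0 -EFinB subr0 /= -/I.
have -> : ln (height (orb q b n z)) = loggrowth q b e n z * D.
  by rewrite /loggrowth divfK // gt_eqF.
rewrite mulrA [leLHS]mulrC ler_pM2l // => h.
have := err z zR; rewrite ler_norml => /andP[_ h1].
have c2 : 2 * (2 * pi * c) < eps by rewrite !mulrA in nP *.
have h3 : 2 * pi * green q b e z <= 2 * pi * (loggrowth q b e n z + c).
  by rewrite ler_wpM2l ?(ltW p0) //; lra.
apply: (le_trans h3); rewrite mulrDr -lerBrDr; apply: (le_trans h).
by rewrite (mulrC c) lerBrDr -addrA lerD2l; apply: ltW; rewrite -mulr2n -[ltLHS]mulr_natl.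
Qed.

Lemma plurisubharmonic_green : plurisubharmonic (fun z => (green q b e z)%:E).
Proof.
split=> [|z|z v].
apply/lower_semicontinuousP => a.
  have -> : [set z | (a%:E < - (green q b e z)%:E)%E] =
      (green q b e) @^-1` [set x | x < - a].
    by apply/seteqP; split => z /=; rewrite lte_fin ltrNr.
  apply: open_comp; last exact: open_lt.
  by move=> z _; exact: (continuous_green H).
by rewrite ltry.
have cG := @continuous_circle (green q b e) z v (@continuous_green R A E q b e H).
have iG : lebesgue_measure.-integrable `[0, 2 * pi : R]
    (EFin \o (fun t => green q b e (z + cis t *: v))).
  by apply: (integrable_itv_continuous (a := 0) (c := 2 * pi)).
have := green_sub_mean z v; rewrite /Rintegral => h.
have fi := integrable_fin_num _ iG.
rewrite -[X in (_ * X)%E]fineK; last exact: fi.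
rewrite -EFinM lee_fin mulrC ler_pdivlMr ?mulr_gt0 ?pi_gt0 //.
by rewrite mulrC.
Qed.

End SubMeanValue.

(** * Derivatives of complex curves and of uniform limits *)

Section ComplexCurves.
Context {R : realType}.
Implicit Types (f g : R -> Cplx R) (t : R) (c : Cplx R).

(** A curve in [Cplx R] with a real time is differentiated through its two
    components, since the scalars of [Cplx R] are complex. *)
Definition cderiv f t c : Prop :=
  is_derive t 1 (fun s => complex.Re (f s)) (complex.Re c) /\
  is_derive t 1 (fun s => complex.Im (f s)) (complex.Im c).

Lemma ImD (x y : Cplx R) : complex.Im (x + y) = complex.Im x + complex.Im y.
Proof. by case: x => ? ?; case: y. Qed.

Lemma is_derive_eqr (h : R -> R) t (x y : R) :
  is_derive t 1 h x -> x = y -> is_derive t 1 h y.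
Proof. by move=> hx <-. Qed.

Lemma cderiv_cst c t : cderiv (fun=> c) t 0.
Proof. by split; apply: is_derive_cst. Qed.

Lemma cderiv_toC t : cderiv (@toC R) t 1.
Proof. by split; [exact: is_derive_id|exact: is_derive_cst]. Qed.

Lemma cderivD f g t c1 c2 : cderiv f t c1 -> cderiv g t c2 ->
  cderiv (fun s => f s + g s) t (c1 + c2).
Proof.
move=> [fr fi] [gr gi]; split.
  have -> : (fun s => complex.Re (f s + g s)) =
    (fun s => complex.Re (f s)) + (fun s => complex.Re (g s)).
    by apply/funext => s; rewrite ReD.
  by apply: is_derive_eqr (is_deriveD fr gr) _; rewrite ReD.
have -> : (fun s => complex.Im (f s + g s)) =
  (fun s => complex.Im (f s)) + (fun s => complex.Im (g s)).
  by apply/funext => s; rewrite ImD.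
by apply: is_derive_eqr (is_deriveD fi gi) _; rewrite ImD.
Qed.

Lemma ReM (x y : Cplx R) : complex.Re (x * y) =
  complex.Re x * complex.Re y - complex.Im x * complex.Im y.
Proof. by case: x => ? ?; case: y. Qed.

Lemma ImM (x y : Cplx R) : complex.Im (x * y) =
  complex.Re x * complex.Im y + complex.Im x * complex.Re y.
Proof. by case: x => ? ?; case: y. Qed.

Lemma cderivM f g t c1 c2 : cderiv f t c1 -> cderiv g t c2 ->
  cderiv (fun s => f s * g s) t (c1 * g t + f t * c2).
Proof.
move=> [fr fi] [gr gi]; split.
  have -> : (fun s => complex.Re (f s * g s)) =
    (fun s => complex.Re (f s)) * (fun s => complex.Re (g s)) -
    (fun s => complex.Im (f s)) * (fun s => complex.Im (g s)).
    by apply/funext => s; rewrite ReM.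
  apply: is_derive_eqr (is_deriveB (is_deriveM fr gr) (is_deriveM fi gi)) _.
  by rewrite ReD !ReM /GRing.scale /=; ring.
have -> : (fun s => complex.Im (f s * g s)) =
  (fun s => complex.Re (f s)) * (fun s => complex.Im (g s)) +
  (fun s => complex.Im (f s)) * (fun s => complex.Re (g s)).
  by apply/funext => s; rewrite ImM.
apply: is_derive_eqr (is_deriveD (is_deriveM fr gi) (is_deriveM fi gr)) _.
by rewrite ImD !ImM /GRing.scale /=; ring.
Qed.

Lemma cderivB f g t c1 c2 : cderiv f t c1 -> cderiv g t c2 ->
  cderiv (fun s => f s - g s) t (c1 - c2).
Proof.
move=> fc gc; have -> : (fun s => f s - g s) = (fun s => f s + (-1) * g s).
  by apply/funext => s; rewrite mulN1r.
have -> : c1 - c2 = c1 + (0 * g t + (-1) * c2) by rewrite mul0r add0r mulN1r.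
exact: cderivD fc (cderivM (cderiv_cst _ _) gc).
Qed.

Lemma cderiv_horner (p : {poly Cplx R}) f t c : cderiv f t c ->
  cderiv (fun s => p.[f s]) t (p^`().[f t] * c).
Proof.
move=> fc; elim/poly_ind: p => [|p a IH].
  have -> : (fun s => (0 : {poly Cplx R}).[f s]) = fun=> 0.
    by apply/funext => s; rewrite horner0.
  by rewrite deriv0 horner0 mul0r; exact: cderiv_cst.
have -> : (fun s => (p * 'X + a%:P).[f s]) = (fun s => p.[f s] * f s + a).
  by apply/funext => s; rewrite hornerMXaddC.
have -> : (p * 'X + a%:P)^`().[f t] * c =
    (p^`().[f t] * c * f t + p.[f t] * c) + 0.
  by rewrite derivD derivC addr0 derivM derivX mulr1 hornerD hornerM hornerX; ring.
exact: cderivD (cderivM IH fc) (cderiv_cst _ _).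
Qed.

Lemma cRe_div (x y : Cplx R) : complex.Re (x / y) =
  (complex.Re x * complex.Re y + complex.Im x * complex.Im y) /
  (complex.Re y ^+ 2 + complex.Im y ^+ 2).
Proof. by case: x => a b; case: y => c d; rewrite ReM /=; ring. Qed.

Lemma cIm_div (x y : Cplx R) : complex.Im (x / y) =
  (complex.Im x * complex.Re y - complex.Re x * complex.Im y) /
  (complex.Re y ^+ 2 + complex.Im y ^+ 2).
Proof. by case: x => a b; case: y => c d; rewrite ImM /=; ring. Qed.

Lemma sqr_cabs_gt0 (y : Cplx R) : y != 0 ->
  0 < complex.Re y ^+ 2 + complex.Im y ^+ 2.
Proof. by move=> y0; rewrite -cabs_sqr exprn_gt0 // cabs_gt0. Qed.

Lemma is_derive_sqr_cabs g t c : cderiv g t c ->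
  is_derive t 1 (fun s => complex.Re (g s) ^+ 2 + complex.Im (g s) ^+ 2)
    (2 * (complex.Re (g t) * complex.Re c + complex.Im (g t) * complex.Im c)).
Proof.
move=> [gr gi].
have -> : (fun s => complex.Re (g s) ^+ 2 + complex.Im (g s) ^+ 2) =
   (fun s => complex.Re (g s)) * (fun s => complex.Re (g s)) +
   (fun s => complex.Im (g s)) * (fun s => complex.Im (g s)).
  by apply/funext => s; rewrite !expr2.
apply: is_derive_eqr (is_deriveD (is_deriveM gr gr) (is_deriveM gi gi)) _.
by rewrite /GRing.scale /=; ring.
Qed.

Lemma is_derive_ln_cabs g t c : cderiv g t c -> g t != 0 ->
  is_derive t 1 (fun s => ln (cabs (g s))) (complex.Re (c / g t)).
Proof.
move=> gc g0; have n0 := sqr_cabs_gt0 g0.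
have -> : (fun s => ln (cabs (g s))) = (1 / 2) \*:
    (@ln R \o (fun s => complex.Re (g s) ^+ 2 + complex.Im (g s) ^+ 2)).
  apply/funext => s /=; rewrite -cabs_sqr.
  have := cabs_ge0 (g s); rewrite le_eqVlt => /orP[/eqP <-|gs].
    by rewrite expr0n ln0 // /GRing.scale /= mulr0.
  by rewrite lnXn // -mulr_natl /GRing.scale /=; field.
have d := @is_derive1_comp R (@ln R)
  (fun s => complex.Re (g s) ^+ 2 + complex.Im (g s) ^+ 2) t _ _
  (is_derive1_ln n0) (is_derive_sqr_cabs gc).
apply: is_derive_eqr (is_deriveZ (1 / 2) d) _.
by rewrite cRe_div /GRing.scale /=; field; rewrite gt_eqF.
Qed.

Lemma is_derive_Re_div f g t c1 c2 : cderiv f t c1 -> cderiv g t c2 ->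
  g t != 0 -> is_derive t 1 (fun s => complex.Re (f s / g s))
    (complex.Re (c1 / g t - f t / g t * (c2 / g t))).
Proof.
move=> fc gc g0; have n0 := sqr_cabs_gt0 g0.
pose den s := complex.Re (g s) ^+ 2 + complex.Im (g s) ^+ 2.
have dd := is_derive_sqr_cabs gc; rewrite -/den in dd.
have [fr fi] := fc; have [gr gi] := gc.
have den0 : den t != 0 by exact: lt0r_neq0.
have dV := is_deriveV den0 dd.
have -> : (fun s => complex.Re (f s / g s)) =
  ((fun s => complex.Re (f s)) * (fun s => complex.Re (g s)) +
   (fun s => complex.Im (f s)) * (fun s => complex.Im (g s))) *
  (fun s => (den s)^-1).
  by apply/funext => s; rewrite cRe_div.
apply: is_derive_eqr
  (is_deriveM (is_deriveD (is_deriveM fr gr) (is_deriveM fi gi)) dV) _.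
rewrite ReB (ReM (f t / g t)) !cRe_div !cIm_div /den; move: n0.
rewrite /GRing.scale /= !fctE => n0.
move: n0; move: (complex.Re (f t)) (complex.Im (f t)) (complex.Re (g t))
  (complex.Im (g t)) => a b u v n0.
by field; rewrite gt_eqF.
Qed.

End ComplexCurves.

Section UniformLimits.
Context {R : realType}.
Implicit Types (u g : C2 R -> R) (z v w : C2 R).

Lemma is_derive_linear_approx (F : R -> R) (d : R) :
  (forall e : R, 0 < e -> \forall h \near (0 : R), `|F h - F 0 - h * d| <= e * `|h|) ->
  is_derive (0 : R) 1 F d.
Proof.
move=> Fd.
have cF : (fun h => h^-1 *: ((F \o shift 0) (h *: 1) - F 0)) @ (0 : R)^' --> d.
  apply/cvgrPdist_le => e e0; rewrite near_withinE.
  apply: filterS (Fd _ e0) => h hF h0; rewrite /= addr0.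
  have -> : h *: 1 = h :> R by rewrite /GRing.scale /= mulr1.
  have -> : d - h^-1 *: (F h - F 0) = - (h^-1 * (F h - F 0 - h * d)).
    by rewrite /GRing.scale /=; field.
  rewrite normrN normrM normfV ler_pdivrMl ?normr_gt0 //.
  by rewrite [leRHS]mulrC.
by apply: DeriveDef; [apply/cvg_ex; exists d|exact: cvg_lim cF].
Qed.

Lemma linear_approx_derive (F F' : R -> R) (d e dl : R) :
  (forall t : R, `|t| < dl -> is_derive t 1 F (F' t)) ->
  (forall t : R, `|t| < dl -> `|F' t - d| <= e) ->
  forall h, `|h| < dl -> `|F h - F 0 - h * d| <= e * `|h|.
Proof.
move=> FF' F'd h hdl.
have cont a b : (forall t, t \in `[a, b] -> `|t| < dl) ->
    {within `[a, b], continuous F}.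
  move=> ab; apply: derivable_within_continuous => t tab.
  by have [] := FF' t (ab t tab).
have [h0|h0|->] := ltgtP h 0; last by rewrite mul0r subrr subr0 normr0 mulr0.
have in_dl t : t \in `[h, 0] -> `|t| < dl.
    rewrite in_itv /= => /andP[t1 t2]; apply: le_lt_trans hdl.
    by rewrite ler0_norm // ltr0_norm // lerN2.
  have df t : t \in `]h, 0[ -> is_derive t 1 F (F' t).
    by move=> tI; apply: FF'; apply: in_dl; exact: subset_itv_oo_cc.
  have [c cI FE] := MVT h0 df (cont _ _ in_dl).
  have := F'd c (in_dl c (subset_itv_oo_cc cI)).
  have -> : F h - F 0 - h * d = h * (F' c - d) by move: FE; lra.
  by rewrite normrM mulrC => le1; rewrite ler_wpM2r.
have in_dl t : t \in `[0, h] -> `|t| < dl.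
  rewrite in_itv /= => /andP[t1 t2]; apply: le_lt_trans hdl.
  by rewrite ger0_norm // gtr0_norm.
have df t : t \in `]0, h[ -> is_derive t 1 F (F' t).
  by move=> tI; apply: FF'; apply: in_dl; exact: subset_itv_oo_cc.
have [c cI FE] := MVT h0 df (cont _ _ in_dl).
have := F'd c (in_dl c (subset_itv_oo_cc cI)).
have -> : F h - F 0 - h * d = h * (F' c - d) by move: FE; lra.
by rewrite normrM mulrC => le1; rewrite ler_wpM2r.
Qed.

Lemma is_derive_line_shift u v z (t d : R) :
  is_derive (0 : R) 1 (fun s : R => u (z + toC t *: v + toC s *: v)) d ->
  is_derive t 1 (fun s : R => u (z + toC s *: v)) d.
Proof.
move=> ud.
have -> : (fun s : R => u (z + toC s *: v)) =
    (fun s : R => u (z + toC t *: v + toC s *: v)) \o (fun s => s - t).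
  apply/funext => s /=; congr u.
  by rewrite -addrA -scalerDl -toCD addrCA subrr addr0.
have dt : is_derive t 1 (fun s : R => s - t) 1.
  apply: is_derive_eqr (is_deriveB (is_derive_id t (1 : R)) (is_derive_cst t t 1)) _.
  by rewrite subr0.
rewrite -[d]mulr1; apply: is_derive1_comp dt.
by rewrite subrr.
Qed.

Lemma cvg_real_line z v (t : R) :
  (fun s : R => z + toC s *: v) @ t --> z + toC t *: v.
Proof.
have FF : Filter (nbhs (t : R)) by exact: _.
apply: (@continuous_comp _ _ _ (@toC R) (fun x : Cplx R => z + x *: v) t).
  by apply: cvg_toC; exact: cvg_id.
exact: cvg_line.
Qed.

Lemma continuous_uniform_limit (g_ : nat -> C2 R -> R) g z :
  (forall e : R, 0 < e -> exists N, \forall w \near z,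
     forall n, (N <= n)%N -> `|g_ n w - g w| <= e) ->
  (exists N, forall n, (N <= n)%N -> {for z, continuous (g_ n)}) ->
  {for z, continuous g}.
Proof.
move=> unif [N0 cont]; apply/cvgrPdist_le => e e0.
have e3 : 0 < e / 3 by rewrite divr_gt0.
have [N NP] := unif _ e3.
have hz := nbhs_singleton NP (maxn N N0) (leq_maxl _ _).
have /cvgrPdist_le/(_ _ e3) := cont (maxn N N0) (leq_maxr _ _).
apply: filterS2 NP => w /(_ (maxn N N0) (leq_maxl _ _)) h1 h2.
move: h1 h2 hz; rewrite !ler_norml => /andP[? ?] /andP[? ?] /andP[? ?].
by apply/andP; split; lra.
Qed.

(** By the mean value theorem, closeness of the derivatives [g_ n] to the value
    [g z] bounds the error of the linear approximation of [u_ n] uniformly in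
    [n]; the bound passes to the pointwise limit [u]. *)
Lemma is_derive_uniform_limit (u_ : nat -> C2 R -> R) u (g_ : nat -> C2 R -> R)
    g v z :
  (exists N, \forall w \near z, forall n, (N <= n)%N ->
     is_derive (0 : R) 1 (fun t : R => u_ n (w + toC t *: v)) (g_ n w)) ->
  (\forall w \near z, (fun n => u_ n w) @ \oo --> u w) ->
  (forall e : R, 0 < e -> exists N, \forall w \near z,
     forall n, (N <= n)%N -> `|g_ n w - g w| <= e) ->
  {for z, continuous g} ->
  is_derive (0 : R) 1 (fun t : R => u (z + toC t *: v)) (g z).
Proof.
move=> [N1 d1] cu unif cg; apply: is_derive_linear_approx => e e0.
have e2 : 0 < e / 2 by rewrite divr_gt0.
have [N2 d2] := unif _ e2.
have /cvgrPdist_le/(_ _ e2) d3 := cg.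
have all_near : \forall w \near z, [/\ (forall n, (N1 <= n)%N ->
     is_derive (0 : R) 1 (fun t : R => u_ n (w + toC t *: v)) (g_ n w)),
   (fun n => u_ n w) @ \oo --> u w,
   (forall n, (N2 <= n)%N -> `|g_ n w - g w| <= e / 2) &
   `|g z - g w| <= e / 2].
  by near=> w; split; near: w.
have line0 : \forall t \near (0 : R), [/\ (forall n, (N1 <= n)%N ->
     is_derive (0 : R) 1 (fun s : R => u_ n (z + toC t *: v + toC s *: v))
       (g_ n (z + toC t *: v))),
   (fun n => u_ n (z + toC t *: v)) @ \oo --> u (z + toC t *: v),
   (forall n, (N2 <= n)%N ->
     `|g_ n (z + toC t *: v) - g (z + toC t *: v)| <= e / 2) &
   `|g z - g (z + toC t *: v)| <= e / 2].
  have z0 : z + toC 0 *: v = z by rewrite toC0 scale0r addr0.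
  by have c0 := @cvg_real_line z v 0; rewrite z0 in c0; exact: c0 all_near.
move/nbhs_ballP: line0 => [dl /= dl0 dlP].
apply/nbhs_ballP; exists dl => //= h; rewrite /ball /= sub0r normrN => hdl.
have near0 (t : R) : `|t| < dl -> ball (0 : R) dl t by rewrite /ball /= sub0r normrN.
have bound n : (maxn N1 N2 <= n)%N ->
    `|u_ n (z + toC h *: v) - u_ n (z + toC 0 *: v) - h * g z| <= e * `|h|.
  rewrite geq_max => /andP[n1 n2].
  apply: (@linear_approx_derive (fun t => u_ n (z + toC t *: v))
    (fun t => g_ n (z + toC t *: v)) (g z) e dl) => // t tdl.
    by have [h1 _ _ _] := dlP _ (near0 t tdl); apply: is_derive_line_shift; exact: h1.
  have [_ _ h1 h2] := dlP _ (near0 t tdl); move: (h1 n n2) h2.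
  rewrite !ler_norml => /andP[? ?] /andP[? ?].
  by apply/andP; split; lra.
have [_ ch _ _] := dlP _ (near0 h hdl).
have dl00 : `|0 : R| < dl by rewrite normr0.
have [_ c0 _ _] := dlP _ (near0 0 dl00).
have lim : (fun n => `|u_ n (z + toC h *: v) - u_ n (z + toC 0 *: v) - h * g z|)
    @ \oo --> `|u (z + toC h *: v) - u (z + toC 0 *: v) - h * g z|.
  apply: cvg_norm; apply: cvgB; last exact: cvg_cst.
  exact: (cvgB ch c0).
rewrite -(cvg_lim _ lim) //; apply: limr_le; first by apply/cvg_ex; eexists; exact: lim.
by exists (maxn N1 N2).
Unshelve. all: by end_near. Qed.

End UniformLimits.

(** * Logarithmic derivatives along orbits *)

Section OrbitDerivatives.
Context {R : realType}.
Implicit Types (z v w : C2 R) (q : nat -> {poly Cplx R}) (b : nat -> Cplx R).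

(** The differential of [orb k] at [z] applied to [v]. *)
Fixpoint dorb q b k z v : C2 R :=
  if k is k'.+1 then
    let d := dorb q b k' z v in
    (d.2, (q k')^`().[(orb q b k' z).2] * d.2 - b k' * d.1)
  else v.

(** The second differential of [orb k] at [z] applied to [v] and [w]. *)
Fixpoint ddorb q b k z v w : C2 R :=
  if k is k'.+1 then
    let y := (orb q b k' z).2 in
    let dd := ddorb q b k' z v w in
    (dd.2, (q k')^`()^`().[y] * (dorb q b k' z w).2 * (dorb q b k' z v).2 +
           (q k')^`().[y] * dd.2 - b k' * dd.1)
  else 0.

(** The derivative of the logarithm of the second coordinate in the direction [v];
    its real part is the derivative of [ln (cabs _)]. *)
Definition logder q b k z v : Cplx R := (dorb q b k z v).2 / (orb q b k z).2.

(** The derivative of [logder] in the direction [w], by the quotient rule. *)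
Definition logder2 q b k z v w : Cplx R :=
  (ddorb q b k z v w).2 / (orb q b k z).2
    - logder q b k z v * logder q b k z w.

Lemma cderiv_line (a c : Cplx R) t : cderiv (fun s => a + toC s * c) t c.
Proof.
have := cderivD (cderiv_cst a t) (cderivM (cderiv_toC t) (cderiv_cst c t)).
by rewrite add0r mul1r mulr0 addr0.
Qed.

Lemma cderiv_orb q b k z v t :
  cderiv (fun s => (orb q b k (z + toC s *: v)).1) t
    (dorb q b k (z + toC t *: v) v).1 /\
  cderiv (fun s => (orb q b k (z + toC s *: v)).2) t
    (dorb q b k (z + toC t *: v) v).2.
Proof.
elim: k => [|k [IH1 IH2]]; first by split; exact: cderiv_line.
split; first exact: IH2.
have := cderivB (cderiv_horner (q k) IH2) (cderivM (cderiv_cst (b k) t) IH1).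
by rewrite mul0r add0r.
Qed.

Lemma cderiv_dorb q b k z v w t :
  cderiv (fun s => (dorb q b k (z + toC s *: w) v).1) t
    (ddorb q b k (z + toC t *: w) v w).1 /\
  cderiv (fun s => (dorb q b k (z + toC s *: w) v).2) t
    (ddorb q b k (z + toC t *: w) v w).2.
Proof.
elim: k => [|k [IH1 IH2]]; first by split; exact: cderiv_cst.
split; first exact: IH2.
have [_ oc] := cderiv_orb q b k z w t.
have := cderivB (cderivM (cderiv_horner (q k)^`() oc) IH2)
  (cderivM (cderiv_cst (b k) t) IH1).
by rewrite mul0r add0r.
Qed.

Lemma is_derive_ln_orb q b k z v : (orb q b k z).2 != 0 ->
  is_derive (0 : R) 1 (fun t : R => ln (cabs (orb q b k (z + toC t *: v)).2))
    (complex.Re (logder q b k z v)).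
Proof.
move=> y0; have z0 : z + toC 0 *: v = z by rewrite toC0 scale0r addr0.
have [_ oc] := cderiv_orb q b k z v 0.
have := is_derive_ln_cabs oc; rewrite z0; exact.
Qed.

Lemma is_derive_logder q b k z v w : (orb q b k z).2 != 0 ->
  is_derive (0 : R) 1 (fun t : R => complex.Re (logder q b k (z + toC t *: w) v))
    (complex.Re (logder2 q b k z v w)).
Proof.
move=> y0; have z0 : z + toC 0 *: w = z by rewrite toC0 scale0r addr0.
have [_ oc] := cderiv_orb q b k z w 0; have [_ dc] := cderiv_dorb q b k z v w 0.
have := is_derive_Re_div dc oc; rewrite z0; exact.
Qed.

Lemma cvg_dorb q b k z v : (fun x : C2 R => dorb q b k x v) @ z --> dorb q b k z v.
Proof.
have FF : Filter (nbhs z) by exact: _.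
elim: k => [|k IH]; first exact: cvg_cst.
move/cvg_C2P: IH => [IH1 IH2]; apply/cvg_C2P; split; first exact: IH2.
have /cvg_C2P[_ co] := @continuous_orb R q b k z.
apply: (cvgB (cvgM (@cvg_horner _ _ _ FF (fun=> (q k)^`()) _ _ _ _ _ co) IH2)
  (cvgM (cvg_cst (b k)) IH1)).
  by near=> t.
by move=> i; exact: cvg_cst.
Unshelve. all: by end_near. Qed.

Lemma cvg_ddorb q b k z v w :
  (fun x : C2 R => ddorb q b k x v w) @ z --> ddorb q b k z v w.
Proof.
have FF : Filter (nbhs z) by exact: _.
elim: k => [|k IH]; first exact: cvg_cst.
move/cvg_C2P: IH => [IH1 IH2]; apply/cvg_C2P; split; first exact: IH2.
have /cvg_C2P[_ co] := @continuous_orb R q b k z.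
have /cvg_C2P[_ cv] := @cvg_dorb q b k z v.
have /cvg_C2P[_ cw] := @cvg_dorb q b k z w.
have hp (p : {poly Cplx R}) :
    (fun x => p.[(orb q b k x).2]) @ z --> p.[(orb q b k z).2].
  apply: (@cvg_horner _ _ _ FF (fun=> p) _ _ _ _ _ co); first by near=> t.
  by move=> i; exact: cvg_cst.
exact: (cvgB (cvgD (cvgM (cvgM (hp _) cw) cv) (cvgM (hp _) IH2))
  (cvgM (cvg_cst (b k)) IH1)).
Unshelve. all: by end_near. Qed.

Lemma cvg_logder q b k z v : (orb q b k z).2 != 0 ->
  (fun x : C2 R => logder q b k x v) @ z --> logder q b k z v.
Proof.
move=> y0; have FF : Filter (nbhs z) by exact: _.
have /cvg_C2P[_ co] := @continuous_orb R q b k z.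
have /cvg_C2P[_ cv] := @cvg_dorb q b k z v.
exact: (cvgM cv (cvgV y0 co)).
Qed.

Lemma cvg_logder2 q b k z v w : (orb q b k z).2 != 0 ->
  (fun x : C2 R => logder2 q b k x v w) @ z --> logder2 q b k z v w.
Proof.
move=> y0; have FF : Filter (nbhs z) by exact: _.
have /cvg_C2P[_ co] := @continuous_orb R q b k z.
have /cvg_C2P[_ cd] := @cvg_ddorb q b k z v w.
exact: (cvgB (cvgM cd (cvgV y0 co))
  (cvgM (@cvg_logder q b k z v y0) (@cvg_logder q b k z w y0))).
Qed.

Lemma dorbZ q b k z (c : Cplx R) v : dorb q b k z (c *: v) = c *: dorb q b k z v.
Proof.
elim: k => //= k ->; congr pair => /=.
by rewrite /GRing.scale /=; ring.
Qed.

Lemma ddorbZ q b k z (c : Cplx R) v w :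
  ddorb q b k z (c *: v) (c *: w) = (c * c) *: ddorb q b k z v w.
Proof.
elim: k => [|k IH] /=; first by rewrite scaler0.
rewrite IH !dorbZ; congr pair => /=.
by rewrite /GRing.scale /=; ring.
Qed.

(** Orbits are holomorphic, so second derivatives are complex bilinear. With
    [c = iunit] this is the vanishing of the Laplacian. *)
Lemma logder2Z q b k z (c : Cplx R) v w :
  logder2 q b k z (c *: v) (c *: w) = c * c * logder2 q b k z v w.
Proof.
rewrite /logder2 /logder ddorbZ !dorbZ.
move: (ddorb q b k z v w) (dorb q b k z v) (dorb q b k z w) (orb q b k z).
move=> [_ x] [_ y] [_ t] [_ u] /=.
by rewrite [in LHS]/GRing.scale /=; ring.
Qed.

End OrbitDerivatives.

Definition step_growth {R : realType} (A : R) (e : nat) (y yp : Cplx R) : Prop :=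
  cabs y ^+ e <= 2 * A * cabs yp.

Definition logder_cst {R : realType} (A : R) (E : nat) : R :=
  2 * A * (A * (E%:R ^+ 2 + E%:R + 1)).

Definition logder2_cst {R : realType} (A : R) (E : nat) : R :=
  2 * A * (A * (E%:R ^+ 3 + E%:R ^+ 2 + E%:R + 1)) +
  4 * E%:R * logder_cst A E + 4 * logder_cst A E ^+ 2.

Section LogderSteps.
Context {R : realType}.
Variables (A : R) (E e : nat) (q : {poly Cplx R}) (y ym yp c : Cplx R).
Hypothesis e2 : (2 <= e <= E)%N.
Hypothesis sq : size q = e.+1.
Hypothesis qA : forall i, cabs q`_i <= A.
Hypothesis cA : cabs c <= A.
Hypothesis A1 : 1 <= A.
Hypothesis y1 : 1 <= cabs y.
Hypothesis ymy : cabs ym <= cabs y.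
Hypothesis ypE : yp = q.[y] - c * ym.
Hypothesis yp_ge : step_growth A e y yp.

Let T : R := cabs y ^+ e.-1.

Lemma step_power : cabs y <= T /\ cabs y ^+ e = T * cabs y.
Proof.
split; first by rewrite -[leLHS]expr1 /T ler_weXn2l //; move: e2; lia.
by rewrite /T -exprSr; congr (_ ^+ _); move: e2; lia.
Qed.

Lemma step_T_ge1 : 1 <= T.
Proof. exact: exprn_ege1. Qed.

Lemma step_yp_neq0 : yp != 0.
Proof.
have A1' := A1; have y1' := y1.
rewrite -cabs_gt0; have : 0 < 2 * A * cabs yp.
  by apply: lt_le_trans yp_ge; rewrite exprn_gt0 // (lt_le_trans _ y1).
by rewrite pmulr_rgt0 //; lra.
Qed.

Lemma step_div (n : Cplx R) (K : R) : cabs n <= K * T ->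
  cabs (n / yp) <= 2 * A * K / cabs y.
Proof.
have A1' := A1; have y1' := y1.
move=> nK; rewrite cabsf; have y0 : 0 < cabs y by lra.
have yp0 : 0 < cabs yp by rewrite cabs_gt0 step_yp_neq0.
have T0 : 0 < T by apply: lt_le_trans step_T_ge1.
have K0 : 0 <= K by rewrite -(pmulr_lge0 _ T0) (le_trans (cabs_ge0 n)).
rewrite ler_pdivrMr // mulrAC ler_pdivlMr //.
have [_ yE] := step_power; have := yp_ge; rewrite /step_growth yE => h.
apply: (@le_trans _ _ (K * (T * cabs y))).
  by rewrite mulrA ler_wpM2r // ltW.
have -> : 2 * A * K * cabs yp = K * (2 * A * cabs yp) by ring.
by rewrite ler_wpM2l.
Qed.

Lemma cabs_natM n (x : Cplx R) : cabs (n%:R * x) = n%:R * cabs x.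
Proof. by rewrite cabsM cabs_nat. Qed.

Lemma step_cym (x : Cplx R) : cabs (c * ym * x) <= A * T * cabs x.
Proof.
rewrite !cabsM ler_wpM2r ?cabs_ge0 // ler_pM ?cabs_ge0 //.
by have [h _] := step_power; exact: le_trans h.
Qed.

Lemma nat_eE : 2 <= (e%:R : R) /\ (e%:R : R) <= E%:R.
Proof. by rewrite !ler_nat; move: e2 => /andP[]. Qed.

(** The two top-order terms [e u] cancel by Euler's relation, and what is left
    is one power of [y] smaller than [yp]. *)
Lemma logder_step (u um : Cplx R) :
  cabs ((q^`().[y] * (y * u) - c * (ym * um)) / yp - e%:R * u) <=
  logder_cst A E / cabs y * (cabs u + cabs um).
Proof.
rewrite /logder_cst.
have A1' := A1; have y1' := y1.
have -> : (q^`().[y] * (y * u) - c * (ym * um)) / yp - e%:R * u =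
  ((y * q^`().[y] - e%:R * q.[y]) * u + e%:R * (c * ym * u) - c * ym * um) / yp.
  have h := step_yp_neq0; rewrite -[e%:R * u](mulfK h) -mulrBl; congr (_ / _).
  by rewrite ypE; ring.
apply: le_trans (step_div (K := A * (E%:R ^+ 2 + E%:R + 1) * (cabs u + cabs um)) _) _; last first.
  by rewrite le_eqVlt; apply/orP; left; apply/eqP; ring.
have h1 : cabs ((y * q^`().[y] - e%:R * q.[y]) * u) <= e%:R ^+ 2 * A * T * cabs u.
  rewrite cabsM ler_wpM2r ?cabs_ge0 //.
  apply: le_trans (euler_bound sq qA y1 (lexx _)) _.
  by rewrite expr2 -!mulrA.
have h2 : cabs (e%:R * (c * ym * u)) <= e%:R * (A * T * cabs u).
  by rewrite cabs_natM ler_wpM2l // step_cym.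
have h3 := step_cym um.
apply: le_trans (cabsB _ _) _; apply: le_trans (lerD (cabsD _ _) (lexx _)) _.
apply: le_trans (lerD (lerD h1 h2) h3) _.
have AT0 : 0 <= A * T by rewrite mulr_ge0 ?exprn_ge0 ?cabs_ge0 //; lra.
have [n2 nE] := nat_eE.
have u0 := cabs_ge0 u; have um0 := cabs_ge0 um.
have -> : e%:R ^+ 2 * A * T * cabs u + e%:R * (A * T * cabs u) + A * T * cabs um =
  A * T * ((e%:R ^+ 2 + e%:R) * cabs u + cabs um) by ring.
have -> : A * (E%:R ^+ 2 + E%:R + 1) * (cabs u + cabs um) * T =
  A * T * ((E%:R ^+ 2 + E%:R + 1) * (cabs u + cabs um)) by ring.
rewrite ler_wpM2l //; move: (e%:R : R) (E%:R : R) n2 nE => n N n2 nN.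
move: (cabs u) (cabs um) u0 um0 => a b a0 b0; rewrite !expr2.
have nn : n * n <= N * N by nra.
have : (n * n + n) * a <= (N * N + N) * a by rewrite ler_wpM2r //; lra.
have : 0 <= (N * N + N) * b by rewrite mulr_ge0 //; nra.
nra.
Qed.

Local Notation L1 := (logder_cst A E).
Local Notation L2 := (logder2_cst A E).

(** The quadratic terms [e ^ 2 * u * u'] cancel by [euler2_bound]; what remains is
    linear in the second-order quantities, plus quadratic terms in the first-order
    ones, bounded by [m], all divided by one power of [y]. *)
Lemma logder2_step (u um u' um' W Wm : Cplx R) (m : R) :
  cabs u <= m -> cabs um <= m -> cabs u' <= m -> cabs um' <= m ->
  cabs ((q^`()^`().[y] * (y * u') * (y * u) + q^`().[y] * (y * (W + u * u'))
           - c * (ym * (Wm + um * um'))) / yp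
     - (q^`().[y] * (y * u) - c * (ym * um)) / yp *
       ((q^`().[y] * (y * u') - c * (ym * um')) / yp) - e%:R * W)
  <= L2 / cabs y * (cabs W + cabs Wm + m ^+ 2).
Proof.
move=> um_ umm u'm um'm; have A1' := A1; have y1' := y1.
have m0 : 0 <= m by exact: le_trans (cabs_ge0 _) um_.
have s1 := logder_step u um; have s2 := logder_step u' um'.
set up := (q^`().[y] * (y * u) - c * (ym * um)) / yp in s1 *.
set up' := (q^`().[y] * (y * u') - c * (ym * um')) / yp in s2 *.
have [n2 nE] := nat_eE.
have L10 : 0 <= L1.
  rewrite /logder_cst !mulr_ge0 ?addr_ge0 ?exprn_ge0 //; lra.
have eta_bd (x : R) (a d : Cplx R) : cabs a <= m -> cabs d <= m ->
    x <= L1 / cabs y * (cabs a + cabs d) -> x <= 2 * L1 * m / cabs y.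
  move=> am dm; move/le_trans; apply.
  rewrite mulrAC ler_wpM2r ?invr_ge0 ?cabs_ge0 // -mulrA mulrCA ler_wpM2l //; lra.
have {}s1 := eta_bd _ _ _ um_ umm s1; have {}s2 := eta_bd _ _ _ u'm um'm s2.
pose N := (y * q^`().[y] - e%:R * q.[y]) * W + e%:R * (c * ym * W) - c * ym * Wm
  + (y ^+ 2 * q^`()^`().[y] + y * q^`().[y] - e%:R ^+ 2 * q.[y]) * (u * u')
  + e%:R ^+ 2 * (c * ym * (u * u')) - c * ym * (um * um').
have yp0 := step_yp_neq0.
have key : (q^`()^`().[y] * (y * u') * (y * u) + q^`().[y] * (y * (W + u * u'))
    - c * (ym * (Wm + um * um'))) / yp - up * up' - e%:R * W =
  N / yp - (e%:R * (u * (up' - e%:R * u')) + e%:R * (u' * (up - e%:R * u))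
     + (up - e%:R * u) * (up' - e%:R * u')).
  clear s1 s2; move: up up' => up up'.
  have -> : N = q^`()^`().[y] * (y * u') * (y * u) + q^`().[y] * (y * (W + u * u'))
    - c * (ym * (Wm + um * um')) - e%:R * W * yp - e%:R ^+ 2 * (u * u') * yp.
    by rewrite /N ypE; ring.
  rewrite [X in X / yp - (_ + _ + _)]addrAC; rewrite !mulrBl !mulfK //.
  by ring.
rewrite key.
have AT0 : 0 <= A * T by rewrite mulr_ge0 ?exprn_ge0 ?cabs_ge0 //; lra.
have uu : cabs (u * u') <= m ^+ 2 by rewrite cabsM expr2 ler_pM ?cabs_ge0.
have umum : cabs (um * um') <= m ^+ 2 by rewrite cabsM expr2 ler_pM ?cabs_ge0.
have W0 := cabs_ge0 W; have Wm0 := cabs_ge0 Wm.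
have mm0 : 0 <= m ^+ 2 by rewrite exprn_ge0.
set K := E%:R ^+ 3 + E%:R ^+ 2 + E%:R + 1 : R.
have NB : cabs N <= A * K * (cabs W + cabs Wm + m ^+ 2) * T.
  have h1 : cabs ((y * q^`().[y] - e%:R * q.[y]) * W) <= A * T * (e%:R ^+ 2 * cabs W).
    rewrite cabsM; have h := euler_bound sq qA y1 (lexx _).
    apply: le_trans (ler_wpM2r W0 h) _.
    by rewrite le_eqVlt /T; apply/orP; left; apply/eqP; ring.
  have h2 : cabs (e%:R * (c * ym * W)) <= A * T * (e%:R * cabs W).
    by rewrite cabs_natM mulrCA ler_wpM2l // step_cym.
  have h3 : cabs (c * ym * Wm) <= A * T * cabs Wm by exact: step_cym.
  have h4 : cabs ((y ^+ 2 * q^`()^`().[y] + y * q^`().[y] - e%:R ^+ 2 * q.[y]) * (u * u'))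
      <= A * T * (e%:R ^+ 3 * m ^+ 2).
    rewrite cabsM; have h := euler2_bound sq qA y1 (lexx _).
    apply: le_trans (ler_pM (cabs_ge0 _) (cabs_ge0 _) h uu) _.
    by rewrite le_eqVlt /T; apply/orP; left; apply/eqP; ring.
  have h5 : cabs (e%:R ^+ 2 * (c * ym * (u * u'))) <= A * T * (e%:R ^+ 2 * m ^+ 2).
    rewrite cabsM cabsX cabs_nat [leRHS]mulrCA ler_wpM2l ?exprn_ge0 //.
    by apply: le_trans (step_cym _) _; rewrite ler_wpM2l.
  have h6 : cabs (c * ym * (um * um')) <= A * T * m ^+ 2.
    by apply: le_trans (step_cym _) _; rewrite ler_wpM2l.
  rewrite /N.
  apply: le_trans (cabsB _ _) _; apply: le_trans (lerD (cabsD _ _) h6) _.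
  apply: le_trans (lerD (lerD (cabsD _ _) h5) (lexx _)) _.
  apply: le_trans (lerD (lerD (lerD (cabsB _ _) h4) (lexx _)) (lexx _)) _.
  apply: le_trans (lerD (lerD (lerD (lerD (cabsD _ _) h3) (lexx _)) (lexx _)) (lexx _)) _.
  apply: le_trans (lerD (lerD (lerD (lerD (lerD h1 h2) (lexx _)) (lexx _)) (lexx _)) (lexx _)) _.
  have -> : A * K * (cabs W + cabs Wm + m ^+ 2) * T =
    A * T * (K * (cabs W + cabs Wm + m ^+ 2)) by ring.
  rewrite -!mulrDr ler_wpM2l // /K; move: (m ^+ 2) mm0 => M M0.
  move: (e%:R : R) (E%:R : R) n2 nE (cabs W) (cabs Wm) W0 Wm0.
  move=> n NN n2 nN w wm w0 wm0.
  have n0 : 0 <= n by exact: le_trans n2.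
  have N0 : 0 <= NN by exact: le_trans nN.
  have nn : n ^+ 2 <= NN ^+ 2 by rewrite lerXn2r.
  have nnn : n ^+ 3 <= NN ^+ 3 by rewrite lerXn2r.
  have p2 : 0 <= n ^+ 2 by exact: exprn_ge0.
  have p3 : 0 <= n ^+ 3 by exact: exprn_ge0.
  move: (n ^+ 2) (n ^+ 3) (NN ^+ 2) (NN ^+ 3) nn nnn p2 p3 => a2 a3 b2 b3 nn nnn p2 p3.
  have g1 : (a2 + n) * w <= (b3 + b2 + NN + 1) * w by rewrite ler_wpM2r //; lra.
  have g2 : wm <= (b3 + b2 + NN + 1) * wm by rewrite ler_peMl //; lra.
  have g3 : (a3 + a2 + 1) * M <= (b3 + b2 + NN + 1) * M by rewrite ler_wpM2r //; lra.
  lra.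
have NB' := step_div NB.
apply: le_trans (cabsB _ _) _; apply: le_trans (lerD NB' (lexx _)) _.
have y0 : 0 < cabs y by lra.
have r1 (a d : Cplx R) : cabs a <= m -> cabs d <= 2 * L1 * m / cabs y ->
    cabs (e%:R * (a * d)) <= 2 * E%:R * L1 * m ^+ 2 / cabs y.
  move=> am dm; rewrite cabs_natM cabsM.
  have -> : 2 * E%:R * L1 * m ^+ 2 / cabs y = E%:R * (m * (2 * L1 * m / cabs y)) by ring.
  by rewrite !ler_pM ?mulr_ge0 ?cabs_ge0.
have r2 : cabs ((up - e%:R * u) * (up' - e%:R * u')) <= 4 * L1 ^+ 2 * m ^+ 2 / cabs y.
  rewrite cabsM; apply: le_trans (ler_pM (cabs_ge0 _) (cabs_ge0 _) s1 s2) _.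
  have -> : 2 * L1 * m / cabs y * (2 * L1 * m / cabs y) =
    4 * L1 ^+ 2 * m ^+ 2 / cabs y * (cabs y)^-1 by ring.
  rewrite ler_piMr //; last by rewrite invf_le1.
  by rewrite mulr_ge0 ?invr_ge0 ?(ltW y0) // mulr_ge0 // mulr_ge0 // exprn_ge0.
apply: le_trans (lerD (lexx _) (cabsD _ _)) _.
apply: le_trans (lerD (lexx _) (lerD (cabsD _ _) r2)) _.
apply: le_trans (lerD (lexx _) (lerD (lerD (r1 _ _ um_ s2) (r1 _ _ u'm s1)) (lexx _))) _.
have -> : 2 * A * (A * K * (cabs W + cabs Wm + m ^+ 2)) / cabs y +
   (2 * E%:R * L1 * m ^+ 2 / cabs y + 2 * E%:R * L1 * m ^+ 2 / cabs y
      + 4 * L1 ^+ 2 * m ^+ 2 / cabs y) =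
  (2 * A * (A * K) * (cabs W + cabs Wm + m ^+ 2) +
    (4 * E%:R * L1 + 4 * L1 ^+ 2) * m ^+ 2) / cabs y by ring.
rewrite [leRHS]mulrAC ler_wpM2r ?invr_ge0 ?(ltW y0) // /logder2_cst -/K -[X in _ <= X * _]addrA.
rewrite [leRHS]mulrDl lerD2l ler_wpM2l //; last by rewrite lerDr addr_ge0.
apply: addr_ge0; apply: mulr_ge0 => //; exact: mulr_ge0.
Qed.

End LogderSteps.

Section SlowRecursions.
Context {R : realType}.
Implicit Types (X : nat -> Cplx R).

(** A discrete Gronwall inequality: the factors [1 + 3 * beta / 2 ^ i] have a
    product bounded by [expR (6 * beta)]. *)
Lemma slow_recursion_bound X (beta T : R) : 0 <= beta -> 1 <= T ->
  cabs (X 0%N) <= T -> cabs (X 1%N) <= T ->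
  (forall i, cabs (X i.+2 - X i.+1) <=
     beta / 2 ^+ i * (cabs (X i.+1) + cabs (X i) + 1)) ->
  forall i, cabs (X i) <= T * expR (6 * beta).
Proof.
move=> b0 T1 X0 X1 Xrec.
pose M i := T * expR (6 * beta * (1 - (2 ^+ i)^-1)).
have p i : 0 < 2 ^+ i :> R by rewrite exprn_gt0.
have pow_le1 i : (2 ^+ i)^-1 <= 1 :> R by rewrite invf_le1 // exprn_ege1 // ler1n.
have M1 i : 1 <= M i.
  apply: mulr_ege1 => //; by rewrite -[leLHS]expR0 ler_expR !mulr_ge0 // subr_ge0 pow_le1.
have MS i : M i * (1 + 3 * beta / 2 ^+ i) <= M i.+1.
  rewrite /M -mulrA ler_wpM2l //; first lra.
  apply: (@le_trans _ _ (expR (6 * beta * (1 - (2 ^+ i)^-1)) * expR (3 * beta / 2 ^+ i))).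
    by rewrite ler_wpM2l ?expR_ge0 // expR_ge1Dx.
  rewrite -expRD ler_expR exprS invfM le_eqVlt; apply/orP; left; apply/eqP.
  by field; rewrite gt_eqF.
have key i : cabs (X i) <= M i /\ cabs (X i.+1) <= M i.
  elim: i => [|i [h1 h2]]; first by rewrite /M expr0 invr1 subrr mulr0 expR0 mulr1.
  have Mi := M1 i; have MSi := MS i.
  have c0 : 0 <= beta / 2 ^+ i by rewrite divr_ge0 // ltW.
  have h3 : cabs (X i.+2) <= M i * (1 + 3 * beta / 2 ^+ i).
    rewrite -(subrK (X i.+1) (X i.+2)); apply: le_trans (cabsD _ _) _.
    apply: le_trans (lerD (Xrec i) h2) _.
    have : beta / 2 ^+ i * (cabs (X i.+1) + cabs (X i) + 1) <= beta / 2 ^+ i * (3 * M i).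
      by rewrite ler_wpM2l //; lra.
    have -> : M i * (1 + 3 * beta / 2 ^+ i) = beta / 2 ^+ i * (3 * M i) + M i by ring.
    by rewrite lerD2r.
  split; last exact: le_trans MSi.
  apply: le_trans h2 _; apply: le_trans MSi; rewrite ler_peMr //; first lra.
  by rewrite lerDl -mulrA mulr_ge0.
move=> i; apply: le_trans (key i).1 _; rewrite /M ler_wpM2l //; first lra.
by rewrite ler_expR ler_piMr ?mulr_ge0 // gerBl invr_ge0 ltW.
Qed.

Lemma slow_recursion_cvg X (beta T : R) : 0 <= beta -> 1 <= T ->
  cabs (X 0%N) <= T -> cabs (X 1%N) <= T ->
  (forall i, cabs (X i.+2 - X i.+1) <=
     beta / 2 ^+ i * (cabs (X i.+1) + cabs (X i) + 1)) ->
  ((fun i => complex.Re (X i)) @ \oo --> lim ((fun i => complex.Re (X i)) @ \oo)) /\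
  forall i, `|lim ((fun i => complex.Re (X i)) @ \oo) - complex.Re (X i)| <=
    (4 * beta * (2 * (T * expR (6 * beta)) + 1) + 4 * (T * expR (6 * beta))) / 2 ^+ i.
Proof.
move=> b0 T1 X0 X1 Xrec; have bd := slow_recursion_bound b0 T1 X0 X1 Xrec.
move: (T * expR (6 * beta)) bd => B bd.
have B0 : 0 <= B by exact: le_trans (cabs_ge0 _) (bd 0%N).
apply: geometric_cauchy => -[|i]; rewrite -ReB; apply: le_trans (Re_cabs _) _.
  apply: le_trans (cabsB _ _) _; have h0 := bd 0%N; have h1 := bd 1%N.
  rewrite expr1 ler_pdivlMr //.
  have : 0 <= 4 * beta * (2 * B + 1) by rewrite !mulr_ge0 //; lra.
  lra.
apply: le_trans (Xrec i) _.
have p : 0 < 2 ^+ i :> R by rewrite exprn_gt0.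
rewrite !exprS; have -> : (4 * beta * (2 * B + 1) + 4 * B) / (2 * (2 * 2 ^+ i)) =
  beta / 2 ^+ i * (2 * B + 1) + B / 2 ^+ i by field; rewrite gt_eqF.
have h0 := bd i; have h1 := bd i.+1.
rewrite -[leLHS]addr0 lerD ?divr_ge0 ?(ltW p) //.
rewrite ler_wpM2l ?divr_ge0 ?(ltW p) //; lra.
Qed.

End SlowRecursions.

Section NormalizedLogder.
Context {R : realType} {A : R} {E : nat} {q : nat -> {poly Cplx R}}
  {b : nat -> Cplx R} {e : nat -> nat}.
Hypothesis H : recurrence_class A E q b e.
Implicit Types z v w : C2 R.

(** [logder] is nearly multiplied by the degree at each step; after
    division by the product of the degrees its real part differentiates
    [loggrowth] at escaping points. *)
Definition nlogder k z v : Cplx R := logder q b k z v / (degs e k)%:R.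

Definition nlogder2 k z v w : Cplx R := logder2 q b k z v w / (degs e k)%:R.

Local Notation L1 := (logder_cst A E).
Local Notation L2 := (logder2_cst A E).

Lemma nlogder_const_ge0 : 0 <= L1 /\ 0 <= L2.
Proof.
have A1 := class_A_ge1 H.
have c1 : 0 <= L1.
  by rewrite /logder_cst !mulr_ge0 ?addr_ge0 ?exprn_ge0 //; lra.
split=> //; rewrite /logder2_cst !addr_ge0 //.
by rewrite !mulr_ge0 ?addr_ge0 ?exprn_ge0 //; lra.
by apply: mulr_ge0 => //; apply: mulr_ge0.
by apply: mulr_ge0 => //; apply: exprn_ge0.
Qed.

Lemma escaping_neq0 z : escaping A E z -> z.2 != 0.
Proof. by move=> /(escaping_ge1 H) z1; rewrite -cabs_gt0; lra. Qed.

Lemma escaping_tail_ge k1 i z : escaping A E (orb q b k1 z) ->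
  (4 * E.+1%:R) ^+ i <= cabs (orb q b (k1 + i) z).2.
Proof.
move=> ez; apply: le_trans (escaping_orb_grow H i ez).
by rewrite ler_peMr ?(escaping_ge1 H ez) // exprn_ge0.
Qed.

Lemma logder_rec k z v : (orb q b k z).2 != 0 -> (orb q b k.+1 z).2 != 0 ->
  logder q b k.+2 z v =
  ((q k.+1)^`().[(orb q b k.+1 z).2] * ((orb q b k.+1 z).2 * logder q b k.+1 z v)
    - b k.+1 * ((orb q b k z).2 * logder q b k z v)) / (orb q b k.+2 z).2.
Proof.
move=> y0 y1; rewrite {1}/logder; congr (_ / _) => /=.
rewrite /logder [X in _ = _ * X - _]mulrC divfK //.
by rewrite [X in _ = _ - _ * X]mulrC divfK.
Qed.

Lemma logder2_rec k z v w : (orb q b k z).2 != 0 -> (orb q b k.+1 z).2 != 0 ->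
  logder2 q b k.+2 z v w =
  ((q k.+1)^`()^`().[(orb q b k.+1 z).2] *
     ((orb q b k.+1 z).2 * logder q b k.+1 z w) *
     ((orb q b k.+1 z).2 * logder q b k.+1 z v) +
   (q k.+1)^`().[(orb q b k.+1 z).2] * ((orb q b k.+1 z).2 *
     (logder2 q b k.+1 z v w + logder q b k.+1 z v * logder q b k.+1 z w))
    - b k.+1 * ((orb q b k z).2 * (logder2 q b k z v w +
        logder q b k z v * logder q b k z w))) / (orb q b k.+2 z).2
   - logder q b k.+2 z v * logder q b k.+2 z w.
Proof.
move=> y0 y1; rewrite {1}/logder2; congr (_ / _ - _); rewrite /logder2 !subrK.
have qK (x y : Cplx R) : y != 0 -> y * (x / y) = x by move=> ?; rewrite mulrC divfK.
rewrite (qK (ddorb q b k.+1 z v w).2 _ y1) (qK (ddorb q b k z v w).2 _ y0).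
by rewrite /logder (qK (dorb q b k.+1 z w).2 _ y1) (qK (dorb q b k.+1 z v).2 _ y1).
Qed.

Lemma degs_mono k : (degs e k)%:R <= (degs e k.+1)%:R :> R.
Proof.
have [/andP[e2 _] _ _ _ _] := H k.
by rewrite ler_nat degsS leq_pmulr // (leq_trans _ e2).
Qed.

Lemma degs_le k i : (degs e (k + i))%:R <= (degs e k)%:R * E%:R ^+ i :> R.
Proof.
elim: i => [|i IH]; first by rewrite addn0 expr0 mulr1.
rewrite addnS degsS natrM exprSr mulrA.
have [/andP[_ eE] _ _ _ _] := H (k + i).
by apply: ler_pM; rewrite // ler_nat.
Qed.

(** Moduli of an escaping orbit grow by [4 * E.+1%:R] at each step and degrees by at
    most [E], so that even degree over modulus is geometrically small. *)
Lemma tail_inv_le k1 i z : escaping A E (orb q b k1 z) ->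
  (cabs (orb q b (k1 + i) z).2)^-1 <= (2 ^+ i)^-1 /\
  (degs e (k1 + i))%:R / cabs (orb q b (k1 + i) z).2 <= (degs e k1)%:R / 2 ^+ i.
Proof.
move=> ez; have h := escaping_tail_ge i ez.
have E1 : 1 <= E.+1%:R :> R by rewrite ler1n.
have p2 : 0 < 2 ^+ i :> R by rewrite exprn_gt0.
have pE : 0 < (4 * E.+1%:R) ^+ i :> R by rewrite exprn_gt0 // mulr_gt0 // ltr0n.
have y0 := lt_le_trans pE h.
have le2 : 2 ^+ i <= (4 * E.+1%:R) ^+ i :> R by rewrite lerXn2r ?nnegrE //; lra.
split; first by rewrite lef_pV2 ?posrE // (le_trans le2).
rewrite ler_pdivrMr // mulrAC ler_pdivlMr //.
apply: (@le_trans _ _ ((degs e k1)%:R * E%:R ^+ i * 2 ^+ i)).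
  by rewrite ler_wpM2r ?(ltW p2) // degs_le.
rewrite -mulrA ler_wpM2l // -exprMn; apply: le_trans h.
have E0 : 0 <= E%:R :> R by [].
rewrite lerXn2r ?nnegrE ?mulr_ge0 //.
by rewrite -natr1; lra.
Qed.

(** The numerical part of [nlogder2_step]: the square [(B * D1) ^+ 2] of the
    first-order quantities carries one degree too many, which the weight [s]
    absorbs since [D1 * s] is still geometrically small. *)
Lemma second_order_weights (L s h D2 D1 D0 w1 w0 d B : R) :
  0 <= L -> 0 <= s -> 0 <= D0 -> D0 <= D1 -> D1 <= D2 -> 0 <= w1 -> 0 <= w0 ->
  0 <= d -> s <= h -> D1 * s <= d * h ->
  L * s * (w1 * D1 + w0 * D0 + (B * D1) ^+ 2) <=
  L * (1 + B ^+ 2 * d) * h * (w1 + w0 + 1) * D2.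
Proof.
move=> L0 s0 D00 D01 D12 w10 w00 d0 sh Dsh.
have B2 : 0 <= B ^+ 2 by exact: sqr_ge0.
have h0 : 0 <= h by exact: le_trans sh.
have D10 : 0 <= D1 by exact: le_trans D01.
have D20 : 0 <= D2 by exact: le_trans D12.
have t1 : s * (w1 * D1) <= h * (w1 * D2).
  by apply: ler_pM; rewrite ?mulr_ge0 // ler_wpM2l.
have t2 : s * (w0 * D0) <= h * (w0 * D2).
  by apply: ler_pM; rewrite ?mulr_ge0 // ler_wpM2l // (le_trans D01).
have t3 : B ^+ 2 * (D1 * (D1 * s)) <= B ^+ 2 * (D2 * (d * h)).
  by rewrite ler_wpM2l // ler_pM // mulr_ge0.
have -> : L * s * (w1 * D1 + w0 * D0 + (B * D1) ^+ 2) =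
  L * (s * (w1 * D1) + s * (w0 * D0) + B ^+ 2 * (D1 * (D1 * s))) by ring.
have -> : L * (1 + B ^+ 2 * d) * h * (w1 + w0 + 1) * D2 =
  L * (h * (w1 * D2) + h * (w0 * D2) + B ^+ 2 * (D2 * (d * h)) +
    (h * D2 + B ^+ 2 * d * h * (w1 + w0) * D2)) by ring.
rewrite ler_wpM2l // -[leLHS]addr0 lerD //.
  by rewrite lerD // lerD.
apply: addr_ge0; first exact: mulr_ge0.
by rewrite mulr_ge0 // mulr_ge0 ?addr_ge0 // mulr_ge0 // mulr_ge0.
Qed.

Lemma nlogder_step k1 i z v : escaping A E (orb q b k1 z) ->
  cabs (nlogder (k1 + i).+2 z v - nlogder (k1 + i).+1 z v) <=
  L1 / 2 ^+ i * (cabs (nlogder (k1 + i).+1 z v) + cabs (nlogder (k1 + i) z v) + 1).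
Proof.
move=> ez; set k := (k1 + i)%N.
have ek : escaping A E (orb q b k z) by exact: (escaping_orb H).
have ek1 : escaping A E (orb q b k.+1 z) by exact: (escaping_henon H).
have y0 := escaping_neq0 ek; have y1 := escaping_neq0 ek1.
have [er sq qA _ bA] := H k.+1.
have st := @logder_step R A E (e k.+1) (q k.+1) (orb q b k.+1 z).2 (orb q b k z).2
  (orb q b k.+2 z).2 (b k.+1) er sq qA bA (class_A_ge1 H) (escaping_ge1 H ek1)
  (proj2 ek1) erefl (escaping_step H k.+1 ek1)
  (logder q b k.+1 z v) (logder q b k z v).
rewrite -(logder_rec _ y0 y1) in st.
have Dk2 := degsR_gt0 H k.+2; have Dk1 := degsR_gt0 H k.+1; have Dk := degsR_gt0 H k.
have DN j : (degs e j)%:R != 0 :> Cplx R.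
  by rewrite pnatr_eq0 -lt0n (degs_gt0 H).
have eN : (e k.+1)%:R != 0 :> Cplx R.
  by have := DN k.+2; rewrite degsS natrM mulf_eq0 negb_or => /andP[].
have -> : nlogder k.+2 z v - nlogder k.+1 z v =
    (logder q b k.+2 z v - (e k.+1)%:R * logder q b k.+1 z v) / (degs e k.+2)%:R.
  by rewrite /nlogder degsS natrM; field; rewrite DN eN.
rewrite cabsf cabs_nat ler_pdivrMr //; apply: le_trans st _.
have [L10 _] := nlogder_const_ge0.
have [h1 _] := tail_inv_le i.+1 ez; rewrite addnS -/k in h1.
have p2 : 0 < 2 ^+ i :> R by rewrite exprn_gt0.
rewrite -[leRHS]mulrA; apply: ler_pM.
by rewrite mulr_ge0 // invr_ge0 cabs_ge0.
by rewrite addr_ge0 ?cabs_ge0.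
rewrite ler_wpM2l //; apply: le_trans h1 _.
  rewrite lef_pV2 ?posrE ?exprn_gt0 // exprS; move: (2 ^+ i : R) p2 => x; lra.
have nE j : cabs (logder q b j z v) = cabs (nlogder j z v) * (degs e j)%:R.
  by rewrite /nlogder cabsf cabs_nat divfK // gt_eqF // (degsR_gt0 H).
rewrite !nE !mulrDl -[leLHS]addr0; apply: lerD; last by rewrite mul1r ltW.
apply: lerD; rewrite ler_wpM2l ?cabs_ge0 //; first exact: degs_mono.
exact: le_trans (degs_mono _) (degs_mono _).
Qed.

Lemma nlogder2_step k1 i z v w (B : R) : escaping A E (orb q b k1 z) ->
  (forall i, cabs (nlogder (k1 + i) z v) <= B) ->
  (forall i, cabs (nlogder (k1 + i) z w) <= B) ->
  cabs (nlogder2 (k1 + i).+2 z v w - nlogder2 (k1 + i).+1 z v w) <=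
  L2 * (1 + B ^+ 2 * (degs e k1)%:R) / 2 ^+ i *
    (cabs (nlogder2 (k1 + i).+1 z v w) + cabs (nlogder2 (k1 + i) z v w) + 1).
Proof.
move=> ez Bv Bw; set k := (k1 + i)%N.
have B0 : 0 <= B by exact: le_trans (cabs_ge0 _) (Bv 0%N).
have ek : escaping A E (orb q b k z) by exact: (escaping_orb H).
have ek1 : escaping A E (orb q b k.+1 z) by exact: (escaping_henon H).
have y0 := escaping_neq0 ek; have y1 := escaping_neq0 ek1.
have [er sq qA _ bA] := H k.+1.
have Dk2 := degsR_gt0 H k.+2; have Dk1 := degsR_gt0 H k.+1; have Dk := degsR_gt0 H k.
have nE j x : cabs (logder q b j z x) = cabs (nlogder j z x) * (degs e j)%:R.
  by rewrite /nlogder cabsf cabs_nat divfK // gt_eqF // (degsR_gt0 H).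
have n2E j : cabs (logder2 q b j z v w) = cabs (nlogder2 j z v w) * (degs e j)%:R.
  by rewrite /nlogder2 cabsf cabs_nat divfK // gt_eqF // (degsR_gt0 H).
have mle x : (forall i, cabs (nlogder (k1 + i) z x) <= B) ->
    cabs (logder q b k.+1 z x) <= B * (degs e k.+1)%:R /\
    cabs (logder q b k z x) <= B * (degs e k.+1)%:R.
  move=> Bx; rewrite !nE; split.
    by rewrite ler_wpM2r ?(ltW Dk1) //; have := Bx i.+1; rewrite addnS.
  by apply: ler_pM; [exact: cabs_ge0|exact: ltW|exact: Bx|exact: degs_mono].
have [mv1 mv0] := mle v Bv; have [mw1 mw0] := mle w Bw.
have st := @logder2_step R A E (e k.+1) (q k.+1) (orb q b k.+1 z).2 (orb q b k z).2
  (orb q b k.+2 z).2 (b k.+1) er sq qA bA (class_A_ge1 H) (escaping_ge1 H ek1)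
  (proj2 ek1) erefl (escaping_step H k.+1 ek1)
  (logder q b k.+1 z v) (logder q b k z v) (logder q b k.+1 z w) (logder q b k z w)
  (logder2 q b k.+1 z v w) (logder2 q b k z v w) _ mv1 mv0 mw1 mw0.
rewrite -!(logder_rec _ y0 y1) -(logder2_rec _ _ y0 y1) in st.
have DN j : (degs e j)%:R != 0 :> Cplx R.
  by rewrite pnatr_eq0 -lt0n (degs_gt0 H).
have eN : (e k.+1)%:R != 0 :> Cplx R.
  by have := DN k.+2; rewrite degsS natrM mulf_eq0 negb_or => /andP[].
have -> : nlogder2 k.+2 z v w - nlogder2 k.+1 z v w =
    (logder2 q b k.+2 z v w - (e k.+1)%:R * logder2 q b k.+1 z v w) / (degs e k.+2)%:R.
  by rewrite /nlogder2 degsS natrM; field; rewrite DN eN.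
rewrite cabsf cabs_nat ler_pdivrMr //; apply: le_trans st _.
have [_ L20] := nlogder_const_ge0.
have [h1 h2] := tail_inv_le i.+1 ez; rewrite addnS -/k in h1 h2.
have p2 : 0 < 2 ^+ i :> R by rewrite exprn_gt0.
have half : (2 ^+ i.+1)^-1 <= (2 ^+ i)^-1 :> R.
  rewrite lef_pV2 ?posrE ?exprn_gt0 // exprS; move: (2 ^+ i : R) p2 => x; lra.
have {}h1 := le_trans h1 half.
have {}h2 : (degs e k.+1)%:R / cabs (orb q b k.+1 z).2 <= (degs e k1)%:R / 2 ^+ i.
  by apply: le_trans h2 _; rewrite ler_wpM2l.
rewrite !n2E; apply: second_order_weights => //; rewrite ?cabs_ge0 ?invr_ge0 ?cabs_ge0 //.
exact: degs_mono.
exact: degs_mono.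
Qed.

End NormalizedLogder.

(** * Pluriharmonicity off the filled set *)

Section Pluriharmonic.
Context {R : realType} {A : R} {E : nat} {q : nat -> {poly Cplx R}}
  {b : nat -> Cplx R} {e : nat -> nat}.
Hypothesis H : recurrence_class A E q b e.
Implicit Types z v w : C2 R.

Local Notation nlogder := (@nlogder R q b e).
Local Notation nlogder2 := (@nlogder2 R q b e).

Definition green1 v z : R := lim ((fun k => complex.Re (nlogder k z v)) @ \oo).

Definition green2 v w z : R := lim ((fun k => complex.Re (nlogder2 k z v w)) @ \oo).

(** The next step turns the weak inequalities of [escaping] into strict ones, which
    hold on a neighborhood. *)
Lemma near_escaping z : 0 < green q b e z ->
  exists k, \forall w \near z, escaping A E (orb q b k w).
Proof.
move=> /(green_gt0P H)[k ez]; exists k.+1.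
have A1 := class_A_ge1 H; have E1 : 1 <= E.+1%:R :> R by rewrite ler1n.
have y1 := escaping_ge1 H ez; have grow := escaping_grow H k ez.
have r1 : 1 <= escape_radius A E.
  by apply: le_trans (escape_radius_ge1 H); nra.
have lt2 : cabs (orb q b k z).2 < cabs (orb q b k.+1 z).2.
  by apply: lt_le_trans grow; nra.
have lt1 : escape_radius A E < cabs (orb q b k.+1 z).2.
  by case: ez => h _; exact: le_lt_trans h lt2.
have FF : Filter (nbhs z) by exact: _.
have /cvg_C2P[c1 c2] := @continuous_orb R q b k.+1 z.
have n1 : \forall w \near z, escape_radius A E < cabs (orb q b k.+1 w).2.
  by apply: (cvgr_gt _ (cvg_cabs FF c2)).
have n2 : \forall w \near z,
    0 < cabs (orb q b k.+1 w).2 - cabs (orb q b k.+1 w).1.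
  apply: (cvgr_gt _ (cvgB (cvg_cabs FF c2) (cvg_cabs FF c1))).
  by rewrite subr_gt0.
by apply: filterS2 n1 n2 => w h1 h2; split; rewrite ltW // -subr_gt0.
Qed.

Lemma near_bounded (f : C2 R -> Cplx R) z : {for z, continuous f} ->
  \forall w \near z, cabs (f w) <= cabs (f z) + 1.
Proof.
move=> cf; have FF : Filter (nbhs z) by exact: _.
have lt1 : cabs (f z) < cabs (f z) + 1 by rewrite ltrDl.
have : \forall w \near z, cabs (f w) < cabs (f z) + 1.
  by apply: (cvgr_lt _ (cvg_cabs FF cf)).
by apply: filterS => w; exact: ltW.
Qed.

Lemma cvg_nlogder k z v : (orb q b k z).2 != 0 ->
  {for z, continuous (fun x : C2 R => nlogder k x v)}.
Proof.
by move=> y0; apply: cvgM; [exact: cvg_logder|exact: cvg_cst].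
Qed.

Lemma cvg_nlogder2 k z v w : (orb q b k z).2 != 0 ->
  {for z, continuous (fun x : C2 R => nlogder2 k x v w)}.
Proof.
by move=> y0; apply: cvgM; [exact: cvg_logder2|exact: cvg_cst].
Qed.

Lemma tail_limit (u : nat -> R) k (l : R) : (fun i => u (k + i)%N) @ \oo --> l ->
  u @ \oo --> l.
Proof.
have -> : (fun i => u (k + i)%N) = (fun i => u (i + k)%N).
  by apply/funext => i; rewrite addnC.
by rewrite cvg_shiftn.
Qed.

(** The initial data of the two recursions are bounded near [z] by continuity, and
    all the other constants depend only on the class and on [k]. *)
Lemma green12_uniform z v w : 0 < green q b e z -> exists k, exists C : R,
  \forall x \near z, [/\ escaping A E (orb q b k x),
    forall i, `|green1 v x - complex.Re (nlogder (k + i) x v)| <= C / 2 ^+ i &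
    forall i, `|green2 v w x - complex.Re (nlogder2 (k + i) x v w)| <= C / 2 ^+ i].
Proof.
move=> /near_escaping[k nez]; exists k.
have ez := nbhs_singleton nez.
have y0 : (orb q b k z).2 != 0 by exact: (escaping_neq0 H ez).
have y1 : (orb q b k.+1 z).2 != 0.
  by apply: (escaping_neq0 H); exact: (escaping_henon H).
have [L10 L20] := nlogder_const_ge0 H.
have bd1 := near_bounded (@cvg_nlogder _ z v y0).
have bd2 := near_bounded (@cvg_nlogder _ z v y1).
have bd3 := near_bounded (@cvg_nlogder _ z w y0).
have bd4 := near_bounded (@cvg_nlogder _ z w y1).
have bd5 := near_bounded (@cvg_nlogder2 _ z v w y0).
have bd6 := near_bounded (@cvg_nlogder2 _ z v w y1).
(* the first two terms of each recursion start the Gronwall bound *)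
pose s : seq R := [:: cabs (nlogder k z v) + 1; cabs (nlogder k.+1 z v) + 1;
  cabs (nlogder k z w) + 1; cabs (nlogder k.+1 z w) + 1;
  cabs (nlogder2 k z v w) + 1; cabs (nlogder2 k.+1 z v w) + 1].
have [T T1 sT] : exists2 T : R, 1 <= T & forall x, x \in s -> x <= T.
  have s0 x : x \in s -> 0 <= x.
    by rewrite !inE; do ![case/orP]; move=> /eqP ->; rewrite addr_ge0 ?cabs_ge0.
  move: s s0 => s s0; exists (1 + \sum_(x <- s) x); first by rewrite lerDl big_seq sumr_ge0.
  move=> x xs; rewrite (big_rem x) //= addrCA lerDl addr_ge0 //.
  by rewrite big_seq sumr_ge0 // => y /mem_rem; exact: s0.
pose B : R := T * expR (6 * logder_cst A E).
(* [B] bounds the first-order sequences, and [beta] is the rate of [nlogder2_step] *)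
pose beta : R := logder2_cst A E * (1 + B ^+ 2 * (degs e k)%:R).
have beta0 : 0 <= beta.
  by rewrite /beta mulr_ge0 // addr_ge0 // mulr_ge0 // sqr_ge0.
pose cst (g : R) : R := 4 * g * (2 * (T * expR (6 * g)) + 1) + 4 * (T * expR (6 * g)).
have cst0 g : 0 <= g -> 0 <= cst g.
  move=> g0; have T0 : 0 <= T by exact: le_trans T1.
  have Te : 0 <= T * expR (6 * g) by rewrite mulr_ge0 // expR_ge0.
  by rewrite /cst addr_ge0 // ?mulr_ge0 // ?addr_ge0 // ?mulr_ge0.
exists (cst (logder_cst A E) + cst beta); near=> x.
have ex : escaping A E (orb q b k x) by near: x.
have xv0 : cabs (nlogder k x v) <= T.
  by apply: (@le_trans _ _ (cabs (nlogder k z v) + 1));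
    [near: x|apply: sT; rewrite !inE eqxx].
have xv1 : cabs (nlogder k.+1 x v) <= T.
  by apply: (@le_trans _ _ (cabs (nlogder k.+1 z v) + 1));
    [near: x|apply: sT; rewrite !inE eqxx ?orbT].
have xw0 : cabs (nlogder k x w) <= T.
  by apply: (@le_trans _ _ (cabs (nlogder k z w) + 1));
    [near: x|apply: sT; rewrite !inE eqxx ?orbT].
have xw1 : cabs (nlogder k.+1 x w) <= T.
  by apply: (@le_trans _ _ (cabs (nlogder k.+1 z w) + 1));
    [near: x|apply: sT; rewrite !inE eqxx ?orbT].
have x20 : cabs (nlogder2 k x v w) <= T.
  by apply: (@le_trans _ _ (cabs (nlogder2 k z v w) + 1));
    [near: x|apply: sT; rewrite !inE eqxx ?orbT].
have x21 : cabs (nlogder2 k.+1 x v w) <= T.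
  by apply: (@le_trans _ _ (cabs (nlogder2 k.+1 z v w) + 1));
    [near: x|apply: sT; rewrite !inE eqxx ?orbT].
have rec1 u i : cabs (nlogder (k + i.+2) x u - nlogder (k + i.+1) x u) <=
    logder_cst A E / 2 ^+ i *
      (cabs (nlogder (k + i.+1) x u) + cabs (nlogder (k + i) x u) + 1).
  by rewrite !addnS; exact: (nlogder_step H).
have bdv := @slow_recursion_bound R (fun i => nlogder (k + i) x v) _ T L10 T1.
have bdw := @slow_recursion_bound R (fun i => nlogder (k + i) x w) _ T L10 T1.
rewrite /= addn0 addn1 in bdv bdw.
have {}bdv := bdv xv0 xv1 (rec1 v); have {}bdw := bdw xw0 xw1 (rec1 w).
have rec2 i : cabs (nlogder2 (k + i.+2) x v w - nlogder2 (k + i.+1) x v w) <=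
    beta / 2 ^+ i *
      (cabs (nlogder2 (k + i.+1) x v w) + cabs (nlogder2 (k + i) x v w) + 1).
  by rewrite !addnS; exact: (nlogder2_step H).
have [] := @slow_recursion_cvg R (fun i => nlogder (k + i) x v) _ T L10 T1.
by rewrite addn0.
by rewrite addn1.
exact: rec1.
move=> cv1 err1.
have [] := @slow_recursion_cvg R (fun i => nlogder2 (k + i) x v w) _ T beta0 T1.
by rewrite addn0.
by rewrite addn1.
exact: rec2.
move=> cv2 err2.
have p i : 0 < 2 ^+ i :> R by rewrite exprn_gt0.
have lim1 : green1 v x = lim ((fun i => complex.Re (nlogder (k + i) x v)) @ \oo).
  by apply: cvg_lim => //; exact: (tail_limit cv1).
have lim2 : green2 v w x = lim ((fun i => complex.Re (nlogder2 (k + i) x v w)) @ \oo).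
  by apply: cvg_lim => //; exact: (tail_limit (u := fun n => complex.Re (nlogder2 n x v w)) cv2).
split=> // i.
rewrite lim1; apply: le_trans (err1 i) _; rewrite ler_wpM2r ?invr_ge0 ?(ltW (p i)) //.
  by rewrite lerDl cst0.
rewrite lim2; apply: le_trans (err2 i) _; rewrite ler_wpM2r ?invr_ge0 ?(ltW (p i)) //.
by rewrite lerDr cst0.
Unshelve. all: by end_near. Qed.

Lemma Re_div_nat (x : Cplx R) n : complex.Re (x / n%:R) = complex.Re x / n%:R.
Proof.
have -> : (n%:R : Cplx R) = toC n%:R.
  by elim: n => // n IH; rewrite !mulrS IH toCD.
rewrite cRe_div /toC /= mulr0 addr0 [0 ^+ 2]expr0n addr0.
have [->|n0] := eqVneq (n%:R : R) 0; first by rewrite mulr0 invr0 mulr0 mul0r.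
by field.
Qed.

Lemma tail_small k (C eps : R) : 0 < eps ->
  exists N, forall n, (N <= n)%N -> C / 2 ^+ (n - k) <= eps.
Proof.
move=> e0; have [n0 _ n0P] := geometric_small C e0.
by exists (k + n0)%N => n kn; apply/ltW/n0P => /=; lia.
Qed.

Lemma green1_tail z v w (eps : R) : 0 < green q b e z -> 0 < eps ->
  exists N, \forall x \near z, forall n, (N <= n)%N ->
    `|complex.Re (nlogder n x v) - green1 v x| <= eps /\
    `|complex.Re (nlogder2 n x v w) - green2 v w x| <= eps.
Proof.
move=> /(@green12_uniform z v w)[k [C nC]] /(tail_small k C)[N NP].
exists (maxn N k); apply: filterS nC => x [_ h1 h2] n.
rewrite geq_max => /andP[Nn kn]; have {}NP := NP n Nn.
split; rewrite distrC; first by apply: le_trans NP; have := h1 (n - k)%N; rewrite subnKC.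
by apply: le_trans NP; have := h2 (n - k)%N; rewrite subnKC.
Qed.

Lemma orb_neq0_near z : 0 < green q b e z -> exists N, \forall x \near z,
  forall n, (N <= n)%N -> escaping A E (orb q b n x).
Proof.
move=> /near_escaping[k nk]; exists k; apply: filterS nk => x ek n kn.
by rewrite -(subnKC kn); exact: (escaping_orb H).
Qed.

Lemma continuous_green1 z v : 0 < green q b e z -> {for z, continuous (green1 v)}.
Proof.
move=> z0; apply: (@continuous_uniform_limit R (fun n x => complex.Re (nlogder n x v))).
  move=> eps eps0; have [N NP] := green1_tail v v z0 eps0.
  by exists N; apply: filterS NP => x h n /h[].
have [N nN] := orb_neq0_near z0; exists N => n Nn.
have y0 := escaping_neq0 H (nbhs_singleton nN n Nn).
have FF : Filter (nbhs z) by exact: _.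
exact: (cvg_Re FF (@cvg_nlogder n z v y0)).
Qed.

Lemma continuous_green2 z v w : 0 < green q b e z ->
  {for z, continuous (green2 v w)}.
Proof.
move=> z0; apply: (@continuous_uniform_limit R (fun n x => complex.Re (nlogder2 n x v w))).
  move=> eps eps0; have [N NP] := green1_tail v w z0 eps0.
  by exists N; apply: filterS NP => x h n /h[].
have [N nN] := orb_neq0_near z0; exists N => n Nn.
have y0 := escaping_neq0 H (nbhs_singleton nN n Nn).
have FF : Filter (nbhs z) by exact: _.
exact: (cvg_Re FF (@cvg_nlogder2 n z v w y0)).
Qed.

Lemma is_derive_divr (F : R -> R) (t d : R) (r : R) : is_derive t 1 F d ->
  is_derive t 1 (fun s => F s / r) (d / r).
Proof.
move=> Fd; have -> : (fun s => F s / r) = r^-1 \*: F.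
  by apply/funext => s; rewrite /GRing.scale /= mulrC.
by apply: is_derive_eqr (is_deriveZ r^-1 Fd) _; rewrite /GRing.scale /= mulrC.
Qed.

Lemma green_near_limit z : 0 < green q b e z -> \forall x \near z,
  (fun n => ln (cabs (orb q b n x).2) / (degs e n)%:R) @ \oo --> green q b e x.
Proof.
move=> /orb_neq0_near[N nN]; apply: filterS nN => x ex.
apply: (@cvg_trans _ ((fun n => loggrowth q b e n x) @ \oo)); last exact: green_cvg.
apply: near_eq_cvg; exists N => // n Nn.
by rewrite /= /loggrowth (escaping_height H (ex n Nn)).
Qed.

Lemma is_derive_green z v : 0 < green q b e z ->
  is_derive (0 : R) 1 (fun t : R => green q b e (z + toC t *: v)) (green1 v z).
Proof.
move=> z0; apply: (@is_derive_uniform_limit R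
  (fun n x => ln (cabs (orb q b n x).2) / (degs e n)%:R) _
  (fun n x => complex.Re (nlogder n x v))).
have [N nN] := orb_neq0_near z0; exists N; apply: filterS nN => x ex n Nn.
  have y0 := escaping_neq0 H (ex n Nn).
  by rewrite Re_div_nat; apply: is_derive_divr; exact: is_derive_ln_orb.
exact: green_near_limit.
move=> eps eps0; have [N NP] := green1_tail v v z0 eps0.
  by exists N; apply: filterS NP => x h n /h[].
exact: continuous_green1.
Qed.

Lemma near_green_gt0 z : 0 < green q b e z -> \forall x \near z, 0 < green q b e x.
Proof. by move=> z0; apply: (cvgr_gt _ (@continuous_green R A E q b e H z)). Qed.

Lemma green12_cvg z v w : 0 < green q b e z ->
  (fun n => complex.Re (nlogder n z v)) @ \oo --> green1 v z /\
  (fun n => complex.Re (nlogder2 n z v w)) @ \oo --> green2 v w z.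
Proof.
move=> z0; split; apply/cvgrPdist_le => eps eps0;
    have [N NP] := green1_tail v w z0 eps0; exists N => // n /(nbhs_singleton NP)[];
    by rewrite distrC [in X in _ -> X]distrC.
Qed.

Lemma is_derive_green1 z v w : 0 < green q b e z ->
  is_derive (0 : R) 1 (fun t : R => green1 v (z + toC t *: w)) (green2 v w z).
Proof.
move=> z0; apply: (@is_derive_uniform_limit R
  (fun n x => complex.Re (nlogder n x v)) _
  (fun n x => complex.Re (nlogder2 n x v w))).
have [N nN] := orb_neq0_near z0; exists N; apply: filterS nN => x ex n Nn.
  have y0 := escaping_neq0 H (ex n Nn).
  have -> : (fun t : R => complex.Re (nlogder n (x + toC t *: w) v)) =
    (fun t : R => complex.Re (logder q b n (x + toC t *: w) v) / (degs e n)%:R).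
    by apply/funext => t; rewrite Re_div_nat.
  by rewrite Re_div_nat; apply: is_derive_divr; exact: is_derive_logder.
apply: filterS (near_green_gt0 z0) => x x0; exact: (green12_cvg v v x0).1.
move=> eps eps0; have [N NP] := green1_tail v w z0 eps0.
  by exists N; apply: filterS NP => x h n /h[].
exact: continuous_green2.
Qed.

Lemma real_derive_green z v : 0 < green q b e z ->
  real_derivable (green q b e) v z /\ real_derive (green q b e) v z = green1 v z.
Proof.
move=> z0; have [d1 d2] := is_derive_green v z0.
split; first exact: d1.
by rewrite -d2 /real_derive; exact: derive1E.
Qed.

Lemma near_line (P : set (C2 R)) z v : (\forall x \near z, P x) ->
  \forall t \near (0 : R), P (z + toC t *: v).
Proof.
move=> Pz; have c0 := @cvg_real_line R z v 0.
by rewrite toC0 scale0r addr0 in c0; exact: (c0 _ Pz).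
Qed.

Lemma real_derive_green1 z v w : 0 < green q b e z ->
  real_derivable (real_derive (green q b e) v) w z /\
  real_derive (real_derive (green q b e) v) w z = green2 v w z.
Proof.
move=> z0; have eqn : \forall t \near (0 : R), green1 v (z + toC t *: w) =
    real_derive (green q b e) v (z + toC t *: w).
  apply: (near_line (P := fun x => green1 v x = real_derive (green q b e) v x)).
  by apply: filterS (near_green_gt0 z0) => x x0; have [_ ->] := real_derive_green v x0.
have [d3 d4] := near_eq_is_derive eqn (is_derive_green1 v w z0).
split; first exact: d3.
by rewrite -d4 /real_derive; exact: derive1E.
Qed.

Lemma eq_near_continuous (f g : C2 R -> R) z : {for z, continuous f} ->
  (\forall x \near z, f x = g x) -> {for z, continuous g}.
Proof.
move=> cf fg; have fz := nbhs_singleton fg.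
have h : g @ z --> f z.
  apply: (@cvg_trans _ (f @ z)); last exact: cf.
  by apply: near_eq_cvg; apply: filterS fg.
by rewrite fz in h.
Qed.

(** Each [nlogder2] changes sign when both directions are multiplied by [iunit]. *)
Lemma green2_laplace z v : 0 < green q b e z ->
  green2 v v z + green2 (iunit *: v) (iunit *: v) z = 0.
Proof.
move=> z0; have ii : iunit * iunit = -1 :> Cplx R.
  by rewrite /iunit; apply/eqP; rewrite eq_complex /=; apply/andP; split; apply/eqP; ring.
have [_ c1] := green12_cvg v v z0.
have [_ c2] := green12_cvg (iunit *: v) (iunit *: v) z0.
have c3 : (fun k => - complex.Re (nlogder2 k z v v)) @ \oo -->
    green2 (iunit *: v) (iunit *: v) z.
  have -> : (fun k => - complex.Re (nlogder2 k z v v)) =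
    (fun k => complex.Re (nlogder2 k z (iunit *: v) (iunit *: v))).
    by apply/funext => k; rewrite /nlogder2 logder2Z ii !mulNr mul1r ReN.
  exact: c2.
by rewrite -(cvg_lim _ c3) // (cvg_lim _ (cvgN c1)) // subrr.
Qed.

Lemma pluriharmonic_green (O : set (C2 R)) :
  (forall z, O z <-> 0 < green q b e z) -> pluriharmonic O (green q b e).
Proof.
move=> OP; split.
rewrite openE => z /OP z0; rewrite /interior.
  by apply: filterS (near_green_gt0 z0) => x /OP.
split=> [v z /OP z0|v w z /OP z0].
    split; first by have [] := real_derive_green v z0.
    apply: (eq_near_continuous (continuous_green1 (v := v) z0)).
    by apply: filterS (near_green_gt0 z0) => x x0; have [_ ->] := real_derive_green v x0.
  split; first by have [] := real_derive_green1 v w z0.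
  have nq : \forall x \near z,
      green2 v w x = real_derive (real_derive (green q b e) v) w x.
    by apply: filterS (near_green_gt0 z0) => x x0; have [_ ->] := real_derive_green1 v w x0.
  exact: (eq_near_continuous (continuous_green2 (v := v) (w := w) z0) nq).
move=> z v /OP z0.
have [_ ->] := real_derive_green1 v v z0.
have [_ ->] := real_derive_green1 (iunit *: v) (iunit *: v) z0.
exact: green2_laplace.
Qed.

End Pluriharmonic.

(** * Henon maps as recurrences *)

Section Flattening.
Context {R : realType} {T : Type} {m : nat}.
Variables (d : 'I_m -> nat) (p : 'I_m -> T -> {poly Cplx R})
  (a : 'I_m -> T -> Cplx R) (j0 : 'I_m) (s : bool).
Implicit Types (L : nat -> T) (z w : C2 R) (l : T).

(** The inverse of a Henon map is, after the exchange of the coordinates, the Henon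
    map of [p / a] and [1 / a]; the exchange puts both signs in one setting. *)
Definition swap_if z : C2 R := if s then (z.2, z.1) else z.

Definition order : seq 'I_m := if s then rev (enum 'I_m) else enum 'I_m.

(** The time [n * m + i] of the recurrence applies the [i]-th factor of the map of
    parameter [L n]. The index is below [size order = m], so that the default [j0]
    is never read. *)
Definition stage n : 'I_m := nth j0 order (n %% m).

Definition stage_poly L n : {poly Cplx R} :=
  let j := stage n in let l := L (n %/ m)%N in
  if s then (a j l)^-1 *: p j l else p j l.

Definition stage_jac L n : Cplx R :=
  let j := stage n in let l := L (n %/ m)%N in
  if s then (a j l)^-1 else a j l.

Definition stage_deg n : nat := d (stage n).

Definition stage_map (l : T) w (j : 'I_m) : C2 R :=
  if s then henon_inv (p j l) (a j l) w else henon (p j l) (a j l) w.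

Lemma henon_sgn_foldl l z : henon_sgn p a s l z = foldl (stage_map l) z order.
Proof.
rewrite /henon_sgn /order /stage_map; case: s => //.
by rewrite foldl_rev.
Qed.

Lemma size_order : size order = m.
Proof. by rewrite /order; case: s; rewrite ?size_rev size_enum_ord. Qed.

Lemma henon_stage L n w :
  henon (stage_poly L n) (stage_jac L n) (swap_if w) =
  swap_if (stage_map (L (n %/ m)%N) w (stage n)).
Proof.
rewrite /henon /stage_poly /stage_jac /swap_if /stage_map; case: s => //=.
rewrite hornerZ /henon_inv /=; congr pair.
by rewrite -mulrBr mulrC.
Qed.

Lemma iterH_orb n L z : swap_if (iterH p a s n L z) =
  orb (stage_poly L) (stage_jac L) (n * m) (swap_if z).
Proof.
elim: n => [|n IH] //; rewrite mulSn addnC /=.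
have key i : (i <= m)%N -> orb (stage_poly L) (stage_jac L) (n * m + i) (swap_if z) =
    swap_if (foldl (stage_map (L n)) (iterH p a s n L z) (take i order)).
  elim: i => [|i IHi] im; first by rewrite addn0 take0 -IH.
  rewrite addnS /= (IHi (ltnW im)) henon_stage.
  rewrite (take_nth j0) ?size_order // foldl_rcons.
  have m0 : (0 < m)%N by exact: leq_ltn_trans im.
  by rewrite divnMDl // divn_small // addn0 /stage modnMDl modn_small.
by rewrite key // take_oversize ?size_order // henon_sgn_foldl.
Qed.

Lemma degs_stage n : degs stage_deg (n * m) = ((\prod_j d j) ^ n)%N.
Proof.
elim: n => [|n IH]; first by rewrite /degs big_ord0 expn0.
rewrite mulSn addnC /degs big_split_ord /= -/(degs _ _) IH expnSr; congr (_ * _)%N.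
transitivity (\prod_(j <- order) d j)%N.
  rewrite [RHS](big_nth j0) size_order big_mkord; apply: eq_bigr => i _.
  by rewrite /stage_deg /stage modnMDl modn_small.
rewrite /order -big_enum /=; case: s => //.
by apply: perm_big; rewrite perm_rev.
Qed.

Lemma csup_swap_if z : csup (swap_if z) = csup z.
Proof. by rewrite /swap_if /csup; case: s => //=; rewrite maxC. Qed.

Lemma iterH_cons n l L z : iterH p a s n L (henon_sgn p a s l z) =
  iterH p a s n.+1 (seq_cons l L) z.
Proof. by elim: n => //= n ->. Qed.

Lemma logpE (t : R) : 0 <= t -> logp t = ln (Num.max 1 t).
Proof.
rewrite /logp le_eqVlt => /orP[/eqP <-|t0].
  by rewrite ln0 // maxxx (max_idPl _) ?ln1.
have [t1|t1] := leP t 1.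
  by rewrite ln1; apply: max_idPr; rewrite ln_le0.
by apply: max_idPl; rewrite ln_ge0 // ltW.
Qed.

(** The norms [enorm] and [csup] agree up to the factor [2]. *)
Lemma greenn_loggrowth n L z : (forall k, (0 < stage_deg k)%N) ->
  `|greenn d p a s n L z
     - loggrowth (stage_poly L) (stage_jac L) stage_deg (n * m) (swap_if z)|
  <= ln 2 / (degs stage_deg (n * m))%:R.
Proof.
move=> d0; rewrite /greenn /loggrowth -iterH_orb degs_stage.
have D0 : 0 < ((\prod_j d j) ^ n)%N%:R :> R.
  by rewrite -degs_stage ltr0n /degs; apply: prodn_gt0 => i.
rewrite -mulrBl normrM [X in _ * X]gtr0_norm ?invr_gt0 //.
rewrite ler_wpM2r ?invr_ge0 ?(ltW D0) //.
set w := iterH p a s n L z.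
have -> : height (swap_if w) = height w by rewrite /height csup_swap_if.
have e0 : 0 <= enorm w by exact: sqrtr_ge0.
rewrite logpE //; have h1 := height_ge1 w.
have h2 : height w <= Num.max 1 (enorm w).
  by apply: height_le; rewrite ?le_max ?lexx // csup_enorm orbT.
have h3 : Num.max 1 (enorm w) <= 2 * height w.
  rewrite ge_max; apply/andP; split; first lra.
  apply: le_trans (enorm_csup w) _; rewrite ler_wpM2l //; exact: height_csup.
have p1 : 0 < height w by lra.
have p2 : 0 < Num.max 1 (enorm w) by lra.
rewrite ger0_norm ?subr_ge0 ?ler_ln ?posrE // lerBlDr -lnM ?posrE //.
by rewrite ler_ln ?posrE // mulr_gt0.
Qed.

End Flattening.

(** * Invariance under the exchange of coordinates *)

Section Swap.
Context {R : realType} (s : bool).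
Implicit Types (z w v : C2 R) (u : C2 R -> R).

Lemma swap_ifD z w : swap_if s (z + w) = swap_if s z + swap_if s w.
Proof. by rewrite /swap_if; case: s. Qed.

Lemma swap_ifB z w : swap_if s (z - w) = swap_if s z - swap_if s w.
Proof. by rewrite /swap_if; case: s. Qed.

Lemma swap_ifZ (c : Cplx R) z : swap_if s (c *: z) = c *: swap_if s z.
Proof. by rewrite /swap_if; case: s. Qed.

Lemma enorm_swap_if z : enorm (swap_if s z) = enorm z.
Proof. by rewrite /enorm /swap_if; case: s => //=; rewrite addrC. Qed.

Lemma continuous_swap_if : continuous (@swap_if R s).
Proof.
move=> z; apply/cvg_csupP => e e0; apply: filterS (near_csup z e0) => w.
by rewrite -swap_ifB csup_swap_if.
Qed.

Lemma locally_holder_swap_if u : locally_holder u ->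
  locally_holder (fun z => u (swap_if s z)).
Proof.
move=> hu z; have [alpha alpha01 [c cP]] := hu (swap_if s z).
exists alpha => //; exists c.
case: cP => -[V W] /= [nV nW] VW.
exists (swap_if s @^-1` V, swap_if s @^-1` W) => /=.
  by split; exact: continuous_swap_if.
move=> [z1 z2] /= [h1 h2]; have := VW (swap_if s z1, swap_if s z2) (conj h1 h2).
by rewrite /= -swap_ifB enorm_swap_if.
Qed.

Lemma plurisubharmonic_swap_if u : plurisubharmonic (fun z => (u z)%:E) ->
  plurisubharmonic (fun z => (u (swap_if s z))%:E).
Proof.
move=> [lsc fin mean]; split.
move=> z c cz; have [V nV VP] := lsc (swap_if s z) c cz.
exists (swap_if s @^-1` V); first exact: continuous_swap_if.
by move=> w; exact: VP.
by move=> z; exact: fin.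
move=> z v; have := mean (swap_if s z) (swap_if s v).
congr (_ <= _ * _)%E; apply: eq_integral => t _.
by rewrite swap_ifD swap_ifZ.
Qed.

Let swap_line u v z : (fun t : R => u (swap_if s (z + toC t *: v))) =
  (fun t : R => u (swap_if s z + toC t *: swap_if s v)).
Proof. by apply/funext => t; rewrite swap_ifD swap_ifZ. Qed.

Lemma real_derivable_swap_if u v z :
  real_derivable (fun w => u (swap_if s w)) v z =
  real_derivable u (swap_if s v) (swap_if s z).
Proof. by rewrite /real_derivable swap_line. Qed.

Lemma real_derive_swap_if u v :
  real_derive (fun w => u (swap_if s w)) v =
  (fun z => real_derive u (swap_if s v) (swap_if s z)).
Proof. by apply/funext => z; rewrite /real_derive swap_line. Qed.

Lemma classC1_swap_if O u : classC1 O u ->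
  classC1 (swap_if s @^-1` O) (fun z => u (swap_if s z)).
Proof.
move=> hu v z Oz; have [h1 h2] := hu (swap_if s v) _ Oz.
split; first by rewrite (real_derivable_swap_if u v z).
rewrite (real_derive_swap_if u v).
by apply: continuous_comp h2; exact: continuous_swap_if.
Qed.

Lemma pluriharmonic_swap_if O u : pluriharmonic O u ->
  pluriharmonic (swap_if s @^-1` O) (fun z => u (swap_if s z)).
Proof.
move=> [oO [c1 c2] lap]; split.
by apply: open_comp => // z _; exact: continuous_swap_if.
split; first exact: classC1_swap_if.
by move=> v; rewrite (real_derive_swap_if u v); apply: classC1_swap_if; exact: c2.
have h v w z : real_derive (real_derive (fun x => u (swap_if s x)) v) w z =
    real_derive (real_derive u (swap_if s v)) (swap_if s w) (swap_if s z).
  rewrite (real_derive_swap_if u v).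
  by move: (real_derive u (swap_if s v)) => f; rewrite (real_derive_swap_if f w).
by move=> z v Oz; rewrite (h v v z) (h _ _ z) swap_ifZ; exact: lap.
Qed.

End Swap.

(** * Uniformity over the parameter space *)

Lemma compact_cabs_bounded {R : realType} {T : topologicalType} (M : set T)
    (f : T -> Cplx R) : compact M -> {within M, continuous f} ->
  exists B, forall l, M l -> cabs (f l) <= B.
Proof.
move=> cM cf; have : compact ((fun l => cabs (f l)) @` M).
  apply: continuous_compact cM; move=> x; apply: cvg_cabs; exact: cf.
move=> /compact_bounded[B [_ HB]]; exists (B + 1) => l Ml.
have : `|cabs (f l)| <= B + 1 by apply: HB; [rewrite ltrDl|exists l].
by apply: le_trans; exact: ler_norm.
Qed.

Lemma compact_cabs_bounded_fam {R : realType} {T : topologicalType}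
    (I : finType) (M : set T) (f : I -> T -> Cplx R) :
  compact M -> (forall i, {within M, continuous (f i)}) ->
  exists2 B, 1 <= B & forall i l, M l -> cabs (f i l) <= B.
Proof.
move=> cM cf.
have [B BP] := choice (fun i => compact_cabs_bounded cM (cf i)).
exists (1 + \sum_i `|B i|); first by rewrite lerDl sumr_ge0.
move=> i l Ml; apply: le_trans (BP i l Ml) _; rewrite (bigD1 i) //=.
apply: le_trans (ler_norm _) _; rewrite addrCA lerDl addr_ge0 // sumr_ge0 //.
Qed.

Lemma family_compact_cvg {R : realType} {U : topologicalType}
    {I : Type} (F : set_system I) {FF : Filter F} (f : I -> U -> R) (g : U -> R) :
  (forall K, compact K -> forall e, 0 < e ->
     \forall i \near F, forall z, K z -> `|g z - f i z| < e) ->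
  {family compact, f @ F --> g}.
Proof.
move=> H; apply/fam_cvgP => K cK P /uniform_nbhs[V [entV VP]].
move: entV; rewrite -entourage_from_ballE => -[e /= e0 eV].
have : F [set i | P (f i)].
  apply: filterS (H K cK e e0) => i Hi; apply: VP => z Kz.
  by apply: eV; exact: Hi.
by [].
Qed.

(** * Green functions of random iterates *)

Section RandomIterates.
Context {R : realType} {T : topologicalType} {M : set T} {m : nat}
  {d : 'I_m -> nat} {p : 'I_m -> T -> {poly Cplx R}} {a : 'I_m -> T -> Cplx R}.
Variable j0 : 'I_m.
Hypotheses (M_compact : compact M) (d_ge2 : forall j, (2 <= d j)%N)
  (p_monic : forall j l, M l -> p j l \is monic)
  (p_deg : forall j l, M l -> size (p j l) = (d j).+1)
  (p_cont : forall j (i : nat), {within M, continuous (fun l => (p j l)`_i)})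
  (a_cont : forall j, {within M, continuous (a j)})
  (a_neq0 : forall j l, M l -> a j l != 0).

Let Seq := prod_topology (fun _ : nat => T).
Let X : set Seq := [set L | forall n, M (L n)].

Definition random_green (s : bool) (L : nat -> T) (z : C2 R) : R :=
  green (stage_poly p a j0 s L) (stage_jac a j0 s L) (stage_deg d j0 s)
    (swap_if s z).

Lemma within_inv_jac j : {within M, continuous (fun l => (a j l)^-1)}.
Proof.
apply/subspace_continuousP => l Ml; apply: cvgV; first exact: a_neq0.
by have /subspace_continuousP := @a_cont j; apply.
Qed.

(** The coefficients and the Jacobians are bounded on the compact set of
    parameters, and so are the inverses of the Jacobians: all the recurrences
    lie in one class. *)
Lemma uniform_recurrence_class : exists A E, forall s L, X L ->
  recurrence_class A E (stage_poly p a j0 s L) (stage_jac a j0 s L)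
    (stage_deg d j0 s).
Proof.
pose E := (\max_j d j)%N.
have dE j : (d j <= E)%N by exact: (leq_bigmax j).
have [A1 A11 A1P] := compact_cabs_bounded_fam
  (I := ('I_m * 'I_E.+1)%type) (f := fun i l => (p i.1 l)`_i.2) M_compact
  (fun i => @p_cont i.1 i.2).
have [A2 A21 A2P] := compact_cabs_bounded_fam M_compact (fun j => @a_cont j).
have [A3 A31 A3P] := compact_cabs_bounded_fam M_compact (fun j => @within_inv_jac j).
(* the square is for the coefficients of [p / a], products of two bounded terms *)
pose B := A1 + A2 + A3; exists (B ^+ 2), E => s L XL k.
rewrite /stage_poly /stage_jac /stage_deg.
move: (stage j0 s k) (XL (k %/ m)%N) => j; move: (L (k %/ m)%N) => l Ml.
have B1 : 1 <= B by rewrite /B; lra.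
have coefB i : cabs (p j l)`_i <= B.
  have [iE|Ei] := ltnP i E.+1.
    by apply: le_trans (A1P (j, Ordinal iE) l Ml) _; rewrite /B; lra.
  rewrite nth_default ?cabs0; first lra.
  by rewrite p_deg // (leq_trans _ Ei) // ltnS dE.
have aB : cabs (a j l) <= B by apply: le_trans (A2P j l Ml) _; rewrite /B; lra.
have vB : cabs (a j l)^-1 <= B by apply: le_trans (A3P j l Ml) _; rewrite /B; lra.
have lead : (p j l)`_(d j) = 1.
  by have /monicP := p_monic j Ml; rewrite lead_coefE p_deg.
have BB : B <= B ^+ 2 by rewrite expr2 ler_peMl //; lra.
have v0 : 0 < cabs (a j l) by rewrite cabs_gt0 a_neq0.
clearbody B; split.
by rewrite d_ge2 dE.
by case: s => //; rewrite ?size_scale ?invr_eq0 ?a_neq0 // p_deg.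
move=> i; case: s; last exact: le_trans BB.
by rewrite coefZ cabsM expr2; apply: ler_pM; rewrite ?cabs_ge0.
case: s; last by rewrite lead cabs1 mulr1; lra.
rewrite coefZ lead mulr1 cabsV ler_pdivlMr // mul1r.
exact: le_trans BB.
by case: s; exact: le_trans BB.
Qed.

Lemma stage_deg_gt0 s k : (0 < stage_deg d j0 s k)%N.
Proof. exact: leq_trans (d_ge2 _). Qed.

Let m_gt0 : (0 < m)%N.
Proof. exact: leq_ltn_trans (ltn_ord j0). Qed.

Section Sequence.
Context {A : R} {E : nat}.
Hypothesis H : forall s L, X L ->
  recurrence_class A E (stage_poly p a j0 s L) (stage_jac a j0 s L)
    (stage_deg d j0 s).

Lemma random_green_err s L n R0 z : X L -> escape_radius A E <= R0 -> csup z <= R0 ->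
  `|random_green s L z - greenn d p a s n L z| <=
  (ln 2 + ln (distortion A E R0)) / 2 ^+ n.
Proof.
move=> XL rR zR; have HL := H s XL.
have zR' : csup (swap_if s z) <= R0 by rewrite csup_swap_if.
have h1 := green_err HL (n * m) rR zR'.
have h2 := greenn_loggrowth p a n L z (stage_deg_gt0 s).
have pw : (2 : R) ^+ n <= 2 ^+ (n * m) by rewrite ler_weXn2l ?ler1n ?leq_pmulr.
have p0 : (0 : R) < 2 ^+ n by rewrite exprn_gt0.
have h3 : ln (distortion A E R0) / 2 ^+ (n * m) <= ln (distortion A E R0) / 2 ^+ n.
  rewrite ler_wpM2l ?ln_ge0 ?(distortion_ge1 HL) //.
  by rewrite lef_pV2 ?posrE ?exprn_gt0.
have h4 : ln 2 / (degs (stage_deg d j0 s) (n * m))%:R <= ln 2 / 2 ^+ n :> R.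
  rewrite ler_wpM2l ?ln_ge0 ?ler1n //.
  rewrite lef_pV2 ?posrE ?exprn_gt0 ?(degsR_gt0 HL) //.
  exact: le_trans pw (degs_ge HL _).
rewrite mulrDl [leRHS]addrC.
apply: le_trans (ler_distD _ _ _) (lerD (le_trans h1 h3) _).
by rewrite distrC; exact: le_trans h4.
Qed.

Lemma greenn_cvg_compact s L : X L ->
  {family compact, (fun n : nat => greenn d p a s n L) @ \oo --> random_green s L}.
Proof.
move=> XL; apply: family_compact_cvg => K /compact_csup[B BP] e e0.
pose R0 := Num.max (escape_radius A E) B.
have rR : escape_radius A E <= R0 by rewrite le_max lexx.
have BR : B <= R0 by rewrite le_max lexx orbT.
apply: filterS (geometric_small (ln 2 + ln (distortion A E R0)) e0) => n ne z Kz.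
exact: le_lt_trans (random_green_err s n XL rR (le_trans (BP z Kz) BR)) ne.
Qed.

Lemma greenn_cvg s L z : X L ->
  (fun n => greenn d p a s n L z) @ \oo --> random_green s L z.
Proof.
move=> XL; apply/cvgrPdist_lt => e e0.
pose R0 := Num.max (escape_radius A E) (csup z).
have rR : escape_radius A E <= R0 by rewrite le_max lexx.
have zR : csup z <= R0 by rewrite le_max lexx orbT.
apply: filterS (geometric_small (ln 2 + ln (distortion A E R0)) e0) => n ne.
exact: le_lt_trans (random_green_err s n XL rR zR) ne.
Qed.

(** Shifting the sequence turns an iterate of order [n] after the first map into an
    iterate of order [n + 1]. *)
Lemma random_green_functional s L l z : X L -> M l ->
  random_green s L (henon_sgn p a s l z) =
  (\prod_j d j)%N%:R * random_green s (seq_cons l L) z.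
Proof.
move=> XL Ml; have XlL : X (seq_cons l L) by case.
have D0 : (\prod_j d j)%N%:R != 0 :> R.
  by rewrite pnatr_eq0 -lt0n prodn_gt0 // => j; exact: leq_trans (d_ge2 j).
apply: (@cvg_unique _ (@Rhausdorff R) ((fun n => greenn d p a s n L (henon_sgn p a s l z)) @ \oo)).
  exact: greenn_cvg.
have -> : (fun n => greenn d p a s n L (henon_sgn p a s l z)) =
    (fun n => (\prod_j d j)%N%:R * greenn d p a s n.+1 (seq_cons l L) z).
  apply/funext => n; rewrite /greenn iterH_cons expnS natrM invfM.
  by rewrite mulrCA mulVKf // mulrC.
apply: cvgMr; have := @greenn_cvg s (seq_cons l L) z XlL.
by rewrite -cvg_shiftS.
Qed.

(** Boundedness along the multiples of [m] suffices: an orbit which escapes tends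
    to infinity along all times. *)
Lemma Kset_never_escaping s L z : X L -> Kset p a s L z <->
  forall k, ~ escaping A E
    (orb (stage_poly p a j0 s L) (stage_jac a j0 s L) k (swap_if s z)).
Proof.
move=> XL; split=> [[B BP] k ek|nesc].
  have [N NP] := escaping_unbounded (H s XL) B ek.
  have := NP (N * m)%N (leq_pmulr _ m_gt0); rewrite -iterH_orb csup_swap_if.
  by have := le_trans (csup_enorm _) (BP N); rewrite leNgt => /negP.
have [[B BP] _] := never_escaping_bounded (H s XL) nesc.
exists (2 * B) => n; apply: le_trans (enorm_csup _) _; rewrite ler_wpM2l //.
by have := BP (n * m)%N; rewrite -iterH_orb csup_swap_if.
Qed.

Lemma notin_KsetP s L z : X L -> ~ Kset p a s L z <-> 0 < random_green s L z.
Proof.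
move=> XL; rewrite /random_green (green_gt0P (H s XL)) (Kset_never_escaping s z XL).
split=> [|[k ek] h]; last exact: h ek.
by move=> nall; apply: contrapT => /forallNP; exact: nall.
Qed.

Lemma in_KsetP s L z : X L -> random_green s L z = 0 <-> Kset p a s L z.
Proof.
move=> XL; split=> [g0|Kz].
  by apply: contrapT => /(notin_KsetP s z XL); rewrite g0 ltxx.
apply/eqP; rewrite eq_le; apply/andP; split; last exact: (green_ge0 (H s XL)).
by rewrite leNgt; apply/negP => /(notin_KsetP s z XL).
Qed.

Lemma locally_holder_random_green s L : X L -> locally_holder (random_green s L).
Proof.
by move=> XL; apply: locally_holder_swap_if; exact: locally_holder_green (H s XL).
Qed.

Lemma plurisubharmonic_random_green s L : X L ->
  plurisubharmonic (fun z => (random_green s L z)%:E).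
Proof.
move=> XL; apply: plurisubharmonic_swap_if.
exact: plurisubharmonic_green (H s XL).
Qed.

Lemma pluriharmonic_random_green s L : X L ->
  pluriharmonic (~` Kset p a s L) (random_green s L).
Proof.
move=> XL; pose g := green (stage_poly p a j0 s L) (stage_jac a j0 s L)
  (stage_deg d j0 s).
have -> : ~` Kset p a s L = swap_if s @^-1` [set w | 0 < g w].
  by apply/seteqP; split=> z /(notin_KsetP s z XL).
have hg : pluriharmonic [set w | 0 < g w] g by exact: (pluriharmonic_green (H s XL)).
exact: pluriharmonic_swap_if hg.
Qed.

Lemma cvg_coordinate (f : T -> Cplx R) (L : Seq) n :
  {within M, continuous f} -> X L ->
  (fun L' : Seq => f (L' n)) @ within X (nbhs L) --> f (L n).
Proof.
move=> /subspace_continuousP cf XL P /(cf _ (XL n)) fP.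
have h : nbhs L [set L' : Seq | M (L' n) -> P (f (L' n))].
  exact: (@proj_continuous nat (fun=> T) n L _ fP).
have : nbhs L [set L' : Seq | X L' -> P (f (L' n))].
  by apply: filterS h => L' h XL'; exact: h (XL' n).
by [].
Qed.

Lemma cvg_stage_poly s (L : Seq) k i : X L ->
  (fun L' : Seq => (stage_poly p a j0 s L' k)`_i) @ within X (nbhs L) -->
  (stage_poly p a j0 s L k)`_i.
Proof.
move=> XL; rewrite /stage_poly; case: s; last exact: cvg_coordinate (@p_cont _ _) XL.
under eq_cvg do rewrite coefZ; rewrite coefZ; apply: cvgM.
  exact: cvg_coordinate (@within_inv_jac _) XL.
exact: cvg_coordinate (@p_cont _ _) XL.
Qed.

Lemma cvg_stage_jac s (L : Seq) k : X L ->
  (fun L' : Seq => stage_jac a j0 s L' k) @ within X (nbhs L) -->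
  stage_jac a j0 s L k.
Proof.
move=> XL; rewrite /stage_jac; case: s; last exact: cvg_coordinate (@a_cont _) XL.
exact: cvg_coordinate (@within_inv_jac _) XL.
Qed.

(** Joint continuity in the point and in the sequence gives local uniformity in
    the point, by compactness. *)
Lemma continuous_random_green s :
  {within X, continuous (random_green s : Seq -> {family compact, C2 R -> R})}.
Proof.
apply/subspace_continuousP => L XL; apply: family_compact_cvg => K cK e e0.
have e2 : 0 < e / 2 by rewrite divr_gt0.
apply: ((compact_near_coveringP K).1 cK _ _
  (fun (L' : Seq) z => `|random_green s L z - random_green s L' z| < e)) => z Kz.
have near1 : \forall z' \near z, `|random_green s L z - random_green s L z'| < e / 2.
  have : random_green s L @ z --> random_green s L z.
    apply: (@continuous_comp _ _ _ (swap_if s)); first exact: continuous_swap_if.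
    exact: continuous_green (H s XL) _.
  by move/cvgrPdist_lt/(_ _ e2).
have joint : (fun t : C2 R * Seq => random_green s t.2 t.1) @
    (filter_prod (nbhs z) (within X (nbhs L))) --> random_green s L z.
  have c2 := @cvg_snd _ _ (nbhs z) (within X (nbhs L)) _.
  apply: (cvg_green (A := A) (E := E) (q_ := fun t : C2 R * Seq => stage_poly p a j0 s t.2)
     (b_ := fun t : C2 R * Seq => stage_jac a j0 s t.2)
     (z_ := fun t : C2 R * Seq => swap_if s t.1)).
  exact: H.
  have nX : filter_prod (nbhs z) (within X (nbhs L)) [set t | X t.2].
    by apply: c2; exact: withinT.
  by apply: filterS nX => t; exact: H.
  by move=> k i P nP; exact: c2 (@cvg_stage_poly s L k i XL P nP).
  by move=> k P nP; exact: c2 (@cvg_stage_jac s L k XL P nP).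
  by move=> P nP; exact: (@cvg_fst _ _ (nbhs z) (within X (nbhs L)) _ _ (@continuous_swap_if R s z P nP)).
have near2 : \forall t \near filter_prod (nbhs z) (within X (nbhs L)),
    `|random_green s L z - random_green s L t.1| < e / 2.
  exact: (@cvg_fst _ _ (nbhs z) (within X (nbhs L)) _ _ near1).
move/cvgrPdist_lt/(_ _ e2): joint; apply: filterS2 near2 => t.
rewrite !ltr_norml => /andP[? ?] /andP[? ?]; apply/andP; split; lra.
Qed.

End Sequence.
End RandomIterates.

Theorem theorem1p5 (R : realType) (k : nat) (M : set 'rV[Cplx R]_k)
    (m : nat) (d : 'I_m -> nat)
    (p : 'I_m -> 'rV[Cplx R]_k -> {poly Cplx R})
    (a : 'I_m -> 'rV[Cplx R]_k -> Cplx R)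
    (M_compact : compact M)
    (m_ge1 : (1 <= m)%N)
    (d_ge2 : forall j, (2 <= d j)%N)
    (p_monic : forall j l, M l -> p j l \is monic)
    (p_deg : forall j l, M l -> size (p j l) = (d j).+1)
    (p_cont : forall j (i : nat), {within M, continuous (fun l => (p j l)`_i)})
    (a_cont : forall j, {within M, continuous (a j)})
    (a_neq0 : forall j l, M l -> a j l != 0) :
  let Seq := prod_topology (fun _ : nat => 'rV[Cplx R]_k) in
  let X : set Seq := [set L | forall n, M (L n)] in
  exists G : bool -> Seq -> C2 R -> R,
    forall s : bool,
      (forall L : Seq, X L ->
        [/\ {family compact,
              (fun n : nat => greenn d p a s n L) @ \oo --> G s L},
            locally_holder (G s L),
            plurisubharmonic (fun z => (G s L z)%:E),
            (forall l, M l -> forall z,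
              G s L (henon_sgn p a s l z) =
              (\prod_j d j)%N%:R * G s (seq_cons l L) z) &
            [/\ (forall z, ~ Kset p a s L z -> 0 < G s L z),
                pluriharmonic (~` Kset p a s L) (G s L) &
                (forall z, G s L z = 0 <-> Kset p a s L z)]])
      /\ {within X, continuous (G s : Seq -> {family compact, C2 R -> R})}.
Proof.
move=> Seq X; pose j0 : 'I_m := Ordinal m_ge1.
have [A [E H]] :=
  uniform_recurrence_class j0 M_compact d_ge2 p_monic p_deg p_cont a_cont a_neq0.
exists (@random_green R _ m d p a j0) => s; split; last first.
  exact: (continuous_random_green p_cont a_cont a_neq0 H).
move=> L XL; split.
exact: (greenn_cvg_compact d_ge2 H XL).
exact: (locally_holder_random_green H s XL).
exact: (plurisubharmonic_random_green H s XL).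
by move=> l Ml z; exact: (random_green_functional d_ge2 H s z XL Ml).
split.
by move=> z; move/(notin_KsetP H s z XL).
exact: (pluriharmonic_random_green H s XL).
by move=> z; exact: (in_KsetP H s z XL).
Qed.
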